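(* Let $n$ be an integer with $2\le n\le 7$ and let $c^*=\left(\tfrac92\right)^{1/3}$. For $c>0$ consider the initial value problem $$(1-\eta^2)\frac{d^2v}{d\eta^2}+\left(\frac{n-1}{\eta}-\frac23\eta\right)\frac{dv}{d\eta}+\frac29 v-\frac1{v^2}=0,\qquad v(0)=c,\quad \frac{dv}{d\eta}(0)=0 .$$ (a) There exists a discrete set of initial values $c=c_j$, $j\in\mathbb N$, with $0<c_j<c^*$ and $c_j\to0^+$ as $j\to\infty$, such that for each $j$ the initial value problem with $c=c_j$ has a non-trivial smooth global solution $v_j$, i.e. a positive, non-constant solution that is smooth on $[0,\infty)$ (in particular across $\eta=1$). (b) The solutions $v_j$ satisfy $v_j(\eta)\sim a\,\eta^{2/3}$ for $c_j^{3/2}\ll\eta\ll1$, where $a=\left[\tfrac23\left(n-\tfrac43\right)\right]^{-1/3}$, and $v_j(\eta)\sim b_j\,\eta^{2/3}$ as $\eta\to\infty$, where $b_j$ is a constant depending on $n$ and $j$.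
   Context: The ordinary differential equation is the equation satisfied by $v$ when $u(r,t)=(T_{\max}-t)^{2/3}v(\eta)$, $\eta=r/(T_{\max}-t)$, is a radial self-similar solution of $u_{tt}=\Delta u-u^{-2}$ in $\mathbb R^n$. The constant function $v\equiv c^*$ is the trivial solution. Solutions are required to be positive. ''$v_j(\eta)\sim a\eta^{2/3}$ for $c_j^{3/2}\ll\eta\ll1$'' means: for every $\varepsilon>0$ there are $M>0$, $\delta>0$, $J\in\mathbb N$ such that $\left|\frac{v_j(\eta)}{a\eta^{2/3}}-1\right|<\varepsilon$ for all $j\ge J$ and all $\eta$ with $Mc_j^{3/2}\le\eta\le\delta$. ''$v_j(\eta)\sim b_j\eta^{2/3}$ as $\eta\to\infty$'' means $v_j(\eta)/(b_j\eta^{2/3})\to1$ as $\eta\to\infty$. *)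

(* Defs.v *)
From Stdlib Require Import Reals.
From Coquelicot Require Import Coquelicot.
Open Scope R_scope.

(** [D k] is the [k]-th derivative of [v] on [[0, +oo)], one-sided at [0].
    The values of [v] at negative arguments are irrelevant. *)
Definition derivatives_on_halfline (v : R -> R) (D : nat -> R -> R) : Prop :=
  (forall x, 0 <= x -> D 0%nat x = v x) /\
  (forall k x, 0 <= x -> D_in (D k) (D (S k)) (Rle 0) x).

(** The equation is imposed for [eta > 0] only, because of the factor
    [(n - 1) / eta]; at [eta = 0] the initial conditions take over. *)
Definition smooth_global_solution (n : nat) (c : R) (v : R -> R) : Prop :=
  exists D : nat -> R -> R,
    derivatives_on_halfline v D /\
    (forall eta, 0 <= eta -> 0 < v eta) /\
    (forall eta, 0 < eta ->
       (1 - eta ^ 2) * D 2%nat eta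
       + ((INR n - 1) / eta - 2 / 3 * eta) * D 1%nat eta
       + 2 / 9 * v eta - 1 / v eta ^ 2 = 0) /\
    v 0 = c /\ D 1%nat 0 = 0.

Definition non_constant (v : R -> R) : Prop :=
  ~ exists k : R, forall eta, 0 <= eta -> v eta = k.

Definition discrete_set (S : R -> Prop) : Prop :=
  forall x, S x ->
    exists eps, 0 < eps /\ forall y, S y -> Rabs (y - x) < eps -> y = x.

Definition c_star : R := Rpower (9 / 2) (1 / 3).

Definition a_coef (n : nat) : R :=
  Rpower (2 / 3 * (INR n - 4 / 3)) (- (1 / 3)).

(** [v j eta ~ a * eta ^ (2/3)] for [(c j) ^ (3/2) << eta << 1]. *)
Definition intermediate_asymptotics
    (c : nat -> R) (v : nat -> R -> R) (a : R) : Prop :=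
  forall eps, 0 < eps ->
    exists (M delta : R) (J : nat), 0 < M /\ 0 < delta /\
      forall (j : nat) (eta : R), (J <= j)%nat ->
        M * Rpower (c j) (3 / 2) <= eta <= delta ->
        Rabs (v j eta / (a * Rpower eta (2 / 3)) - 1) < eps.

(** [v eta ~ b * eta ^ (2/3)] as [eta] tends to [+oo]. *)
Definition asymptotics_at_infinity (v : R -> R) (b : R) : Prop :=
  b <> 0 /\
  is_lim (fun eta => v eta / (b * Rpower eta (2 / 3))) p_infty 1.

(* Main.v *)
Require Import Defs.
From Stdlib Require Import Reals Lra Lia Psatz Classical IndefiniteDescription.
From Coquelicot Require Import Coquelicot.
Open Scope R_scope.

(** Write [v = eta ^ (2/3) * w] and [s = ln eta].  The equation becomes
    [(1 - eta ^ 2) w_ss + (d - eta ^ 2) w_s + F' w = 0] with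
    [F w = k w ^ 2 / 2 + 1 / w], [d = n - 2/3], [k = (2/3) (n - 4/3)].  The constant
    [w = a], the minimum of the convex function [F], is the singular solution
    [v = a * eta ^ (2/3)].  The energy [(1 - eta ^ 2) w_s ^ 2 / 2 + F w] has derivative
    exactly [- d * w_s ^ 2], so for [eta < 1] it bounds [w] away from [0] and decreases.

    Solutions regular at the centre depend, up to scaling, on [mu = c ^ 3] only, and
    this dependence is Lipschitz down to [mu = 0], where the equation is autonomous in
    [s] and a Lyapunov function drives [(w, w_s)] to [(a, 0)].  Hence for small [c]
    the solution comes close to [(a, 0)] at [eta] of order [c ^ (3/2)], and the decay
    of the energy keeps it there as long as [eta] stays below a fixed number less than
    [1]: this is the intermediate asymptotics ([family_near_equilibrium]).

    The linearization at [(a, 0)] has a negative discriminant precisely because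
    [2 <= n <= 7] ([discriminant_neg]).  The angle of [(w - a, w_s)] therefore grows at a
    definite rate while [eta] runs from [c ^ (3/2)] to [1], and as [c] tends to [0] its
    value at a fixed [eta] is continuous in [c] and unbounded ([angle_unbounded]): the
    point [(w - a, w_s)] at this [eta] spirals into the origin.

    On the other side, in the variable [t = 1 - 1 / eta], the light cone is a Fuchsian
    singular point with exponents [0] and [(3 n + 1) / 6].  The second one is not an
    integer, so a unique smooth solution exists for each value of [w] at [eta = 1]; the
    power series is controlled by majorants ([fuchs_bound]), uniformly in the
    parameters ([fuchs_lipschitz]).  At a fixed [eta] slightly below [1] the Cauchy data
    of these solutions form a Lipschitz graph through the origin ([cone_inverse]).  The
    spiral crosses it for arbitrarily small [c] ([spiral_meets_graph]), and each
    crossing gives a solution smooth across [eta = 1].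

    Since [eta = infinity] is the regular point [t = 1], solutions that are close to
    [w = a] at the light cone remain so, and positive, up to infinity, and
    [w] has the positive limit [b] there ([exterior_solution]).  Uniqueness of the
    Cauchy problem glues the pieces smoothly ([matched_profile]); choosing crossings
    with rapidly decreasing [c] yields the discrete set. *)

(** * Absolutely convergent power series *)

(** Partial sums of the weighted l1 norm.  It is submultiplicative for the Cauchy
    product, which keeps the majorant estimates below free of combinatorics. *)
Definition wsum (rho : R) (u : nat -> R) (m : nat) : R :=
  sum_f_R0 (fun j => Rabs (u j) * rho ^ j) m.

Lemma wsum_succ rho u m :
  wsum rho u (S m) = wsum rho u m + Rabs (u (S m)) * rho ^ S m.
Proof. reflexivity. Qed.

Lemma wsum_split rho u m :
  wsum rho u (S m)
  = Rabs (u 0%nat) + rho * wsum rho (fun j => u (S j)) m.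
Proof.
unfold wsum; rewrite decomp_sum by lia; simpl pred.
rewrite scal_sum; simpl pow; rewrite Rmult_1_r; f_equal.
apply sum_eq; intros i _; ring.
Qed.

Lemma wsum_nonneg rho u m : 0 <= rho -> 0 <= wsum rho u m.
Proof.
intros hr; apply cond_pos_sum; intros j.
apply Rmult_le_pos; [apply Rabs_pos | now apply pow_le].
Qed.

Lemma wsum_mono rho u m : 0 <= rho -> wsum rho u m <= wsum rho u (S m).
Proof.
intros hr; rewrite wsum_succ.
generalize (Rmult_le_pos _ _ (Rabs_pos (u (S m))) (pow_le rho (S m) hr)); lra.
Qed.

Lemma wsum_triangle rho u v w m :
  0 <= rho -> (forall j, (j <= m)%nat -> Rabs (w j) <= Rabs (u j) + Rabs (v j)) ->
  wsum rho w m <= wsum rho u m + wsum rho v m.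
Proof.
intros hr h; unfold wsum; rewrite <- plus_sum.
apply sum_Rle; intros j hj; rewrite <- Rmult_plus_distr_r.
apply Rmult_le_compat_r; [now apply pow_le | now apply h].
Qed.

Lemma wsum_scal rho c u m :
  wsum rho (fun j => c * u j) m = Rabs c * wsum rho u m.
Proof.
unfold wsum; rewrite scal_sum; apply sum_eq; intros j _.
rewrite Rabs_mult; ring.
Qed.

Lemma wsum_mult rho u v m :
  0 <= rho ->
  wsum rho (PS_mult u v) m <= wsum rho u m * wsum rho v m.
Proof.
intros hr.
set (p := fun j => Rabs (u j) * rho ^ j).
set (q := fun j => Rabs (v j) * rho ^ j).
assert (hp : forall j, 0 <= p j)
  by (intros j; apply Rmult_le_pos; [apply Rabs_pos | now apply pow_le]).
assert (hq : forall j, 0 <= q j)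
  by (intros j; apply Rmult_le_pos; [apply Rabs_pos | now apply pow_le]).
assert (h1 : wsum rho (PS_mult u v) m
  <= sum_f_R0 (fun i => sum_f_R0 (fun j => p j * q (i - j)%nat) i) m).
{ apply sum_Rle; intros i _; unfold PS_mult.
  apply Rle_trans with
    (sum_f_R0 (fun j => Rabs (u j * v (i - j)%nat)) i * rho ^ i).
  - apply Rmult_le_compat_r; [now apply pow_le | apply Rsum_abs].
  - rewrite Rmult_comm, scal_sum; right; apply sum_eq; intros j hj.
    unfold p, q; rewrite Rabs_mult.
    replace (rho ^ i) with (rho ^ j * rho ^ (i - j))
      by (rewrite <- pow_add; f_equal; lia).
    ring. }
apply (Rle_trans _ _ _ h1).
destruct m as [|m].
- unfold wsum; simpl; unfold p, q; simpl; lra.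
- unfold wsum; fold p q; rewrite (cauchy_finite p q) by lia.
  assert (h2 : 0 <= sum_f_R0
    (fun i => sum_f_R0 (fun l => p (S (l + i)) * q (S m - l)%nat)
       (Init.Nat.pred (S m - i))) (Init.Nat.pred (S m))).
  { apply cond_pos_sum; intros i; apply cond_pos_sum; intros l.
    now apply Rmult_le_pos. }
  lra.
Qed.

Lemma series_bounded (u : nat -> R) (S : R) :
  (forall j, 0 <= u j) -> (forall m, sum_f_R0 u m <= S) ->
  ex_series u /\ Series u <= S.
Proof.
intros hu hS.
assert (hb : forall m, sum_n u m <= S) by (intros m; now rewrite sum_n_Reals).
assert (hinc : forall m, sum_n u m <= sum_n u (Datatypes.S m)).
{ intros m; rewrite sum_Sn; generalize (hu (Datatypes.S m)).
  unfold plus; simpl; lra. }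
destruct (ex_finite_lim_seq_incr (sum_n u) S hinc hb) as [l hl].
assert (hl' : is_series u l) by exact hl.
split; [now exists l |].
rewrite (is_series_unique _ _ hl').
apply (is_lim_seq_le (sum_n u) (fun _ => S) l S hb hl).
apply is_lim_seq_const.
Qed.

Lemma wsum_pow_le rho t u m :
  Rabs t <= rho ->
  sum_f_R0 (fun j => Rabs (u j * t ^ j)) m <= wsum rho u m.
Proof.
intros ht; apply sum_Rle; intros j _.
rewrite Rabs_mult; apply Rmult_le_compat_l; [apply Rabs_pos |].
rewrite <- RPow_abs; apply pow_incr; split; [apply Rabs_pos | exact ht].
Qed.

Section WeightedBound.

Variables (rho S : R) (u : nat -> R).
Hypothesis hrho : 0 < rho.
Hypothesis hS : forall m, wsum rho u m <= S.

Lemma wsum_cv_radius : Rbar_le rho (CV_radius u).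
Proof.
apply (CV_radius_bounded u); exists S; intros j.
assert (h := hS j).
assert (h2 : Rabs (u j) * rho ^ j <= wsum rho u j).
{ destruct j as [|j]; [unfold wsum; simpl; lra |].
  rewrite wsum_succ; generalize (wsum_nonneg rho u j); lra. }
rewrite Rabs_mult, (Rabs_pos_eq (rho ^ j)) by (apply pow_le; lra); lra.
Qed.

Lemma wsum_PSeries t : Rabs t <= rho -> Rabs (PSeries u t) <= S.
Proof.
intros ht.
destruct (series_bounded (fun j => Rabs (u j * t ^ j)) S) as [h1 h2].
- intros j; apply Rabs_pos.
- intros m; eapply Rle_trans; [now apply (wsum_pow_le rho) | apply hS].
- unfold PSeries; eapply Rle_trans; [now apply Series_Rabs | exact h2].
Qed.

(** Half of the radius pays for one derivative, because [j + 1 <= 2 ^ j]. *)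
Lemma wsum_PSeries_derive t :
  Rabs t <= rho / 2 -> Rabs (PSeries (PS_derive u) t) <= S / rho.
Proof.
intros ht.
assert (hj : forall j, INR (Datatypes.S j) <= 2 ^ j).
{ induction j as [|j IH]; [simpl; lra |].
  rewrite S_INR; simpl pow.
  assert (1 <= 2 ^ j) by (apply pow_R1_Rle; lra); lra. }
destruct (series_bounded (fun j => Rabs (PS_derive u j * t ^ j)) (S / rho))
  as [h1 h2].
- intros j; apply Rabs_pos.
- intros m; eapply Rle_trans; [apply (wsum_pow_le (rho / 2)); exact ht |].
  assert (h : wsum rho u (Datatypes.S m) <= S) by apply hS.
  rewrite wsum_split in h.
  assert (h' : wsum (rho / 2) (PS_derive u) m
               <= wsum rho (fun j => u (Datatypes.S j)) m).
  { apply sum_Rle; intros j _; unfold PS_derive.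
    rewrite Rabs_mult, Rabs_pos_eq by apply pos_INR.
    assert (h2j : 0 < 2 ^ j) by (apply pow_lt; lra).
    assert (hr : 0 < rho ^ j) by now apply pow_lt.
    unfold Rdiv; rewrite Rpow_mult_distr, pow_inv.
    replace (INR (Datatypes.S j) * Rabs (u (Datatypes.S j)) * (rho ^ j * / 2 ^ j))
      with (INR (Datatypes.S j) / 2 ^ j * (Rabs (u (Datatypes.S j)) * rho ^ j))
      by (field; lra).
    rewrite <- (Rmult_1_l (Rabs _ * rho ^ j)) at 2.
    apply Rmult_le_compat_r.
    - apply Rmult_le_pos; [apply Rabs_pos | lra].
    - apply Rle_div_l; [lra |]; rewrite Rmult_1_l; apply hj. }
  apply Rle_div_r; [lra |].
  generalize (Rabs_pos (u 0%nat)); nra.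
- unfold PSeries; eapply Rle_trans; [now apply Series_Rabs | exact h2].
Qed.

End WeightedBound.

(** A series without constant term is [t] times its shift, whence the factor
    [Rabs t / rho]. *)
Lemma wsum_PSeries_small rho S u t :
  0 < rho -> (forall m, wsum rho u m <= S) -> u 0%nat = 0 ->
  Rabs t < rho -> Rabs (PSeries u t) <= Rabs t / rho * S.
Proof.
intros hr hS h0 ht.
assert (hcv : Rbar_lt (Rabs t) (CV_radius u)).
{ apply Rbar_lt_le_trans with rho; [exact ht |].
  now apply (wsum_cv_radius rho S). }
rewrite PSeries_decr_1 by now apply CV_radius_inside.
rewrite h0, Rplus_0_l, Rabs_mult; unfold Rdiv; rewrite Rmult_assoc.
apply Rmult_le_compat_l; [apply Rabs_pos |].
rewrite Rmult_comm; apply (wsum_PSeries rho); [| lra].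
intros m; apply Rle_div_r; [lra |].
generalize (hS (Datatypes.S m)); rewrite wsum_split, h0, Rabs_R0.
unfold PS_decr_1; lra.
Qed.

(** * Recursion over all earlier values *)

Section History.

Variables (T : Type) (x0 : T) (step : nat -> (nat -> T) -> T).

Fixpoint history (m : nat) : nat -> T :=
  match m with
  | O => fun _ => x0
  | S p => fun j => if (j <=? p)%nat then history p j else step p (history p)
  end.

Definition from_history (m : nat) : T := history m m.

Lemma history_stable m j : (j <= m)%nat -> history m j = from_history j.
Proof.
induction m as [|m IH]; intros hj.
- now replace j with 0%nat by lia.
- destruct (Nat.eq_dec j (S m)) as [->|hne]; [reflexivity |].
  simpl; destruct (Nat.leb_spec j m) as [_|hlt]; [apply IH |]; lia.
Qed.

Lemma from_history_succ m :
  (forall h h', (forall j, (j <= m)%nat -> h j = h' j) -> step m h = step m h') ->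
  from_history (S m) = step m from_history.
Proof.
intros hext; unfold from_history at 1; cbn -[Nat.leb].
destruct (Nat.leb_spec (S m) m) as [hlt|_]; [lia |].
apply hext; intros j hj; now apply history_stable.
Qed.

End History.

(** * The regular solution at a Fuchsian singular point *)

Section Fuchs.

Variable D : R.

(** Coefficient sequences [g] and [r] of a solution [G] of
    [t (1 - kap t) G'' + (D + e t) G' = A G + B / G ^ 2], [G 0 = 1], and of its
    reciprocal.  Carrying [1 / G] along makes the recursion polynomial. *)
Definition fuchs_rec (kap e A B : R) (g r : nat -> R) : Prop :=
  g 0%nat = 1 /\ r 0%nat = 1 /\
  (forall m, (INR m + 1) * (INR m + D) * g (S m)
     = (kap * (INR m * (INR m - 1)) - e * INR m + A) * g m
       + B * PS_mult r r m) /\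
  (forall m, r (S m) = - PS_mult (fun j => g (S j)) r m).

Definition fuchs_step (kap e A B : R) (m : nat) (h : nat -> R * R) : R * R :=
  let r := fun j => snd (h j) in
  let g1 := ((kap * (INR m * (INR m - 1)) - e * INR m + A) * fst (h m)
             + B * PS_mult r r m) / ((INR m + 1) * (INR m + D)) in
  (g1,
   - PS_mult (fun j => if (j =? m)%nat then g1 else fst (h (S j))) r m).

Definition fuchs_coef kap e A B (j : nat) : R :=
  fst (from_history _ (1, 1) (fuchs_step kap e A B) j).

Definition fuchs_inv kap e A B (j : nat) : R :=
  snd (from_history _ (1, 1) (fuchs_step kap e A B) j).

Variable dl : R.
Hypothesis hdl : 0 < dl.
Hypothesis hD :
  forall m, dl * (INR m + 1) ^ 2 <= Rabs ((INR m + 1) * (INR m + D)).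

Lemma fuchs_denom m : (INR m + 1) * (INR m + D) <> 0.
Proof.
intros h; generalize (hD m) (pos_INR m); rewrite h, Rabs_R0; nra.
Qed.

Lemma fuchs_coef_rec kap e A B :
  fuchs_rec kap e A B (fuchs_coef kap e A B) (fuchs_inv kap e A B).
Proof.
assert (hs : forall m, from_history _ (1, 1) (fuchs_step kap e A B) (S m)
  = fuchs_step kap e A B m (from_history _ (1, 1) (fuchs_step kap e A B))).
{ intros m; apply from_history_succ; intros h h' hh.
  assert (hg : PS_mult (fun j => snd (h j)) (fun j => snd (h j)) m
             = PS_mult (fun j => snd (h' j)) (fun j => snd (h' j)) m).
  { apply sum_eq; intros i hi; now rewrite !hh by lia. }
  unfold fuchs_step; cbv zeta; rewrite hg, (hh m) by lia; f_equal; f_equal.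
  apply sum_eq; intros i hi; rewrite (hh (m - i)%nat) by lia.
  destruct (Nat.eqb_spec i m) as [_|hne]; [reflexivity |].
  now rewrite (hh (S i)) by lia. }
split; [reflexivity |]; split; [reflexivity |]; split; intros m.
- unfold fuchs_coef at 1; rewrite hs; unfold fuchs_step; cbn [fst].
  rewrite Rmult_comm; unfold Rdiv; rewrite Rmult_assoc, Rinv_l, Rmult_1_r
    by apply fuchs_denom.
  reflexivity.
- unfold fuchs_inv at 1; rewrite hs; unfold fuchs_step; cbn [snd].
  f_equal; apply sum_eq; intros i hi; f_equal.
  destruct (Nat.eqb_spec i m) as [->|hne]; [| reflexivity].
  unfold fuchs_coef; rewrite hs; reflexivity.
Qed.

Variable Q : R.
Hypothesis hQ : 1 <= Q.

Definition fuchs_radius : R := dl / (16 * Q).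

Lemma fuchs_radius_pos : 0 < fuchs_radius.
Proof. apply Rdiv_lt_0_compat; lra. Qed.

(** The right-hand side of the recursion grows no faster than its denominator. *)
Lemma fuchs_factor kap e A m :
  Rabs (kap * (INR m * (INR m - 1)) - e * INR m + A)
  <= (Rabs kap + Rabs e + Rabs A) * (INR m + 1) ^ 2.
Proof.
assert (hm := pos_INR m).
assert (hm1 : 0 <= INR m * (INR m - 1)).
{ destruct m as [|m]; [simpl; lra |].
  rewrite S_INR; generalize (pos_INR m); intros; apply Rmult_le_pos; lra. }
unfold Rminus at 1.
eapply Rle_trans; [apply Rabs_triang |].
eapply Rle_trans; [apply Rplus_le_compat_r, Rabs_triang |].
rewrite Rabs_Ropp, !Rabs_mult, (Rabs_pos_eq (INR m)) by lra.
assert (h2 : Rabs (INR m) * Rabs (INR m - 1) <= (INR m + 1) ^ 2).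
{ rewrite <- Rabs_mult, Rabs_pos_eq by lra; nra. }
rewrite Rabs_pos_eq in h2 by lra.
generalize (Rabs_pos kap) (Rabs_pos e) (Rabs_pos A); intros h3 h4 h5.
assert (Rabs kap * (INR m * Rabs (INR m - 1)) <= Rabs kap * (INR m + 1) ^ 2)
  by now apply Rmult_le_compat_l.
assert (Rabs e * INR m <= Rabs e * (INR m + 1) ^ 2)
  by (apply Rmult_le_compat_l; nra).
assert (Rabs A * 1 <= Rabs A * (INR m + 1) ^ 2)
  by (apply Rmult_le_compat_l; nra).
lra.
Qed.

Lemma fuchs_solve m x y :
  (INR m + 1) * (INR m + D) * x = y ->
  forall z, Rabs y <= (INR m + 1) ^ 2 * z -> Rabs x <= z / dl.
Proof.
intros hx z hy; apply Rle_div_r; [exact hdl |].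
assert (hm := pos_INR m).
rewrite <- hx, Rabs_mult in hy.
assert (h : dl * (INR m + 1) ^ 2 * Rabs x <= (INR m + 1) ^ 2 * z).
{ eapply Rle_trans; [| exact hy].
  apply Rmult_le_compat_r; [apply Rabs_pos | apply hD]. }
apply (Rmult_le_reg_l ((INR m + 1) ^ 2)); nra.
Qed.

Lemma wsum_tail_zero rho u S m :
  0 < rho -> u 0%nat = 1 -> wsum rho (fun j => u (Datatypes.S j)) m <= S / rho ->
  wsum rho u (Datatypes.S m) <= 1 + S.
Proof.
intros hr h0 h; rewrite wsum_split, h0, Rabs_R1.
apply Rle_div_r in h; [|lra]; lra.
Qed.

Lemma Rabs_m1 : Rabs (-1) = 1.
Proof. rewrite Rabs_left; lra. Qed.

(** The weight absorbs the right-hand side: one factor of the radius is gained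
    at each step of the recursion, so both bounds reproduce themselves. *)
Lemma fuchs_bound kap e A B g r :
  fuchs_rec kap e A B g r ->
  Rabs kap + Rabs e + Rabs A + Rabs B <= Q ->
  forall m, wsum fuchs_radius g m <= 5 / 4 /\ wsum fuchs_radius r m <= 4 / 3.
Proof.
intros (hg0 & hr0 & hg & hr) hp.
assert (hrho := fuchs_radius_pos).
assert (pk := Rabs_pos kap); assert (pe := Rabs_pos e);
assert (pA := Rabs_pos A); assert (pB := Rabs_pos B).
induction m as [|m [IHg IHr]].
- unfold wsum; simpl; rewrite hg0, hr0, Rabs_R1; lra.
- assert (hrr := wsum_mult fuchs_radius r r m (Rlt_le _ _ hrho)).
  assert (pr := wsum_nonneg fuchs_radius r m (Rlt_le _ _ hrho)).
  assert (pg := wsum_nonneg fuchs_radius g m (Rlt_le _ _ hrho)).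
  assert (hG : wsum fuchs_radius g (S m) <= 1 + / 4).
  { apply wsum_tail_zero; [exact hrho | exact hg0 |].
    apply Rle_trans with
      (wsum fuchs_radius (fun j => Q / dl * g j) m
       + wsum fuchs_radius (fun j => Q / dl * PS_mult r r j) m).
    - apply wsum_triangle; [lra |]; intros j _.
      assert (hQd : 0 < Q / dl) by (apply Rdiv_lt_0_compat; lra).
      rewrite !Rabs_mult, (Rabs_pos_eq (Q / dl)) by lra.
      replace (Q / dl * Rabs (g j) + Q / dl * Rabs (PS_mult r r j))
        with (Q * (Rabs (g j) + Rabs (PS_mult r r j)) / dl) by (field; lra).
      eapply fuchs_solve; [apply hg |].
      eapply Rle_trans; [apply Rabs_triang |]; rewrite !Rabs_mult.
      assert (h1 := fuchs_factor kap e A j).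
      assert (h2 := Rabs_pos (g j)); assert (h3 := Rabs_pos (PS_mult r r j)).
      assert (h4 : 1 <= (INR j + 1) ^ 2) by (generalize (pos_INR j); nra).
      assert (Rabs (kap * (INR j * (INR j - 1)) - e * INR j + A) * Rabs (g j)
              <= Q * (INR j + 1) ^ 2 * Rabs (g j)).
      { apply Rmult_le_compat_r; [exact h2 |].
        eapply Rle_trans; [exact h1 |]; apply Rmult_le_compat_r; lra. }
      assert (Rabs B * Rabs (PS_mult r r j)
              <= Q * (INR j + 1) ^ 2 * Rabs (PS_mult r r j)).
      { apply Rmult_le_compat_r; [exact h3 | nra]. }
      lra.
    - assert (hQd : 0 < Q / dl) by (apply Rdiv_lt_0_compat; lra).
      rewrite !wsum_scal, Rabs_pos_eq by lra.
      replace (/ 4 / fuchs_radius) with (Q / dl * 4)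
        by (unfold fuchs_radius; field; lra).
      rewrite <- Rmult_plus_distr_l; apply Rmult_le_compat_l; [lra | nra]. }
  split; [lra |].
  replace (4 / 3) with (1 + / 3) by field.
  apply wsum_tail_zero; [exact hrho | exact hr0 |].
  rewrite wsum_split, hg0, Rabs_R1 in hG.
  apply Rle_trans with
    (wsum fuchs_radius (fun j => -1 * PS_mult (fun i => g (S i)) r j) m).
  { right; apply sum_eq; intros j _; rewrite hr; do 2 f_equal; ring. }
  rewrite wsum_scal, Rabs_m1, Rmult_1_l.
  eapply Rle_trans; [apply wsum_mult; lra |].
  apply (proj1 (Rle_div_r _ _ _ hrho)).
  assert (h5 := wsum_nonneg fuchs_radius (fun j => g (S j)) m (Rlt_le _ _ hrho)).
  replace (/ 3) with (/ 4 * (4 / 3)) by field.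
  rewrite Rmult_comm, <- Rmult_assoc; apply Rmult_le_compat; nra.
Qed.

Lemma PS_mult_diff u v u' v' j :
  PS_mult u v j - PS_mult u' v' j
  = PS_mult (fun i => u i - u' i) v j + PS_mult u' (fun i => v i - v' i) j.
Proof.
unfold PS_mult; rewrite <- minus_sum, <- plus_sum.
apply sum_eq; intros i _; ring.
Qed.

(** The differences obey the linearized recursion, with the differences of the
    parameters as a source, so the gain of one factor of the radius closes this
    estimate as well. *)
Lemma fuchs_lipschitz kap e A B g r kap' e' A' B' g' r' :
  fuchs_rec kap e A B g r -> fuchs_rec kap' e' A' B' g' r' ->
  Rabs kap + Rabs e + Rabs A + Rabs B <= Q ->
  Rabs kap' + Rabs e' + Rabs A' + Rabs B' <= Q ->
  forall m,
    wsum fuchs_radius (fun j => g j - g' j) m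
    <= Rabs (kap - kap') + Rabs (e - e') + Rabs (A - A') + Rabs (B - B').
Proof.
intros H H' hp hp'.
assert (hb := fuchs_bound _ _ _ _ _ _ H hp).
assert (hb' := fuchs_bound _ _ _ _ _ _ H' hp').
destruct H as (hg0 & hr0 & hg & hr); destruct H' as (hg0' & hr0' & hg' & hr').
set (Dp := Rabs (kap - kap') + Rabs (e - e') + Rabs (A - A') + Rabs (B - B')).
assert (pD : 0 <= Dp).
{ unfold Dp; generalize (Rabs_pos (kap - kap')) (Rabs_pos (e - e'))
    (Rabs_pos (A - A')) (Rabs_pos (B - B')); lra. }
assert (hrho := fuchs_radius_pos).
assert (hrho0 := Rlt_le _ _ hrho).
set (dg := fun j => g j - g' j); set (dr := fun j => r j - r' j).
assert (pk := Rabs_pos kap'); assert (pe := Rabs_pos e');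
assert (pA := Rabs_pos A'); assert (pB := Rabs_pos B').
enough (hall : forall m, wsum fuchs_radius dg m <= Dp
                 /\ wsum fuchs_radius dr m <= 2 * Dp) by apply hall.
induction m as [|m [IHg IHr]].
- unfold wsum, dg, dr; simpl; rewrite hg0, hr0, hg0', hr0', Rminus_diag, Rabs_R0.
  lra.
- destruct (hb m) as [bg br]; destruct (hb' m) as [bg' br'].
  assert (prr := wsum_mult fuchs_radius r r m hrho0).
  assert (pr := wsum_nonneg fuchs_radius r m hrho0).
  assert (pr' := wsum_nonneg fuchs_radius r' m hrho0).
  assert (pg := wsum_nonneg fuchs_radius g m hrho0).
  assert (pdr := wsum_nonneg fuchs_radius dr m hrho0).
  assert (hG : wsum fuchs_radius dg (S m) <= Dp).
  { rewrite wsum_split; unfold dg at 1; rewrite hg0, hg0', Rminus_diag, Rabs_R0.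
    rewrite Rplus_0_l, Rmult_comm; apply Rle_div_r; [exact hrho |].
    set (drr := fun j => PS_mult dr r j + PS_mult r' dr j).
    assert (hdrr : wsum fuchs_radius drr m <= 16 / 3 * Dp).
    { eapply Rle_trans.
      - apply (wsum_triangle _ (PS_mult dr r) (PS_mult r' dr)); [exact hrho0 |].
        intros j _; apply Rabs_triang.
      - generalize (wsum_mult fuchs_radius dr r m hrho0)
          (wsum_mult fuchs_radius r' dr m hrho0); nra. }
    apply Rle_trans with
     (wsum fuchs_radius (fun j => Dp / dl * g j) m
      + (wsum fuchs_radius (fun j => Dp / dl * PS_mult r r j) m
      + (wsum fuchs_radius (fun j => Q / dl * dg j) m
      + wsum fuchs_radius (fun j => Q / dl * drr j) m))).
    - unfold wsum; rewrite <- !plus_sum; apply sum_Rle; intros j _.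
      rewrite <- !Rmult_plus_distr_r; apply Rmult_le_compat_r;
        [now apply pow_le |].
      assert (0 < Q / dl) by (apply Rdiv_lt_0_compat; lra).
      assert (0 <= Dp / dl) by (apply Rdiv_le_0_compat; lra).
      rewrite !Rabs_mult, (Rabs_pos_eq (Q / dl)), (Rabs_pos_eq (Dp / dl)) by lra.
      match goal with |- _ <= ?x => replace x with
        ((Dp * (Rabs (g j) + Rabs (PS_mult r r j))
          + Q * (Rabs (dg j) + Rabs (drr j))) / dl) by (field; lra) end.
      assert (hrec : (INR j + 1) * (INR j + D) * dg (S j)
        = ((kap - kap') * (INR j * (INR j - 1)) - (e - e') * INR j + (A - A')) * g j
          + ((kap' * (INR j * (INR j - 1)) - e' * INR j + A') * dg j
          + ((B - B') * PS_mult r r j + B' * drr j))).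
      { replace (drr j) with (PS_mult r r j - PS_mult r' r' j)
          by apply PS_mult_diff.
        unfold dg; rewrite Rmult_minus_distr_l, hg, hg'; ring. }
      eapply fuchs_solve; [exact hrec |].
      eapply Rle_trans; [apply Rabs_triang |].
      eapply Rle_trans; [apply Rplus_le_compat_l, Rabs_triang |].
      eapply Rle_trans; [apply Rplus_le_compat_l, Rplus_le_compat_l, Rabs_triang |].
      rewrite !Rabs_mult.
      assert (h1 := fuchs_factor kap' e' A' j).
      assert (h1' := fuchs_factor (kap - kap') (e - e') (A - A') j).
      set (z := (INR j + 1) ^ 2) in *.
      assert (h4 : 1 <= z) by (unfold z; generalize (pos_INR j); nra).
      assert (q1 := Rabs_pos (kap - kap')); assert (q2 := Rabs_pos (e - e')).
      assert (q3 := Rabs_pos (A - A')); assert (q4 := Rabs_pos (B - B')).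
      assert (s1 := Rabs_pos (g j)); assert (s2 := Rabs_pos (dg j)).
      assert (s3 := Rabs_pos (PS_mult r r j)); assert (s4 := Rabs_pos (drr j)).
      match goal with |- ?u1 * _ + (?u2 * _ + (_ + _)) <= _ =>
        assert (u1 * Rabs (g j) <= Dp * z * Rabs (g j));
        [apply Rmult_le_compat_r; [lra |]; eapply Rle_trans; [exact h1' |];
         apply Rmult_le_compat_r; unfold Dp; lra |];
        assert (u2 * Rabs (dg j) <= Q * z * Rabs (dg j));
        [apply Rmult_le_compat_r; [lra |]; eapply Rle_trans; [exact h1 |];
         apply Rmult_le_compat_r; lra |]
      end.
      assert (Rabs (B - B') * Rabs (PS_mult r r j) <= Dp * z * Rabs (PS_mult r r j)).
      { apply Rmult_le_compat_r; [lra |].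
        apply Rle_trans with (Dp * 1); [unfold Dp; lra |].
        apply Rmult_le_compat_l; lra. }
      assert (Rabs B' * Rabs (drr j) <= Q * z * Rabs (drr j)).
      { apply Rmult_le_compat_r; [lra |].
        apply Rle_trans with (Q * 1); [lra |].
        apply Rmult_le_compat_l; lra. }
      lra.
    - assert (0 < Q / dl) by (apply Rdiv_lt_0_compat; lra).
      assert (0 <= Dp / dl) by (apply Rdiv_le_0_compat; lra).
      rewrite !wsum_scal, (Rabs_pos_eq (Q / dl)), (Rabs_pos_eq (Dp / dl)) by lra.
      apply Rle_trans with (Dp / dl * 4 + Q / dl * (7 * Dp)).
      + assert (h6 : wsum fuchs_radius g m + wsum fuchs_radius (PS_mult r r) m <= 4)
          by nra.
        assert (h7 : wsum fuchs_radius dg m + wsum fuchs_radius drr m <= 7 * Dp)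
          by lra.
        apply (Rmult_le_compat_l (Dp / dl)) in h6; [|lra].
        apply (Rmult_le_compat_l (Q / dl)) in h7; [|lra].
        lra.
      + unfold fuchs_radius.
        replace (Dp / dl * 4 + Q / dl * (7 * Dp)) with ((4 + 7 * Q) * (Dp / dl))
          by (field; lra).
        replace (Dp / (dl / (16 * Q))) with (16 * Q * (Dp / dl)) by (field; lra).
        apply Rmult_le_compat_r; lra. }
  split; [exact hG |].
  rewrite wsum_split; unfold dr at 1; rewrite hr0, hr0', Rminus_diag, Rabs_R0.
  rewrite Rplus_0_l, Rmult_comm; apply Rle_div_r; [exact hrho |].
  rewrite wsum_split in hG; unfold dg at 1 in hG.
  rewrite hg0, hg0', Rminus_diag, Rabs_R0, Rplus_0_l in hG.
  assert (hG' := proj1 (hb' (S m))).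
  rewrite wsum_split, hg0', Rabs_R1 in hG'.
  apply Rle_trans with
    (wsum fuchs_radius (fun j => -1 * PS_mult (fun i => dg (S i)) r j) m
     + wsum fuchs_radius (fun j => -1 * PS_mult (fun i => g' (S i)) dr j) m).
  { apply wsum_triangle; [exact hrho0 |]; intros j _.
    unfold dr at 1; rewrite hr, hr'.
    eapply Rle_trans; [| apply Rabs_triang].
    right; f_equal.
    replace (- PS_mult (fun i => g (S i)) r j - - PS_mult (fun i => g' (S i)) r' j)
      with (- (PS_mult (fun i => g (S i)) r j - PS_mult (fun i => g' (S i)) r' j))
      by ring.
    rewrite PS_mult_diff; unfold dg, dr; ring. }
  rewrite !wsum_scal, !Rabs_m1, !Rmult_1_l.
  apply (proj1 (Rle_div_r _ _ _ hrho)).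
  assert (u1 := wsum_mult fuchs_radius (fun i => dg (S i)) r m hrho0).
  assert (u2 := wsum_mult fuchs_radius (fun i => g' (S i)) dr m hrho0).
  assert (p1 := wsum_nonneg fuchs_radius (fun i => dg (S i)) m hrho0).
  assert (p2 := wsum_nonneg fuchs_radius (fun i => g' (S i)) m hrho0).
  set (a1 := wsum fuchs_radius (fun i => dg (S i)) m) in *.
  set (a2 := wsum fuchs_radius (fun i => g' (S i)) m) in *.
  set (a3 := wsum fuchs_radius r m) in *.
  set (a4 := wsum fuchs_radius dr m) in *.
  set (rho := fuchs_radius) in *.
  assert (t1 : rho * a1 * a3 <= Dp * (4 / 3)) by (apply Rmult_le_compat; nra).
  assert (t2 : rho * a2 * a4 <= / 4 * (2 * Dp)) by (apply Rmult_le_compat; nra).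
  nra.
Qed.

End Fuchs.

Definition unit_coef (j : nat) : R := match j with O => 1 | S _ => 0 end.

Lemma PSeries_unit t : PSeries unit_coef t = 1.
Proof.
apply is_pseries_unique, is_pseries_Reals; intros eps heps.
exists 0%nat; intros m _.
replace (sum_f_R0 (fun j => unit_coef j * t ^ j) m) with 1;
  [unfold Rdist; rewrite Rminus_diag, Rabs_R0; exact heps |].
induction m as [|m IH]; simpl; [ring | rewrite <- IH; ring].
Qed.

Section FuchsFunction.

Variables (D dl Q : R).
Hypothesis hdl : 0 < dl.
Hypothesis hD :
  forall m, dl * (INR m + 1) ^ 2 <= Rabs ((INR m + 1) * (INR m + D)).
Hypothesis hQ : 1 <= Q.

Let rho := fuchs_radius dl Q.
Let hrho : 0 < rho := fuchs_radius_pos dl hdl Q hQ.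

Section OneEquation.

Variables (kap e A B : R).
Hypothesis hp : Rabs kap + Rabs e + Rabs A + Rabs B <= Q.

Let g := fuchs_coef D kap e A B.
Let r := fuchs_inv D kap e A B.
Let hrec : fuchs_rec D kap e A B g r := fuchs_coef_rec D dl hdl hD kap e A B.
Let hbd := fuchs_bound D dl hdl hD Q hQ kap e A B g r hrec hp.

Lemma fuchs_cv_radius : Rbar_le rho (CV_radius g).
Proof. apply (wsum_cv_radius rho (5 / 4)); [exact hrho | intros m; apply hbd]. Qed.

Lemma fuchs_inv_cv_radius : Rbar_le rho (CV_radius r).
Proof. apply (wsum_cv_radius rho (4 / 3)); [exact hrho | intros m; apply hbd]. Qed.

Lemma fuchs_near_one t :
  Rabs t < rho -> Rabs (PSeries g t - 1) <= Rabs t / rho * / 4.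
Proof.
intros ht.
assert (hcv : Rbar_lt (Rabs t) (CV_radius g))
  by (apply Rbar_lt_le_trans with rho; [exact ht | exact fuchs_cv_radius]).
set (u := PS_incr_1 (PS_decr_1 g)).
replace (PSeries g t - 1) with (PSeries u t).
- apply wsum_PSeries_small; [exact hrho | | reflexivity | exact ht].
  intros m; apply Rle_trans with (wsum rho g (S m) - 1).
  + rewrite wsum_split, (proj1 hrec), Rabs_R1.
    eapply Rle_trans; [apply wsum_mono; lra |].
    rewrite wsum_split; change (u 0%nat) with 0.
    change (wsum rho (fun j => u (S j)) m) with (wsum rho (fun j => g (S j)) m).
    rewrite Rabs_R0; lra.
  + generalize (proj1 (hbd (S m))); fold rho; lra.
- rewrite (PSeries_decr_1 g t) by now apply CV_radius_inside.
  unfold u; rewrite PSeries_incr_1, (proj1 hrec); ring.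
Qed.

Lemma fuchs_derive_bound t :
  Rabs t <= rho / 2 -> Rabs (PSeries (PS_derive g) t) <= 5 / 4 / rho.
Proof.
intros ht; apply wsum_PSeries_derive; [exact hrho | | exact ht].
intros m; apply hbd.
Qed.

Lemma fuchs_equation t :
  Rabs t < rho ->
  t * (1 - kap * t) * PSeries (PS_derive (PS_derive g)) t
  + (D + e * t) * PSeries (PS_derive g) t
  = A * PSeries g t + B / PSeries g t ^ 2.
Proof.
intros ht.
assert (hcg : Rbar_lt (Rabs t) (CV_radius g))
  by (apply Rbar_lt_le_trans with rho; [exact ht | exact fuchs_cv_radius]).
assert (hcr : Rbar_lt (Rabs t) (CV_radius r))
  by (apply Rbar_lt_le_trans with rho; [exact ht | exact fuchs_inv_cv_radius]).
assert (hcg1 : Rbar_lt (Rabs t) (CV_radius (PS_derive g)))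
  by now rewrite CV_radius_derive.
assert (hcg2 : Rbar_lt (Rabs t) (CV_radius (PS_derive (PS_derive g))))
  by now rewrite CV_radius_derive.
destruct hrec as (hg0 & hr0 & hg & hr).
assert (hgr : PSeries g t * PSeries r t = 1).
{ rewrite <- PSeries_mult by assumption.
  transitivity (PSeries unit_coef t).
  - apply PSeries_ext; intros [|m]; unfold PS_mult.
    + simpl; rewrite hg0, hr0; ring.
    + rewrite decomp_sum by lia; simpl pred; rewrite Nat.sub_0_r, hg0, hr.
      unfold PS_mult, unit_coef; cbn [Nat.sub]; ring.
  - apply PSeries_unit. }
assert (hg1 : PSeries g t <> 0) by (intros h; rewrite h in hgr; lra).
replace (B / PSeries g t ^ 2) with (B * (PSeries r t * PSeries r t))
  by (replace (PSeries r t) with (/ PSeries g t);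
      [field; exact hg1 | apply (Rmult_eq_reg_l (PSeries g t)); [|exact hg1];
       rewrite hgr; now apply Rinv_r]).
rewrite <- PSeries_mult by assumption.
set (g2 := PS_derive (PS_derive g)) in *; set (g1 := PS_derive g) in *.
assert (hcrr : ex_pseries (PS_mult r r) t) by (apply ex_pseries_mult; assumption).
assert (e0 : ex_pseries g t) by now apply CV_radius_inside.
assert (e2 : ex_pseries g2 t) by now apply CV_radius_inside.
assert (e1 : ex_pseries g1 t) by now apply CV_radius_inside.
transitivity (PSeries (PS_plus (PS_scal A g) (PS_scal B (PS_mult r r))) t).
2: { rewrite PSeries_plus, !PSeries_scal;
     [reflexivity | |]; apply ex_pseries_scal; try apply Rmult_comm; assumption. }
replace (t * (1 - kap * t) * PSeries g2 t + (D + e * t) * PSeries g1 t)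
  with (t * PSeries g2 t + (- kap * (t * (t * PSeries g2 t))
        + (D * PSeries g1 t + e * (t * PSeries g1 t)))) by ring.
assert (hs : forall (c : R) (u : nat -> R), ex_pseries u t -> ex_pseries (PS_scal c u) t)
  by (intros c u; apply ex_pseries_scal, Rmult_comm).
assert (i1 : ex_pseries (PS_incr_1 g1) t) by now apply ex_pseries_incr_1.
assert (i2 : ex_pseries (PS_incr_1 g2) t) by now apply ex_pseries_incr_1.
assert (i3 : ex_pseries (PS_incr_1 (PS_incr_1 g2)) t)
  by now apply ex_pseries_incr_1.
assert (j1 := hs D g1 e1); assert (j2 := hs e _ i1); assert (j3 := hs (- kap) _ i3).
assert (k1 := ex_pseries_plus _ _ _ j1 j2); assert (k2 := ex_pseries_plus _ _ _ j3 k1).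
rewrite <- !PSeries_incr_1, <- !PSeries_scal, <- !PSeries_plus; [| assumption ..].
- apply PSeries_ext; intros m.
  unfold PS_plus, PS_scal, PS_incr_1, plus, scal, zero; simpl;
    unfold mult; simpl.
  generalize (hg m); unfold g2, g1, PS_derive.
  destruct m as [|[|m]]; rewrite ?S_INR; simpl INR; intros hgm; lra.
Qed.

(** When [A + B = 0] the constant [1] solves the equation, and the recursion has no
    other solution starting from [1]. *)
Lemma fuchs_constant :
  A + B = 0 -> forall j, g (S j) = 0.
Proof.
intros hAB.
destruct hrec as (hg0 & hr0 & hg & hr).
assert (hall : forall m j, (j <= m)%nat -> g (S j) = 0 /\ r (S j) = 0).
{ assert (hstep : forall m, (forall j, (j < m)%nat -> g (S j) = 0 /\ r (S j) = 0)
      -> g (S m) = 0 /\ r (S m) = 0).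
  { intros m IH.
    assert (hg1 : g (S m) = 0).
    { assert (hm : (INR m + 1) * (INR m + D) * g (S m) = 0).
      { rewrite hg; destruct m as [|m].
        - unfold PS_mult; simpl; rewrite hg0, hr0; nra.
        - rewrite (proj1 (IH m ltac:(lia))).
          replace (PS_mult r r (S m)) with 0; [ring |].
          symmetry; unfold PS_mult.
          rewrite decomp_sum by lia; simpl pred; rewrite Nat.sub_0_r.
          rewrite (proj2 (IH m ltac:(lia))), Rmult_0_r, Rplus_0_l.
          rewrite (sum_eq _ (fun _ => 0)); [apply sum_eq_R0; auto |].
          intros i hi; rewrite (proj2 (IH i ltac:(lia))); ring. }
      apply Rmult_integral in hm; destruct hm as [hm|hm]; [| exact hm].
      now apply (fuchs_denom D dl hdl hD) in hm. }
    split; [exact hg1 |].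
    rewrite hr; unfold PS_mult; rewrite (sum_eq _ (fun _ => 0)).
    - rewrite sum_eq_R0 by auto; ring.
    - intros i hi; destruct (Nat.eq_dec i m) as [->|hne]; [rewrite hg1; ring |].
      rewrite (proj1 (IH i ltac:(lia))); ring. }
  induction m as [|m IH]; intros j hj.
  - replace j with 0%nat by lia; apply hstep; intros; lia.
  - apply hstep; intros i hi; apply IH; lia. }
intros j; now apply (hall j).
Qed.

Lemma fuchs_constant_PSeries t :
  A + B = 0 -> PSeries g t = 1 /\ PSeries (PS_derive g) t = 0.
Proof.
intros hAB; assert (h := fuchs_constant hAB); split.
- rewrite (PSeries_ext _ unit_coef); [apply PSeries_unit |].
  intros [|j]; [apply hrec | apply h].
- rewrite (PSeries_ext _ (fun _ => 0)); [apply PSeries_const_0 |].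
  intros j; unfold PS_derive; rewrite h; ring.
Qed.

End OneEquation.

Section TwoEquations.

Variables (kap e A B kap' e' A' B' : R).
Hypothesis hp : Rabs kap + Rabs e + Rabs A + Rabs B <= Q.
Hypothesis hp' : Rabs kap' + Rabs e' + Rabs A' + Rabs B' <= Q.

Let g := fuchs_coef D kap e A B.
Let g' := fuchs_coef D kap' e' A' B'.
Let Dp := Rabs (kap - kap') + Rabs (e - e') + Rabs (A - A') + Rabs (B - B').

Let hlip : forall m, wsum rho (PS_minus g g') m <= Dp :=
  fuchs_lipschitz D dl hdl hD Q hQ _ _ _ _ _ _ _ _ _ _ _ _
    (fuchs_coef_rec D dl hdl hD kap e A B)
    (fuchs_coef_rec D dl hdl hD kap' e' A' B') hp hp'.

Lemma fuchs_PSeries_lipschitz t :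
  Rabs t < rho -> Rabs (PSeries g t - PSeries g' t) <= Rabs t / rho * Dp.
Proof.
intros ht; rewrite <- PSeries_minus.
- apply wsum_PSeries_small; [exact hrho | exact hlip | | exact ht].
  change (1 + - 1 = 0); ring.
- apply CV_radius_inside, Rbar_lt_le_trans with rho; [exact ht |].
  now apply fuchs_cv_radius.
- apply CV_radius_inside, Rbar_lt_le_trans with rho; [exact ht |].
  now apply fuchs_cv_radius.
Qed.

Lemma fuchs_derive_lipschitz t :
  Rabs t <= rho / 2 ->
  Rabs (PSeries (PS_derive g) t - PSeries (PS_derive g') t) <= Dp / rho.
Proof.
intros ht; rewrite <- PSeries_minus.
- rewrite (PSeries_ext _ (PS_derive (PS_minus g g'))).
  + apply wsum_PSeries_derive; [exact hrho | exact hlip | exact ht].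
  + intros j; unfold PS_derive, PS_minus, plus, opp; simpl; 
    unfold plus, opp; simpl; ring.
- apply CV_radius_inside; rewrite CV_radius_derive.
  apply Rbar_lt_le_trans with rho; [simpl; lra |].
  now apply fuchs_cv_radius.
- apply CV_radius_inside; rewrite CV_radius_derive.
  apply Rbar_lt_le_trans with rho; [simpl; lra |].
  now apply fuchs_cv_radius.
Qed.

End TwoEquations.

End FuchsFunction.

(** * Differential inequalities *)

Lemma derive_continuous (f : R -> R) x l : is_derive f x l -> continuous f x.
Proof.
intros h; apply (ex_derive_continuous f x); now exists l.
Qed.

Lemma derive_continuity_pt (f : R -> R) x l : is_derive f x l -> continuity_pt f x.
Proof.
intros h; apply continuity_pt_filterlim; exact (derive_continuous f x l h).
Qed.

Lemma derive_nonincreasing (f df : R -> R) a b :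
  a <= b ->
  (forall x, a <= x <= b -> is_derive f x (df x)) ->
  (forall x, a <= x <= b -> df x <= 0) ->
  f b <= f a.
Proof.
intros hab hd hs.
destruct (MVT_gen f a b df) as [x [hx he]];
  rewrite ?Rmin_left, ?Rmax_right in * by exact hab.
- intros x hx; apply hd; lra.
- intros x hx; apply (derive_continuity_pt f x (df x)), hd, hx.
- generalize (hs x hx); nra.
Qed.

Lemma derive_nondecreasing (f df : R -> R) a b :
  a <= b ->
  (forall x, a <= x <= b -> is_derive f x (df x)) ->
  (forall x, a <= x <= b -> 0 <= df x) ->
  f a <= f b.
Proof.
intros hab hd hs.
assert (h : - f b <= - f a); [| lra].
apply (derive_nonincreasing (fun x => - f x) (fun x => - df x)); [exact hab | |].
- intros x hx; apply (is_derive_opp f x (df x)), hd, hx.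
- intros x hx; generalize (hs x hx); lra.
Qed.

Lemma derive_constant (f df : R -> R) a b :
  a <= b ->
  (forall x, a <= x <= b -> is_derive f x (df x)) ->
  (forall x, a <= x <= b -> df x = 0) ->
  f b = f a.
Proof.
intros hab hd h0; apply Rle_antisym.
- apply (derive_nonincreasing f df); auto; intros x hx; rewrite h0; auto; lra.
- apply (derive_nondecreasing f df); auto; intros x hx; rewrite h0; auto; lra.
Qed.

Lemma exp_le x y : x <= y -> exp x <= exp y.
Proof.
intros [h| ->]; [left; now apply exp_increasing | apply Rle_refl].
Qed.

Ltac rewrite_derive H :=
  match type of H with
  | is_derive ?f ?x ?l =>
    let E := fresh in
    assert (E : Derive (fun z => f z) x = l) by exact (is_derive_unique f x l H);
    rewrite ?E; clear E
  end.

Lemma gronwall (f df : R -> R) K C a b :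
  a <= b -> 0 <= K -> 0 <= C ->
  (forall x, a <= x <= b -> is_derive f x (df x)) ->
  (forall x, a <= x <= b -> df x <= K * f x + C) ->
  f b <= (f a + C * (b - a)) * exp (K * (b - a)).
Proof.
intros hab hK hC hd hle.
assert (h : f b * exp (- (K * (b - a))) - C * (b - a)
            <= f a * exp (- (K * (a - a))) - C * (a - a)).
{ apply (derive_nonincreasing
    (fun x => f x * exp (- (K * (x - a))) - C * (x - a))
    (fun x => (df x - K * f x) * exp (- (K * (x - a))) - C)); [exact hab | |].
  - intros x hx; auto_derive; [now exists (df x); apply hd |].
    rewrite_derive (hd x hx); unfold Rminus; ring.
  - intros x hx.
    assert (he : 0 < exp (- (K * (x - a))) <= 1).
    { split; [apply exp_pos |]; rewrite <- exp_0; apply exp_le; nra. }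
    assert (h1 := hle x hx).
    assert ((df x - K * f x) * exp (- (K * (x - a))) <= C * 1).
    { apply Rle_trans with (C * exp (- (K * (x - a)))).
      - apply Rmult_le_compat_r; lra.
      - apply Rmult_le_compat_l; lra. }
    lra. }
rewrite Rminus_diag, !Rmult_0_r, Ropp_0, exp_0 in h.
assert (he := exp_pos (K * (b - a))).
rewrite exp_Ropp in h.
apply Rmult_le_reg_r with (/ exp (K * (b - a))); [now apply Rinv_0_lt_compat |].
rewrite (Rmult_assoc _ (exp _)), Rinv_r, Rmult_1_r by lra; lra.
Qed.

(** * Global solutions of semilinear second-order equations *)

Lemma RInt_derive_continuous (f : R -> R) a t :
  (forall x, continuous f x) -> is_derive (fun x => RInt f a x) t (f t).
Proof.
intros hf; apply (is_derive_RInt f _ a); [| apply hf].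
apply filter_forall; intros x; apply (RInt_correct (V := R_CompleteNormedModule)).
apply (ex_RInt_continuous (V := R_CompleteNormedModule)).
intros z _; apply hf.
Qed.

(** The step of the Picard estimate, on both sides of [a]. *)
Lemma RInt_pow_bound (g : R -> R) a M k t :
  (forall x, continuous g x) ->
  (forall x, Rabs (g x) <= M * Rabs (x - a) ^ k / INR (Factorial.fact k)) ->
  Rabs (RInt g a t) <= M * Rabs (t - a) ^ S k / INR (Factorial.fact (S k)).
Proof.
intros hg hb.
assert (hI := fun x => RInt_derive_continuous g a x hg).
assert (hf : forall j, INR (Factorial.fact j) <> 0) by apply INR_fact_neq_0.
assert (hfS : INR (Factorial.fact (S k)) = (INR k + 1) * INR (Factorial.fact k))
  by (rewrite <- S_INR, <- mult_INR; f_equal).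
assert (hk := pos_INR k); assert (hfk := hf k).
assert (ha : RInt g a a = 0) by exact (RInt_point (V := R_CompleteNormedModule) a g).
set (c := M / INR (Factorial.fact (S k))).
replace (M * Rabs (t - a) ^ S k / INR (Factorial.fact (S k))) with (c * Rabs (t - a) ^ S k)
  by (unfold c; field; apply hf).
assert (hc : forall z, c * (INR k + 1) * z = M * z / INR (Factorial.fact k))
  by (intros z; unfold c; rewrite hfS; field; split; [exact hfk | lra]).
destruct (Rle_dec a t) as [hat|hat].
- assert (hx : forall s, (s = 1 \/ s = -1) ->
    c * (a - a) ^ S k - s * RInt g a a <= c * (t - a) ^ S k - s * RInt g a t).
  { intros s hs; apply (derive_nondecreasing
      (fun x => c * (x - a) ^ S k - s * RInt g a x)
      (fun x => c * (INR k + 1) * (x - a) ^ k - s * g x)); [exact hat | |].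
    - intros x hx; evar_last.
      + apply @is_derive_minus; apply is_derive_scal; [| apply hI].
        apply is_derive_pow, @is_derive_minus;
          [apply @is_derive_id | apply @is_derive_const].
      + unfold minus, plus, opp, scal, one, zero; simpl;
        unfold mult; simpl.
        change (match k with 0%nat => 1 | S _ => INR k + 1 end) with (INR (S k)).
        rewrite S_INR; ring.
    - intros x hx; rewrite hc; generalize (hb x).
      rewrite (Rabs_pos_eq (x - a)) by lra; intros h.
      apply Rabs_le_between in h; destruct hs as [->| ->]; lra. }
  assert (h1 := hx 1 (or_introl eq_refl)).
  assert (h2 := hx (-1) (or_intror eq_refl)).
  rewrite ha, Rminus_diag, pow_ne_zero in h1, h2 by lia.
  rewrite (Rabs_pos_eq (t - a)) by lra; apply Rabs_le; lra.
- assert (hx : forall s, (s = 1 \/ s = -1) ->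
    c * (a - a) ^ S k - s * RInt g a a <= c * (a - t) ^ S k - s * RInt g a t).
  { intros s hs; apply (derive_nonincreasing
      (fun x => c * (a - x) ^ S k - s * RInt g a x)
      (fun x => - (c * (INR k + 1) * (a - x) ^ k) - s * g x)); [lra | |].
    - intros x hx; evar_last.
      + apply @is_derive_minus; apply is_derive_scal; [| apply hI].
        apply is_derive_pow, @is_derive_minus;
          [apply @is_derive_const | apply @is_derive_id].
      + unfold minus, plus, opp, scal, one, zero; simpl;
        unfold mult; simpl.
        change (match k with 0%nat => 1 | S _ => INR k + 1 end) with (INR (S k)).
        rewrite S_INR; ring.
    - intros x hx; rewrite hc; generalize (hb x).
      rewrite (Rabs_left1 (x - a)) by lra.
      replace (- (x - a)) with (a - x) by ring; intros h.
      apply Rabs_le_between in h; destruct hs as [->| ->]; lra. }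
  assert (h1 := hx 1 (or_introl eq_refl)).
  assert (h2 := hx (-1) (or_intror eq_refl)).
  rewrite ha, Rminus_diag, pow_ne_zero in h1, h2 by lia.
  rewrite (Rabs_left1 (t - a)) by lra.
  replace (- (t - a)) with (a - t) by ring; apply Rabs_le; lra.
Qed.

Section Picard.

Variables (A B G : R -> R) (C L t0 y0 p0 : R).
Hypothesis hA : forall t, continuous A t.
Hypothesis hB : forall t, continuous B t.
Hypothesis hAC : forall t, Rabs (A t) <= C.
Hypothesis hBC : forall t, Rabs (B t) <= C.
Hypothesis hL : 0 <= L.
Hypothesis hG : forall y z, Rabs (G y - G z) <= L * Rabs (y - z).

Fixpoint picard (m : nat) : (R -> R) * (R -> R) :=
  match m with
  | O => (fun _ => y0, fun _ => p0)
  | S m => (fun t => y0 + RInt (snd (picard m)) t0 t,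
            fun t => p0 + RInt (fun u => A u * snd (picard m) u
                                        + B u * G (fst (picard m) u)) t0 t)
  end.

Let Y m := fst (picard m).
Let P m := snd (picard m).
Let F m u := A u * P m u + B u * G (Y m u).

Lemma lipschitz_continuous t : continuous G t.
Proof.
apply continuity_pt_filterlim; intros eps heps.
exists (eps / (L + 1)); split; [apply Rdiv_lt_0_compat; lra |].
intros z [_ hz]; simpl in *; unfold Rdist in *.
apply Rle_lt_trans with (L * Rabs (z - t)); [apply hG |].
assert (hL1 : L + 1 > 0) by lra.
apply (proj2 (Rlt_div_r _ _ _ hL1)) in hz.
generalize (Rabs_pos (z - t)); nra.
Qed.

Lemma picard_continuous m t : continuous (Y m) t /\ continuous (P m) t.
Proof.
revert t; induction m as [|m IH]; intros t.
- split; apply continuous_const.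
- assert (hF : forall u, continuous (F m) u).
  { intros u; destruct (IH u) as [h1 h2].
    apply @continuous_plus; apply @continuous_mult; auto.
    apply (continuous_comp (Y m) G); [exact h1 | apply lipschitz_continuous]. }
  split; apply @continuous_plus; try apply continuous_const.
  + apply (derive_continuous _ _ (P m t)), RInt_derive_continuous; apply IH.
  + apply (derive_continuous _ _ (F m t)), RInt_derive_continuous, hF.
Qed.

Lemma picard_field_continuous m u : continuous (F m) u.
Proof.
destruct (picard_continuous m u) as [h1 h2].
apply @continuous_plus; apply @continuous_mult; auto.
apply (continuous_comp (Y m) G); [exact h1 | apply lipschitz_continuous].
Qed.

Lemma picard_derive m t :
  is_derive (Y (S m)) t (P m t) /\ is_derive (P (S m)) t (F m t).
Proof.
split; rewrite <- Rplus_0_l; apply @is_derive_plus; try apply @is_derive_const.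
- apply (RInt_derive_continuous (P m)); apply picard_continuous.
- apply (RInt_derive_continuous (F m)); apply picard_field_continuous.
Qed.

Let K := 1 + C + C * L.
Let M := Rabs p0 + (C * Rabs p0 + C * Rabs (G y0)).

Lemma picard_step m t :
  Rabs (Y (S m) t - Y m t) <= M * K ^ m * Rabs (t - t0) ^ S m / INR (Factorial.fact (S m)) /\
  Rabs (P (S m) t - P m t) <= M * K ^ m * Rabs (t - t0) ^ S m / INR (Factorial.fact (S m)).
Proof.
assert (hC : 0 <= C) by (generalize (hAC 0) (Rabs_pos (A 0)); lra).
assert (hK : 1 <= K) by (unfold K; nra).
assert (q1 := Rabs_pos p0); assert (q2 := Rabs_pos (G y0)).
assert (hM : 0 <= M) by (unfold M; nra).
assert (hca : forall u v : R, u + v - u = v) by (intros; ring).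
assert (hcb : forall u v w : R, (u + v) - (u + w) = v - w) by (intros; ring).
revert t; induction m as [|m IH]; intros t.
- split; unfold Y, P; simpl fst; simpl snd.
  + rewrite hca.
    apply (RInt_pow_bound (fun _ => p0) t0 (M * K ^ 0) 0);
      [intros; apply continuous_const |].
    intros x; simpl; unfold M; nra.
  + rewrite hca.
    apply (RInt_pow_bound (F 0) t0 (M * K ^ 0) 0); [apply picard_field_continuous |].
    intros x; simpl; rewrite !Rmult_1_r, Rdiv_1_r.
    eapply Rle_trans; [apply Rabs_triang |]; rewrite !Rabs_mult.
    assert (h1 := Rmult_le_compat_r _ _ _ q1 (hAC x)).
    assert (h2 := Rmult_le_compat_r _ _ _ q2 (hBC x)).
    unfold M, Y, P; simpl; lra.
- assert (hc : forall x, 0 <= M * K ^ m * Rabs (x - t0) ^ S m / INR (Factorial.fact (S m))).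
  { intros x; apply Rdiv_le_0_compat; [| apply INR_fact_lt_0].
    repeat apply Rmult_le_pos; try apply pow_le; try apply Rabs_pos; lra. }
  assert (hd : forall (f g : R -> R) s, (forall x, continuous f x) ->
    (forall x, continuous g x) -> RInt f t0 s - RInt g t0 s
      = RInt (fun x => f x - g x) t0 s).
  { intros f g s hf hg; symmetry; apply (RInt_minus f g).
    - apply (ex_RInt_continuous (V := R_CompleteNormedModule)); intros; apply hf.
    - apply (ex_RInt_continuous (V := R_CompleteNormedModule)); intros; apply hg. }
  split.
  + replace (Y (S (S m)) t - Y (S m) t)
      with (RInt (P (S m)) t0 t - RInt (P m) t0 t)
      by (symmetry; apply hcb).
    rewrite hd by (intros; apply picard_continuous).
    apply (RInt_pow_bound (fun x => P (S m) x - P m x) t0 (M * K ^ S m) (S m)).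
    * intros x; apply @continuous_minus; apply picard_continuous.
    * intros x; eapply Rle_trans; [apply IH |].
      generalize (hc x); simpl pow; unfold Rdiv; intros; 
      set (z := M * K ^ m * (Rabs (x - t0) * Rabs (x - t0) ^ m) * / INR (Factorial.fact (S m))) in *;
      match goal with |- _ <= ?r => replace r with (K * z) by (unfold z; ring) end.
      nra.
  + replace (P (S (S m)) t - P (S m) t)
      with (RInt (F (S m)) t0 t - RInt (F m) t0 t)
      by (symmetry; apply hcb).
    rewrite hd by (intros; apply picard_field_continuous).
    apply (RInt_pow_bound (fun x => F (S m) x - F m x) t0 (M * K ^ S m) (S m)).
    * intros x; apply @continuous_minus; apply picard_field_continuous.
    * intros x; destruct (IH x) as [i1 i2].
      specialize (hc x); revert hc i1 i2; simpl pow; unfold Rdiv.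
      match goal with |- 0 <= ?z0 -> _ => set (z := z0) end; intros hc i1 i2.
      match goal with |- _ <= ?r => replace r with (K * z) by (unfold z; ring) end.
      unfold F.
      replace (A x * P (S m) x + B x * G (Y (S m) x)
               - (A x * P m x + B x * G (Y m x)))
        with (A x * (P (S m) x - P m x) + B x * (G (Y (S m) x) - G (Y m x))) by ring.
      eapply Rle_trans; [apply Rabs_triang |]; rewrite !Rabs_mult.
      assert (h3 := hG (Y (S m) x) (Y m x)).
      assert (h4 : Rabs (A x) * Rabs (P (S m) x - P m x) <= C * z)
        by (apply Rmult_le_compat; auto; apply Rabs_pos).
      assert (h5 : Rabs (B x) * Rabs (G (Y (S m) x) - G (Y m x)) <= C * (L * z)).
      { apply Rmult_le_compat; auto; try apply Rabs_pos.
        eapply Rle_trans; [exact h3 |]; now apply Rmult_le_compat_l. }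
      unfold K; nra.
Qed.

Lemma picard_majorant_cauchy T :
  forall eps : posreal, exists N, forall n m x, Rabs (x - t0) <= T ->
    (N <= n)%nat -> (N <= m)%nat ->
    Rabs (Y n x - Y m x) < eps /\ Rabs (P n x - P m x) < eps.
Proof.
assert (hC : 0 <= C) by (generalize (hAC 0) (Rabs_pos (A 0)); lra).
assert (hK : 1 <= K) by (unfold K; nra).
assert (q1 := Rabs_pos p0); assert (q2 := Rabs_pos (G y0)).
assert (hM : 0 <= M) by (unfold M; nra).
set (b := fun j => M * K ^ j * T ^ S j / INR (Factorial.fact (S j))).
assert (hb : ex_finite_lim_seq (sum_n b)).
{ assert (he : ex_series (fun j => M / K * (/ INR (Factorial.fact (S j)) * (K * T) ^ S j))).
  { apply (ex_series_scal (V := R_NormedModule) (M / K)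
      (fun j => / INR (Factorial.fact (S j)) * (K * T) ^ S j)).
    apply (ex_series_incr_1 (V := R_NormedModule)
      (fun j => / INR (Factorial.fact j) * (K * T) ^ j)).
    exists (exp (K * T)).
    apply (is_series_ext (fun j => scal (pow_n (K * T) j) (/ INR (Factorial.fact j)))).
    - intros j; rewrite pow_n_pow; unfold scal; simpl; unfold mult; simpl; ring.
    - apply is_exp_Reals. }
  destruct he as [l hl]; exists l.
  assert (hj : forall j,
    M / K * (/ INR (Factorial.fact (S j)) * (K * T) ^ S j) = b j).
  { intros j; unfold b; rewrite Rpow_mult_distr.
    change (K ^ S j) with (K * K ^ j).
    field; split; [apply INR_fact_neq_0 | lra]. }
  exact (is_series_ext _ b l hj hl). }
apply ex_lim_seq_cauchy_corr in hb; intros eps.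
destruct (hb eps) as [N hN].
assert (hle : forall i k x, Rabs (x - t0) <= T ->
  Rabs (Y (S i + k) x - Y (S i) x) <= sum_n b (i + k) - sum_n b i /\
  Rabs (P (S i + k) x - P (S i) x) <= sum_n b (i + k) - sum_n b i).
{ intros i k x hx; induction k as [|k IH].
  - rewrite !Nat.add_0_r, !Rminus_diag, Rabs_R0; lra.
  - rewrite !Nat.add_succ_r, sum_Sn.
    destruct (picard_step (S i + k) x) as [h1 h2].
    assert (h3 : M * K ^ (S i + k) * Rabs (x - t0) ^ S (S i + k)
                  / INR (Factorial.fact (S (S i + k))) <= b (S (i + k))).
    { unfold b; simpl Nat.add; unfold Rdiv; apply Rmult_le_compat_r.
      - left; apply Rinv_0_lt_compat, INR_fact_lt_0.
      - apply Rmult_le_compat_l; [apply Rmult_le_pos; [lra | apply pow_le; lra] |].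
        apply pow_incr; split; [apply Rabs_pos | exact hx]. }
    unfold plus; simpl AbelianMonoid.plus; simpl.
    destruct IH as [IH1 IH2]; simpl in *; split.
    + replace (Y (S (S (i + k))) x - Y (S i) x) with
        ((Y (S (S (i + k))) x - Y (S (i + k)) x) + (Y (S (i + k)) x - Y (S i) x)) by ring.
      eapply Rle_trans; [apply Rabs_triang |]; lra.
    + replace (P (S (S (i + k))) x - P (S i) x) with
        ((P (S (S (i + k))) x - P (S (i + k)) x) + (P (S (i + k)) x - P (S i) x)) by ring.
      eapply Rle_trans; [apply Rabs_triang |]; lra. }
assert (hlt : forall i j x, Rabs (x - t0) <= T -> (N <= i <= j)%nat ->
  Rabs (Y (S j) x - Y (S i) x) < eps /\ Rabs (P (S j) x - P (S i) x) < eps).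
{ intros i j x hx hij; replace j with (i + (j - i))%nat by lia.
  destruct (hle i (j - i)%nat x hx) as [h1 h2].
  assert (h3 := hN (i + (j - i))%nat i ltac:(lia) ltac:(lia)).
  apply Rabs_lt_between in h3; simpl in *; lra. }
exists (S N); intros [|n] [|m] x hx hn hm; try lia.
destruct (Nat.le_ge_cases n m) as [h|h].
- rewrite (Rabs_minus_sym (Y _ x)), (Rabs_minus_sym (P _ x)); apply hlt; [exact hx | lia].
- apply hlt; [exact hx | lia].
Qed.

(** The iterates and their derivatives converge uniformly on compact intervals, so
    the limit may be differentiated term by term. *)
Lemma picard_solution :
  exists y p : R -> R, y t0 = y0 /\ p t0 = p0 /\
    forall t, is_derive y t (p t) /\ is_derive p t (A t * p t + B t * G (y t)).
Proof.
assert (hcv : forall t, ex_finite_lim_seq (fun m => Y m t)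
                     /\ ex_finite_lim_seq (fun m => P m t)).
{ intros t; split; apply ex_lim_seq_cauchy_corr; intros eps;
  destruct (picard_majorant_cauchy (Rabs (t - t0)) eps) as [N hN];
  exists N; intros n m hn hm; now apply (hN n m t (Rle_refl _)). }
set (y := fun t => Lim_seq (fun m => Y m t) : R).
set (p := fun t => Lim_seq (fun m => P m t) : R).
assert (hy : forall t, is_lim_seq (fun m => Y m t) (y t))
  by (intros t; apply Lim_seq_correct', hcv).
assert (hp : forall t, is_lim_seq (fun m => P m t) (p t))
  by (intros t; apply Lim_seq_correct', hcv).
exists y, p; split; [| split].
- unfold y; rewrite (Lim_seq_ext _ (fun _ => y0)); [now rewrite Lim_seq_const |].
  intros [|m]; unfold Y; simpl; [reflexivity |].
  rewrite RInt_point; apply Rplus_0_r.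
- unfold p; rewrite (Lim_seq_ext _ (fun _ => p0)); [now rewrite Lim_seq_const |].
  intros [|m]; unfold P; simpl; [reflexivity |].
  rewrite RInt_point; apply Rplus_0_r.
- intros t; set (T := Rabs (t - t0) + 1).
  set (I := fun x => Rabs (x - t0) < T).
  assert (hI : I t) by (unfold I, T; lra).
  assert (hopen : open I).
  { intros x hx.
    assert (hr : 0 < T - Rabs (x - t0)) by (unfold I in hx; lra).
    exists (mkposreal _ hr); intros z hz.
    change (Rabs (z - x) < T - Rabs (x - t0)) in hz; unfold I.
    replace (z - t0) with ((z - x) + (x - t0)) by ring.
    eapply Rle_lt_trans; [apply Rabs_triang | lra]. }
  assert (hconn : is_connected I).
  { intros u v x hu hv hx; unfold I in *.
    apply Rabs_lt_between in hu, hv; apply Rabs_lt_between; lra. }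
  assert (dY : forall m x, Derive (Y (S m)) x = P m x)
    by (intros m x; apply is_derive_unique, picard_derive).
  assert (dP : forall m x, Derive (P (S m)) x = F m x)
    by (intros m x; apply is_derive_unique, picard_derive).
  split.
  + apply (is_derive_ext (fun x => Lim_seq (fun m => Y (S m) x) : R)).
    { intros x; unfold y; now rewrite (Lim_seq_incr_1 (fun m => Y m x)). }
    replace (p t) with (Lim_seq (fun m => Derive (Y (S m)) t) : R)
      by (unfold p; now rewrite (Lim_seq_ext _ _ (fun m => dY m t))).
    apply (CVU_Derive (fun m x => Y (S m) x) I); auto.
    * apply CVU_dom_cauchy; intros eps.
      destruct (picard_majorant_cauchy T eps) as [N hN]; exists N.
      intros n m x hx hn hm; apply hN; [left; exact hx | lia | lia].
    * intros m x _; exists (P m x); apply picard_derive.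
    * intros m x _; apply (continuity_pt_ext (P m)); [intros; now rewrite dY |].
      apply continuity_pt_filterlim, picard_continuous.
    * apply CVU_dom_cauchy; intros eps.
      destruct (picard_majorant_cauchy T eps) as [N hN]; exists N.
      intros n m x hx hn hm; rewrite !dY; apply hN; [left; exact hx | lia | lia].
  + apply (is_derive_ext (fun x => Lim_seq (fun m => P (S m) x) : R)).
    { intros x; unfold p; now rewrite (Lim_seq_incr_1 (fun m => P m x)). }
    replace (A t * p t + B t * G (y t))
      with (Lim_seq (fun m => Derive (P (S m)) t) : R).
    2: { rewrite (Lim_seq_ext _ _ (fun m => dP m t)).
         rewrite (is_lim_seq_unique _ (A t * p t + B t * G (y t))); [reflexivity |].
         apply is_lim_seq_plus'.
         - apply (is_lim_seq_scal_l _ (A t) (p t)), hp.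
         - apply (is_lim_seq_scal_l _ (B t) (G (y t))), is_lim_seq_continuous; [|apply hy].
           apply continuity_pt_filterlim, lipschitz_continuous. }
    apply (CVU_Derive (fun m x => P (S m) x) I); auto.
    * apply CVU_dom_cauchy; intros eps.
      destruct (picard_majorant_cauchy T eps) as [N hN]; exists N.
      intros n m x hx hn hm; apply hN; [left; exact hx | lia | lia].
    * intros m x _; exists (F m x); apply picard_derive.
    * intros m x _; apply (continuity_pt_ext (F m)); [intros; now rewrite dP |].
      apply continuity_pt_filterlim, picard_field_continuous.
    * apply CVU_dom_cauchy; intros eps.
      assert (hC : 0 <= C) by (generalize (hAC 0) (Rabs_pos (A 0)); lra).
      assert (hKp : 0 < K) by (unfold K; nra).
      destruct (picard_majorant_cauchy T
        (mkposreal (eps / K) (Rdiv_lt_0_compat _ _ (cond_pos eps) hKp))) as [N hN].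
      exists N; intros n m x hx hn hm; rewrite !dP.
      destruct (hN n m x (Rlt_le _ _ hx) hn hm) as [h1 h2]; simpl in h1, h2.
      apply (Rlt_div_r _ _ _ hKp) in h1; apply (Rlt_div_r _ _ _ hKp) in h2.
      unfold F.
      replace (A x * P n x + B x * G (Y n x) - (A x * P m x + B x * G (Y m x)))
        with (A x * (P n x - P m x) + B x * (G (Y n x) - G (Y m x))) by ring.
      eapply Rle_lt_trans; [apply Rabs_triang |]; rewrite !Rabs_mult.
      assert (h3 := hG (Y n x) (Y m x)).
      assert (h4 : Rabs (A x) * Rabs (P n x - P m x) <= C * Rabs (P n x - P m x))
        by (apply Rmult_le_compat_r; auto; apply Rabs_pos).
      assert (h5 : Rabs (B x) * Rabs (G (Y n x) - G (Y m x))
                   <= C * (L * Rabs (Y n x - Y m x))).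
      { apply Rmult_le_compat; auto; apply Rabs_pos. }
      assert (q3 := Rabs_pos (P n x - P m x)); assert (q4 := Rabs_pos (Y n x - Y m x)).
      destruct (Rle_dec (Rabs (P n x - P m x)) (Rabs (Y n x - Y m x))) as [hh|hh].
      -- apply Rle_lt_trans with (Rabs (Y n x - Y m x) * K); [unfold K; nra | exact h1].
      -- apply Rle_lt_trans with (Rabs (P n x - P m x) * K); [unfold K |exact h2].
         assert (Rabs (Y n x - Y m x) <= Rabs (P n x - P m x)) by lra.
         assert (C * (L * Rabs (Y n x - Y m x)) <= C * (L * Rabs (P n x - P m x)))
           by (apply Rmult_le_compat_l; [lra | now apply Rmult_le_compat_l]).
         nra.
Qed.

End Picard.

(** * Smoothness by closure under differentiation *)

Section Bootstrapping.

Variables (I : R -> Prop) (base : (R -> R) -> Prop).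
Hypothesis hI : open I.

(** The algebra generated by [base].  If it contains the derivatives of its
    generators it is closed under differentiation, so all its elements are smooth;
    for solutions of an equation, the equation itself supplies the derivative of
    the last generator. *)
Inductive generated : (R -> R) -> Prop :=
| gen_base f : base f -> generated f
| gen_const c : generated (fun _ => c)
| gen_plus f g : generated f -> generated g -> generated (fun x => f x + g x)
| gen_mult f g : generated f -> generated g -> generated (fun x => f x * g x).

Hypothesis hbase : forall f, base f ->
  exists f', generated f' /\ forall x, I x -> is_derive f x (f' x).

Lemma generated_derive f : generated f ->
  exists f', generated f' /\ forall x, I x -> is_derive f x (f' x).
Proof.
induction 1 as [f hf | c | f g hf [f' [hf' df]] hg [g' [hg' dg]]
               | f g hf [f' [hf' df]] hg [g' [hg' dg]]].
- now apply hbase.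
- exists (fun _ => 0); split; [apply gen_const |].
  intros x _; apply (is_derive_const c).
- exists (fun x => f' x + g' x); split; [now apply gen_plus |].
  intros x hx; apply (is_derive_plus f g); auto.
- exists (fun x => f' x * g x + f x * g' x); split.
  + apply gen_plus; now apply gen_mult.
  + intros x hx; apply (is_derive_mult f g); auto; intros; apply Rmult_comm.
Qed.

Lemma generated_derive_n f k : generated f ->
  exists g, generated g /\ forall x, I x -> Derive_n f k x = g x.
Proof.
intros hf; induction k as [|k [g [hg eg]]].
- now exists f.
- destruct (generated_derive g hg) as [g' [hg' dg]].
  exists g'; split; [exact hg' |]; intros x hx; simpl.
  rewrite <- (is_derive_unique g x (g' x)) by now apply dg.
  apply Derive_ext_loc; generalize (hI x hx); apply filter_imp; exact eg.
Qed.

Lemma generated_smooth f k x : generated f -> I x -> ex_derive_n f k x.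
Proof.
intros hf hx; destruct k as [|k]; [exact Logic.I |].
destruct (generated_derive_n f k hf) as [g [hg eg]].
destruct (generated_derive g hg) as [g' [_ dg]].
exists (g' x); apply (is_derive_ext_loc g); [| now apply dg].
generalize (hI x hx); apply filter_imp; intros y hy; now rewrite eg.
Qed.

End Bootstrapping.

(** * Local solutions of the profile equation *)

Definition profile_ode (N x v v1 v2 : R) : Prop :=
  (1 - x ^ 2) * v2 + ((N - 1) / x - 2 / 3 * x) * v1 + 2 / 9 * v - 1 / v ^ 2 = 0.

Definition smooth_profile_at (N : R) (v : R -> R) (x : R) : Prop :=
  0 < v x /\ (forall k, ex_derive_n v k x) /\
  (0 < x -> profile_ode N x (v x) (Derive v x) (Derive_n v 2 x)).

Lemma smooth_profile_ext N v v' x :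
  locally x (fun y => v y = v' y) ->
  smooth_profile_at N v x -> smooth_profile_at N v' x.
Proof.
intros he [h0 [h1 h2]].
assert (hx := locally_singleton x _ he); simpl in hx.
split; [now rewrite <- hx |]; split.
- intros k; apply (ex_derive_n_ext_loc v); auto.
- intros hpos; rewrite <- hx, <- (Derive_ext_loc v v' x he).
  rewrite <- (Derive_n_ext_loc v v' 2 x he); now apply h2.
Qed.

Definition glue (m : R) (v w : R -> R) (x : R) : R :=
  if Rlt_dec x m then v x else w x.

Lemma glue_left m v w x : x < m -> glue m v w x = v x.
Proof. intros h; unfold glue; now destruct (Rlt_dec x m). Qed.

Lemma glue_right m v w x : m <= x -> glue m v w x = w x.
Proof. intros h; unfold glue; destruct (Rlt_dec x m); [lra | easy]. Qed.

Lemma glue_smooth_profile N m v w x :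
  locally m (fun y => v y = w y) ->
  (x <= m -> smooth_profile_at N v x) -> (m < x -> smooth_profile_at N w x) ->
  smooth_profile_at N (glue m v w) x.
Proof.
intros he hv hw; destruct (Rtotal_order x m) as [h|[h|h]].
- apply (smooth_profile_ext N v); [| apply hv; lra].
  generalize (open_lt m x h); apply filter_imp; intros y hy.
  now rewrite glue_left.
- subst m; apply (smooth_profile_ext N v); [| apply hv; lra].
  revert he; apply filter_imp; intros y hy; unfold glue.
  now destruct (Rlt_dec y x).
- apply (smooth_profile_ext N w); [| apply hw; lra].
  generalize (open_gt m x h); apply filter_imp; intros y hy.
  rewrite glue_right; [easy | lra].
Qed.

(** The squared distance of the Cauchy data satisfies a linear differential
    inequality once the cross terms are absorbed by [2 u v <= u ^ 2 + v ^ 2]. *)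
Lemma second_order_gronwall (y p f z q g : R -> R) C xi a b :
  a <= b -> 0 <= C -> 
  (forall t, a <= t <= b -> is_derive y t (p t)) ->
  (forall t, a <= t <= b -> is_derive p t (f t)) ->
  (forall t, a <= t <= b -> is_derive z t (q t)) ->
  (forall t, a <= t <= b -> is_derive q t (g t)) ->
  (forall t, a <= t <= b ->
     Rabs (f t - g t) <= C * Rabs (p t - q t) + C * Rabs (y t - z t) + xi) ->
  (y b - z b) ^ 2 + (p b - q b) ^ 2
  <= ((y a - z a) ^ 2 + (p a - q a) ^ 2 + xi ^ 2 * (b - a))
     * exp ((2 + 3 * C) * (b - a)).
Proof.
intros hab hC hy hp hz hq hfg.
apply (gronwall (fun t => (y t - z t) ^ 2 + (p t - q t) ^ 2)
  (fun t => 2 * (y t - z t) * (p t - q t) + 2 * (p t - q t) * (f t - g t)));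
  [exact hab | lra | apply pow2_ge_0 | |].
- intros t ht.
  evar_last.
  + apply @is_derive_plus; apply is_derive_pow, @is_derive_minus; auto.
  + unfold minus, plus, opp; simpl; ring.
- intros t ht; specialize (hfg t ht).
  set (u := y t - z t) in *; set (w := p t - q t) in *; set (h := f t - g t) in *.
  assert (h1 := pow2_ge_0 (u - w)).
  assert (h2 : w * h <= Rabs w * (C * Rabs w + C * Rabs u + xi)).
  { apply Rle_trans with (Rabs w * Rabs h).
    - rewrite <- Rabs_mult; apply Rle_abs.
    - apply Rmult_le_compat_l; [apply Rabs_pos | exact hfg]. }
  assert (hu := pow2_abs u); assert (hw := pow2_abs w).
  revert h2 hu hw; generalize (Rabs u) (Rabs w); intros U W h2 hu hw.
  assert (h3 : 0 <= C * (W - U) ^ 2) by (apply Rmult_le_pos, pow2_ge_0; exact hC).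
  assert (h4 := pow2_ge_0 (W - xi)).
  assert (h5 : 0 <= C * U ^ 2) by (apply Rmult_le_pos, pow2_ge_0; exact hC).
  assert (h6 := pow2_ge_0 U).
  rewrite <- hu, <- hw in *; lra.
Qed.

(** Two semilinear equations with nearby coefficients: the differences of the
    coefficients, seen along the second solution, are the perturbation. *)
Lemma semilinear_gronwall (A B A' B' G y p z q : R -> R) CA CB L C xi a b :
  a <= b -> 0 <= CB -> CA + CB * L <= C -> 0 <= CA -> 0 <= L ->
  (forall u v, Rabs (G u - G v) <= L * Rabs (u - v)) ->
  (forall t, a <= t <= b -> Rabs (A t) <= CA /\ Rabs (B t) <= CB /\
     Rabs (A t - A' t) * Rabs (q t) + Rabs (B t - B' t) * Rabs (G (z t)) <= xi) ->
  (forall t, a <= t <= b ->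
     is_derive y t (p t) /\ is_derive p t (A t * p t + B t * G (y t))) ->
  (forall t, a <= t <= b ->
     is_derive z t (q t) /\ is_derive q t (A' t * q t + B' t * G (z t))) ->
  (y b - z b) ^ 2 + (p b - q b) ^ 2
  <= ((y a - z a) ^ 2 + (p a - q a) ^ 2 + xi ^ 2 * (b - a))
     * exp ((2 + 3 * C) * (b - a)).
Proof.
intros hab hCB hC hCA hL hG hco hy hz.
assert (hCL : 0 <= CB * L) by now apply Rmult_le_pos.
apply (second_order_gronwall y p (fun t => A t * p t + B t * G (y t))
  z q (fun t => A' t * q t + B' t * G (z t))); try lra.
1,2 : intros t ht; apply (hy t ht).
1,2 : intros t ht; apply (hz t ht).
intros t ht; destruct (hco t ht) as (hA & hB & hxi).
replace (A t * p t + B t * G (y t) - (A' t * q t + B' t * G (z t)))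
  with (A t * (p t - q t) + (B t * (G (y t) - G (z t))
        + ((A t - A' t) * q t + (B t - B' t) * G (z t)))) by ring.
eapply Rle_trans; [apply Rabs_triang |].
eapply Rle_trans; [apply Rplus_le_compat_l, Rabs_triang |].
eapply Rle_trans; [apply Rplus_le_compat_l, Rplus_le_compat_l, Rabs_triang |].
rewrite !Rabs_mult.
assert (h1 := Rmult_le_compat _ _ _ _ (Rabs_pos _) (Rabs_pos _) hA (Rle_refl (Rabs (p t - q t)))).
assert (h2 := Rmult_le_compat _ _ _ _ (Rabs_pos _) (Rabs_pos _) hB (hG (y t) (z t))).
assert (h3 : (CA + CB * L) * (Rabs (p t - q t) + Rabs (y t - z t))
             <= C * (Rabs (p t - q t) + Rabs (y t - z t))).
{ apply Rmult_le_compat_r; [| exact hC].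
  apply Rplus_le_le_0_compat; apply Rabs_pos. }
generalize (Rmult_le_pos _ _ hCA (Rabs_pos (y t - z t)))
  (Rmult_le_pos _ _ hCL (Rabs_pos (p t - q t))); lra.
Qed.

Lemma inv_square_lipschitz m y z :
  0 < m -> m <= y -> m <= z -> Rabs (1 / y ^ 2 - 1 / z ^ 2) <= 2 / m ^ 3 * Rabs (y - z).
Proof.
intros hm hy hz.
replace (1 / y ^ 2 - 1 / z ^ 2)
  with ((/ (y ^ 2 * z) + / (y * z ^ 2)) * (z - y)) by (field; lra).
rewrite Rabs_mult, (Rabs_minus_sym z y); apply Rmult_le_compat_r; [apply Rabs_pos |].
assert (h1 : m ^ 3 <= y ^ 2 * z).
{ replace (m ^ 3) with (m ^ 2 * m) by ring; apply Rmult_le_compat; try lra.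
  - apply pow2_ge_0.
  - apply pow_incr; lra. }
assert (h2 : m ^ 3 <= y * z ^ 2).
{ replace (m ^ 3) with (m * m ^ 2) by ring; apply Rmult_le_compat; try lra.
  - apply pow2_ge_0.
  - apply pow_incr; lra. }
assert (h3 : 0 < m ^ 3) by (apply pow_lt; lra).
assert (i1 := Rinv_le_contravar _ _ h3 h1).
assert (i2 := Rinv_le_contravar _ _ h3 h2).
rewrite Rabs_pos_eq; [lra |].
apply Rplus_le_le_0_compat; left; apply Rinv_0_lt_compat; lra.
Qed.

Lemma continuous_bounded (f : R -> R) a b :
  a <= b -> (forall x, a <= x <= b -> continuity_pt f x) ->
  exists C, 0 <= C /\ forall x, a <= x <= b -> Rabs (f x) <= C.
Proof.
intros hab hf.
destruct (continuity_ab_maj f a b hab hf) as [u [hu _]].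
destruct (continuity_ab_min f a b hab hf) as [l [hl _]].
exists (Rabs (f u) + Rabs (f l)); split.
- generalize (Rabs_pos (f u)) (Rabs_pos (f l)); lra.
- intros x hx; apply Rabs_le.
  generalize (hu x hx) (hl x hx) (Rle_abs (f u)) (Rabs_pos (f u)) (Rabs_pos (f l))
    (Rabs_maj2 (f l)); lra.
Qed.

Lemma smooth_profile_derivatives N v x :
  smooth_profile_at N v x ->
  is_derive v x (Derive v x) /\ is_derive (Derive v) x (Derive_n v 2 x).
Proof.
intros [_ [h _]]; split; apply Derive_correct; [apply (h 1%nat) | apply (h 2%nat)].
Qed.

(** Away from [eta = 0] and [eta = 1] the equation can be solved for the second
    derivative, and on a compact interval positivity bounds the solutions away from
    the singularity of [1 / v ^ 2]. *)
Lemma smooth_profile_unique N v w a b :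
  0 < a -> a <= b -> b < 1 \/ 1 < a ->
  (forall x, a <= x <= b -> smooth_profile_at N v x) ->
  (forall x, a <= x <= b -> smooth_profile_at N w x) ->
  v a = w a -> Derive v a = Derive w a ->
  forall x, a <= x <= b -> v x = w x.
Proof.
intros ha hab h1 hv hw e0 e1 x hx.
assert (hne : forall z, a <= z <= b -> 1 - z ^ 2 <> 0) by (intros z hz; nra).
assert (hpos : forall u, (forall z, a <= z <= b -> smooth_profile_at N u z) ->
  exists m, 0 < m /\ forall z, a <= z <= b -> m <= u z).
{ intros u hu; destruct (continuity_ab_min u a b hab) as [z [hz hz']].
  - intros z hz; apply (derive_continuity_pt u z (Derive u z)).
    exact (proj1 (smooth_profile_derivatives N u z (hu z hz))).
  - exists (u z); split; [apply hu, hz' | exact hz]. }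
destruct (hpos v hv) as [m1 [hm1 hvm]]; destruct (hpos w hw) as [m2 [hm2 hwm]].
set (m := Rmin m1 m2).
assert (hm : 0 < m) by (now apply Rmin_glb_lt).
assert (hm1' : m <= m1) by apply Rmin_l; assert (hm2' : m <= m2) by apply Rmin_r.
destruct (continuous_bounded (fun z => ((N - 1) / z - 2 / 3 * z) / (1 - z ^ 2)) a b hab)
  as [C1 [hC1 hA]].
{ intros z hz; apply continuity_pt_filterlim.
  apply (ex_derive_continuous (fun z => ((N - 1) / z - 2 / 3 * z) / (1 - z ^ 2))).
  assert (z <> 0) by lra; generalize (hne z hz); intros; auto_derive; repeat split; auto. }
destruct (continuous_bounded (fun z => / (1 - z ^ 2)) a b hab) as [C2 [hC2 hB]].
{ intros z hz; apply continuity_pt_filterlim.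
  apply (ex_derive_continuous (fun z => / (1 - z ^ 2))).
  generalize (hne z hz); intros; auto_derive; auto. }
set (L := 2 / 9 + 2 / m ^ 3).
assert (hL : 0 <= L).
{ unfold L; assert (0 < m ^ 3) by (apply pow_lt; lra).
  assert (0 < 2 / m ^ 3) by (apply Rdiv_lt_0_compat; lra); lra. }
assert (hCL : 0 <= C2 * L) by now apply Rmult_le_pos.
set (C := C1 + C2 * L).
assert (hN : (v x - w x) ^ 2 + (Derive v x - Derive w x) ^ 2
  <= ((v a - w a) ^ 2 + (Derive v a - Derive w a) ^ 2 + 0 ^ 2 * (x - a))
     * exp ((2 + 3 * C) * (x - a))).
{ apply (second_order_gronwall v (Derive v) (Derive_n v 2) w (Derive w) (Derive_n w 2));
    [lra | unfold C; lra | | | | |].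
  - intros t ht; assert (ht' : a <= t <= b) by lra.
    exact (proj1 (smooth_profile_derivatives N v t (hv t ht'))).
  - intros t ht; assert (ht' : a <= t <= b) by lra.
    exact (proj2 (smooth_profile_derivatives N v t (hv t ht'))).
  - intros t ht; assert (ht' : a <= t <= b) by lra.
    exact (proj1 (smooth_profile_derivatives N w t (hw t ht'))).
  - intros t ht; assert (ht' : a <= t <= b) by lra.
    exact (proj2 (smooth_profile_derivatives N w t (hw t ht'))).
  - intros t ht; assert (ht' : a <= t <= b) by lra.
    destruct (hv t ht') as [pv [_ ov]]; destruct (hw t ht') as [pw [_ ow]].
    assert (ht0 : 0 < t) by lra; specialize (ov ht0); specialize (ow ht0).
    unfold profile_ode in ov, ow; assert (hn := hne t ht').
    replace (Derive_n v 2 t - Derive_n w 2 t) with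
      (- (((N - 1) / t - 2 / 3 * t) / (1 - t ^ 2)) * (Derive v t - Derive w t)
       + - / (1 - t ^ 2) * (2 / 9 * (v t - w t) - (1 / v t ^ 2 - 1 / w t ^ 2))).
    2: { apply (Rmult_eq_reg_l (1 - t ^ 2)); [| exact hn].
         transitivity (- ((N - 1) / t - 2 / 3 * t) * (Derive v t - Derive w t)
           - (2 / 9 * (v t - w t) - (1 / v t ^ 2 - 1 / w t ^ 2))).
         - field; repeat split; lra.
         - lra. }
    eapply Rle_trans; [apply Rabs_triang |]; rewrite !Rabs_mult, !Rabs_Ropp.
    assert (i1 := Rmult_le_compat_r _ _ _ (Rabs_pos (Derive v t - Derive w t)) (hA t ht')).
    assert (i2 : Rabs (2 / 9 * (v t - w t) - (1 / v t ^ 2 - 1 / w t ^ 2))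
                 <= L * Rabs (v t - w t)).
    { unfold Rminus at 1; eapply Rle_trans; [apply Rabs_triang |].
      rewrite Rabs_Ropp, Rabs_mult, (Rabs_pos_eq (2 / 9)) by lra.
      assert (i3 := inv_square_lipschitz m (v t) (w t) hm).
      unfold L; rewrite Rmult_plus_distr_r; apply Rplus_le_compat_l, i3.
      - generalize (hvm t ht'); lra.
      - generalize (hwm t ht'); lra. }
    assert (i4 : Rabs (/ (1 - t ^ 2))
                 * Rabs (2 / 9 * (v t - w t) - (1 / v t ^ 2 - 1 / w t ^ 2))
                 <= C2 * (L * Rabs (v t - w t))).
    { apply Rmult_le_compat; try apply Rabs_pos; [now apply hB | exact i2]. }
    assert (0 <= C2 * L * Rabs (Derive v t - Derive w t))
      by (apply Rmult_le_pos; [lra | apply Rabs_pos]).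
    assert (0 <= C1 * Rabs (v t - w t)) by (apply Rmult_le_pos; [lra | apply Rabs_pos]).
    unfold C; lra. }
rewrite e0, e1, !Rminus_diag in hN.
replace ((0 ^ 2 + 0 ^ 2 + 0 ^ 2 * (x - a)) * exp ((2 + 3 * C) * (x - a)))
  with 0 in hN by ring.
assert (hs1 := pow2_ge_0 (v x - w x)); assert (hs2 := pow2_ge_0 (Derive v x - Derive w x)).
assert (hz : (v x - w x) ^ 2 = 0) by lra.
assert (hz' : v x - w x = 0) by nra; lra.
Qed.

Lemma Derive_n_two (v v1 : R -> R) (I : R -> Prop) x v2 :
  open I -> (forall y, I y -> is_derive v y (v1 y)) -> I x -> is_derive v1 x v2 ->
  Derive_n v 2 x = v2.
Proof.
intros hI hd hx h2; apply is_derive_unique, (is_derive_ext_loc v1); [| exact h2].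
generalize (hI x hx); apply filter_imp; intros y hy; symmetry.
now apply is_derive_unique, hd.
Qed.

Inductive regular_base (v v1 : R -> R) : (R -> R) -> Prop :=
| rb_val : regular_base v v1 v
| rb_der : regular_base v v1 v1
| rb_id : regular_base v v1 (fun x => x)
| rb_inv : regular_base v v1 (fun x => / x)
| rb_cone : regular_base v v1 (fun x => / (1 - x ^ 2))
| rb_inv_val : regular_base v v1 (fun x => / v x).

Lemma regular_smooth_profile N (v v1 v2 : R -> R) (I : R -> Prop) :
  open I ->
  (forall x, I x -> 0 < x /\ x <> 1 /\ 0 < v x) ->
  (forall x, I x -> is_derive v x (v1 x)) ->
  (forall x, I x -> is_derive v1 x (v2 x)) ->
  (forall x, I x -> profile_ode N x (v x) (v1 x) (v2 x)) ->
  forall x, I x -> smooth_profile_at N v x.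
Proof.
intros hI hpos hd1 hd2 hode x hx.
assert (dv : forall y, I y -> Derive v y = v1 y)
  by (intros y hy; apply is_derive_unique, hd1, hy).
split; [now apply hpos |]; split.
- intros k; apply (generated_smooth I (regular_base v v1) hI); [| | exact hx].
  2: apply gen_base, rb_val.
  set (gb := gen_base (regular_base v v1)).
  assert (gv := gb _ (rb_val v v1)); assert (gv1 := gb _ (rb_der v v1)).
  assert (gid := gb _ (rb_id v v1)); assert (ginv := gb _ (rb_inv v v1)).
  assert (gc := gb _ (rb_cone v v1)); assert (giv := gb _ (rb_inv_val v v1)).
  assert (gk := gen_const (regular_base v v1)).
  intros f [ | | | | | ].
  + now exists v1.
  + exists (fun x => / (1 - x ^ 2) * (-1 * (((N - 1) * / x + - (2 / 3) * x) * v1 x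
        + 2 / 9 * v x) + / v x * / v x)); split.
    * repeat first [apply gen_plus | apply gen_mult | assumption | apply gk].
    * intros y hy; destruct (hpos y hy) as [p1 [p2 p3]].
      assert (hn : 1 - y ^ 2 <> 0).
      { intros h; apply p2; assert (h0 : (1 - y) * (1 + y) = 0) by (rewrite <- h; ring).
        apply Rmult_integral in h0; lra. }
      replace (_ * _) with (v2 y); [now apply hd2 |].
      assert (ho := hode y hy); unfold profile_ode in ho.
      apply (Rmult_eq_reg_l (1 - y ^ 2)); [| exact hn].
      transitivity (- ((N - 1) / y - 2 / 3 * y) * v1 y - 2 / 9 * v y + 1 / v y ^ 2); [lra |].
      field; repeat split; lra.
  + exists (fun _ => 1); split; [apply gk | intros y _; apply (@is_derive_id R_AbsRing)].
  + exists (fun x => -1 * (/ x * / x)); split.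
    * repeat first [apply gen_mult | assumption | apply gk].
    * intros y hy; destruct (hpos y hy) as [p1 _].
      auto_derive; [lra | field; lra].
  + exists (fun x => 2 * (x * (/ (1 - x ^ 2) * / (1 - x ^ 2)))); split.
    * repeat first [apply gen_mult | assumption | apply gk].
    * intros y hy; destruct (hpos y hy) as [p1 [p2 p3]].
      assert (hn : 1 - y ^ 2 <> 0).
      { intros h; apply p2; assert (h0 : (1 - y) * (1 + y) = 0) by (rewrite <- h; ring).
        apply Rmult_integral in h0; lra. }
      auto_derive; [intros h; apply hn; rewrite <- h; ring |].
      field; intros h; apply hn; rewrite <- h; ring.
  + exists (fun x => -1 * (v1 x * (/ v x * / v x))); split.
    * repeat first [apply gen_mult | assumption | apply gk].
    * intros y hy; destruct (hpos y hy) as [p1 [p2 p3]].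
      evar_last; [apply is_derive_inv; [now apply hd1 | lra] | field; lra].
- intros _; rewrite dv by exact hx.
  rewrite (Derive_n_two v v1 I x (v2 x)); auto.
Qed.

(** ** The variable [w = v / eta ^ (2/3)] *)

(** With [s = ln eta], [w] solves
    [(1 - eta ^ 2) w_ss + (d - eta ^ 2) w_s + k w - 1 / w ^ 2 = 0], where [d] and [k]
    are the following constants. *)
Definition damping (N : R) : R := N - 2 / 3.
Definition stiffness (N : R) : R := 2 / 3 * (N - 4 / 3).

(** [w1] and [w2] are the derivatives with respect to [x = eta]. *)
Definition scaled_ode (N x w w1 w2 : R) : Prop :=
  (1 - x ^ 2) * (x ^ 2 * w2 + x * w1) + (damping N - x ^ 2) * (x * w1)
  + stiffness N * w - 1 / w ^ 2 = 0.

Lemma Rpower_two_thirds_cube x : 0 < x -> Rpower x (2 / 3) ^ 3 = x ^ 2.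
Proof.
intros hx; rewrite <- Rpower_pow by apply exp_pos.
rewrite Rpower_mult, <- Rpower_pow by exact hx.
f_equal; simpl; field.
Qed.

Lemma Rpower_two_thirds_derive x :
  0 < x -> is_derive (fun y => Rpower y (2 / 3)) x (2 / 3 * Rpower x (2 / 3) / x).
Proof.
intros hx; unfold Rpower; auto_derive; [exact hx | field; lra].
Qed.

Lemma scaled_derive (w : R -> R) x w1 :
  0 < x -> is_derive w x w1 ->
  is_derive (fun y => Rpower y (2 / 3) * w y) x
    (Rpower x (2 / 3) * (w1 + 2 / 3 * w x / x)).
Proof.
intros hx hw; evar_last.
- apply (is_derive_mult (fun y => Rpower y (2 / 3)) w);
    [now apply Rpower_two_thirds_derive | exact hw | intros; apply Rmult_comm].
- unfold plus, mult; simpl; field; lra.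
Qed.

Lemma scaled_ode_profile N e x w w1 w2 :
  0 < x -> 0 < e -> e ^ 3 = x ^ 2 -> 0 < w -> scaled_ode N x w w1 w2 ->
  profile_ode N x (e * w) (e * (w1 + 2 / 3 * w / x))
    (e * (w2 + 4 / 3 * w1 / x - 2 / 9 * w / x ^ 2)).
Proof.
unfold profile_ode, scaled_ode, damping, stiffness; intros hx he hc hw ho.
replace (1 / (e * w) ^ 2) with (e * (1 / w ^ 2) / x ^ 2)
  by (rewrite <- hc; field; lra).
apply (Rmult_eq_reg_l (x ^ 2 / e)); [| apply Rgt_not_eq, Rdiv_lt_0_compat; nra].
rewrite Rmult_0_r, <- ho; field; lra.
Qed.

Section Scaled.

Variables (N : R) (w w1 w2 : R -> R) (I : R -> Prop).
Hypothesis hI : open I.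
Hypothesis hpos : forall x, I x -> 0 < x /\ 0 < w x.
Hypothesis hd1 : forall x, I x -> is_derive w x (w1 x).
Hypothesis hd2 : forall x, I x -> is_derive w1 x (w2 x).
Hypothesis hode : forall x, I x -> scaled_ode N x (w x) (w1 x) (w2 x).

Let v x := Rpower x (2 / 3) * w x.
Let v1 x := Rpower x (2 / 3) * (w1 x + 2 / 3 * w x / x).
Let v2 x := Rpower x (2 / 3) * (w2 x + 4 / 3 * w1 x / x - 2 / 9 * w x / x ^ 2).

Lemma scaled_second_derive x : I x -> is_derive v1 x (v2 x).
Proof.
intros hx; destruct (hpos x hx) as [p1 p3]; evar_last.
- apply (scaled_derive (fun x => w1 x + 2 / 3 * w x / x)); [exact p1 |].
  apply (is_derive_plus w1 (fun x => 2 / 3 * w x / x)); [now apply hd2 |].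
  apply (is_derive_div (fun x => 2 / 3 * w x) (fun x => x));
    [apply is_derive_scal; now apply hd1 | apply (@is_derive_id R_AbsRing) | lra].
- unfold plus, one, v2; simpl; field; lra.
Qed.

Lemma scaled_first_derive x : I x -> is_derive v x (v1 x).
Proof. intros hx; now apply scaled_derive; [apply hpos | apply hd1]. Qed.

Lemma scaled_profile x : I x -> profile_ode N x (v x) (v1 x) (v2 x).
Proof.
intros hx; destruct (hpos x hx) as [p1 p3].
apply scaled_ode_profile; auto; [apply exp_pos |].
now apply Rpower_two_thirds_cube.
Qed.

Lemma scaled_profile_Derive x :
  I x -> profile_ode N x (v x) (Derive v x) (Derive_n v 2 x).
Proof.
intros hx; rewrite (is_derive_unique v x (v1 x)) by now apply scaled_first_derive.
rewrite (Derive_n_two v v1 I x (v2 x)); auto.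
- now apply scaled_profile.
- exact scaled_first_derive.
- now apply scaled_second_derive.
Qed.

Lemma scaled_smooth_profile :
  (forall x, I x -> x <> 1) -> forall x, I x -> smooth_profile_at N v x.
Proof.
intros h1; apply (regular_smooth_profile N v v1 v2 I); auto.
- intros x hx; destruct (hpos x hx) as [p1 p3].
  split; [exact p1 |]; split; [now apply h1 |].
  apply Rmult_lt_0_compat; [apply exp_pos | exact p3].
- exact scaled_first_derive.
- exact scaled_second_derive.
- exact scaled_profile.
Qed.

End Scaled.

(** * Solutions that are regular at the centre *)

Definition iter_derive (g : nat -> R) (j : nat) : nat -> R := Nat.iter j PS_derive g.

Lemma iter_derive_cv_radius g j : CV_radius (iter_derive g j) = CV_radius g.
Proof.
induction j as [|j IH]; [reflexivity |].
unfold iter_derive; simpl; rewrite CV_radius_derive; exact IH.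
Qed.

Lemma iter_derive_comp g (u : R -> R) j x u1 :
  Rbar_lt (Rabs (u x)) (CV_radius g) -> is_derive u x u1 ->
  is_derive (fun y => PSeries (iter_derive g j) (u y)) x
    (u1 * PSeries (iter_derive g (S j)) (u x)).
Proof.
intros hcv hu; apply (is_derive_comp (PSeries (iter_derive g j)) u); [| exact hu].
apply is_derive_PSeries; now rewrite iter_derive_cv_radius.
Qed.

Section Centre.

Variable N : R.
Hypothesis hN : 2 <= N <= 7.

Lemma centre_denom m : 1 * (INR m + 1) ^ 2 <= Rabs ((INR m + 1) * (INR m + N / 2)).
Proof.
assert (h := pos_INR m); rewrite Rabs_pos_eq by nra; nra.
Qed.

(** With [mu = c ^ 3] and [X = eta ^ 2 / mu], [v / c] as a function of [X] solves
    [X (1 - mu X) f'' + (N / 2 - 5 / 6 mu X) f' = - mu / 18 f + 1 / (4 f ^ 2)], which is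
    regular in the limit [mu = 0]. *)
Definition centre_coef (mu : R) : nat -> R :=
  fuchs_coef (N / 2) mu (- (5 / 6 * mu)) (- (mu / 18)) (1 / 4).

Lemma centre_params mu :
  0 <= mu <= 1 ->
  Rabs mu + Rabs (- (5 / 6 * mu)) + Rabs (- (mu / 18)) + Rabs (1 / 4) <= 3.
Proof.
intros hmu; rewrite !Rabs_Ropp, !Rabs_pos_eq by lra; lra.
Qed.

Lemma centre_radius : fuchs_radius 1 3 = 1 / 48.
Proof. unfold fuchs_radius; field. Qed.

Lemma centre_size_ge_one : 1 <= 3.
Proof. lra. Qed.

Lemma centre_cv_radius mu X :
  0 <= mu <= 1 -> Rabs X < 1 / 48 -> Rbar_lt (Rabs X) (CV_radius (centre_coef mu)).
Proof.
intros hmu hX; rewrite <- centre_radius in hX.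
apply Rbar_lt_le_trans with (fuchs_radius 1 3); [exact hX |].
apply (fuchs_cv_radius (N / 2) 1 3 Rlt_0_1 centre_denom centre_size_ge_one).
now apply centre_params.
Qed.

Lemma centre_value mu X :
  0 <= mu <= 1 -> Rabs X < 1 / 48 ->
  3 / 4 <= PSeries (centre_coef mu) X <= 5 / 4.
Proof.
intros hmu hX; assert (hX' := hX); rewrite <- centre_radius in hX.
assert (h := fuchs_near_one (N / 2) 1 3 Rlt_0_1 centre_denom centre_size_ge_one _ _ _ _
  (centre_params mu hmu) X hX).
fold (centre_coef mu) in h; rewrite centre_radius in h.
apply Rabs_le_between in h; lra.
Qed.

Lemma centre_derive_value mu X :
  0 <= mu <= 1 -> Rabs X <= 1 / 96 ->
  Rabs (PSeries (PS_derive (centre_coef mu)) X) <= 60.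
Proof.
intros hmu hX.
assert (hX' : Rabs X <= fuchs_radius 1 3 / 2) by (rewrite centre_radius; lra).
assert (h := fuchs_derive_bound (N / 2) 1 3 Rlt_0_1 centre_denom centre_size_ge_one _ _ _ _
  (centre_params mu hmu) X hX').
fold (centre_coef mu) in h; rewrite centre_radius in h; lra.
Qed.

Lemma centre_lipschitz mu mu' X :
  0 <= mu <= 1 -> 0 <= mu' <= 1 -> Rabs X <= 1 / 96 ->
  Rabs (PSeries (centre_coef mu) X - PSeries (centre_coef mu') X)
    <= 2 * Rabs (mu - mu') /\
  Rabs (PSeries (PS_derive (centre_coef mu)) X
        - PSeries (PS_derive (centre_coef mu')) X) <= 96 * Rabs (mu - mu').
Proof.
intros hmu hmu' hX.
assert (hDp : Rabs (mu - mu') + Rabs (- (5 / 6 * mu) - - (5 / 6 * mu'))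
  + Rabs (- (mu / 18) - - (mu' / 18)) + Rabs (1 / 4 - 1 / 4) <= 2 * Rabs (mu - mu')).
{ replace (- (5 / 6 * mu) - - (5 / 6 * mu')) with (- (5 / 6) * (mu - mu')) by ring.
  replace (- (mu / 18) - - (mu' / 18)) with (- (1 / 18) * (mu - mu')) by field.
  rewrite !Rabs_mult, !Rabs_Ropp, Rminus_diag, Rabs_R0, !(Rabs_pos_eq (_ / _)) by lra.
  generalize (Rabs_pos (mu - mu')); lra. }
assert (p := Rabs_pos (mu - mu')).
split.
- assert (hX' : Rabs X < fuchs_radius 1 3) by (rewrite centre_radius; lra).
  assert (h := fuchs_PSeries_lipschitz (N / 2) 1 3 Rlt_0_1 centre_denom centre_size_ge_one
    _ _ _ _ _ _ _ _ (centre_params mu hmu) (centre_params mu' hmu') X hX').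
  fold (centre_coef mu) (centre_coef mu') in h; rewrite centre_radius in h.
  eapply Rle_trans; [exact h |].
  replace (2 * Rabs (mu - mu')) with (1 * (2 * Rabs (mu - mu'))) by ring.
  apply Rmult_le_compat; [| | | exact hDp].
  + generalize (Rabs_pos X); lra.
  + repeat apply Rplus_le_le_0_compat; apply Rabs_pos.
  + lra.
- assert (hX' : Rabs X <= fuchs_radius 1 3 / 2) by (rewrite centre_radius; lra).
  assert (h := fuchs_derive_lipschitz (N / 2) 1 3 Rlt_0_1 centre_denom centre_size_ge_one
    _ _ _ _ _ _ _ _ (centre_params mu hmu) (centre_params mu' hmu') X hX').
  fold (centre_coef mu) (centre_coef mu') in h; rewrite centre_radius in h.
  lra.
Qed.

Lemma centre_coef_zero mu : PSeries (centre_coef mu) 0 = 1.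
Proof. rewrite PSeries_0; reflexivity. Qed.

Inductive centre_base (g : nat -> R) (m : R) : (R -> R) -> Prop :=
| cb_series j : centre_base g m (fun x => PSeries (iter_derive g j) (x ^ 2 / m))
| cb_id : centre_base g m (fun x => x).

(** In the variable [eta ^ 2 / c ^ 3] the centre is a Fuchsian point with
    exponents [0] and [1 - N / 2].  As a power series in [eta ^ 2] the solution also makes sense for
    negative [eta], so that the origin is no boundary for differentiability. *)
Lemma centre_smooth_profile c x :
  0 < c <= 1 -> x ^ 2 / c ^ 3 < 1 / 48 ->
  smooth_profile_at N (fun y => c * PSeries (centre_coef (c ^ 3)) (y ^ 2 / c ^ 3)) x /\
  Derive (fun y => c * PSeries (centre_coef (c ^ 3)) (y ^ 2 / c ^ 3)) x
  = c * PSeries (PS_derive (centre_coef (c ^ 3))) (x ^ 2 / c ^ 3) * (2 * x / c ^ 3).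
Proof.
intros hc hx; set (m := c ^ 3) in *.
assert (hm : 0 < m <= 1).
{ split; [apply pow_lt; lra |].
  unfold m; rewrite <- (pow1 3); apply pow_incr; lra. }
assert (hm' : 0 <= m <= 1) by lra.
set (g := centre_coef m).
set (v := fun y => c * PSeries g (y ^ 2 / m)).
set (g1 := PS_derive g); set (g2 := PS_derive g1).
set (v1 := fun y => c * PSeries g1 (y ^ 2 / m) * (2 * y / m)).
set (v2 := c * PSeries g2 (x ^ 2 / m) * (2 * x / m) ^ 2
           + c * PSeries g1 (x ^ 2 / m) * (2 / m)).
set (I := fun y => y ^ 2 / m < 1 / 48).
assert (hI : open I).
{ apply (open_comp (fun y => y ^ 2 / m) (fun z => z < 1 / 48)); [| apply open_lt].
  intros y _; apply (ex_derive_continuous (fun y => y ^ 2 / m)).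
  auto_derive; lra. }
assert (hcv : forall y, I y -> Rbar_lt (Rabs (y ^ 2 / m)) (CV_radius g)).
{ intros y hy; apply centre_cv_radius; [exact hm' |].
  rewrite Rabs_pos_eq; [exact hy |].
  apply Rdiv_le_0_compat; [apply pow2_ge_0 | lra]. }
assert (hu : forall y, is_derive (fun z => z ^ 2 / m) y (2 * y / m)).
{ intros y; auto_derive; [easy | field; lra]. }
assert (hd1 : forall y, I y -> is_derive v y (v1 y)).
{ intros y hy; evar_last.
  - apply is_derive_scal, (iter_derive_comp g (fun z => z ^ 2 / m) 0);
      [now apply hcv | apply hu].
  - unfold v1, g1, iter_derive; simpl; ring. }
assert (hd2 : is_derive v1 x v2).
{ evar_last.
  - apply (is_derive_mult (fun y => c * PSeries g1 (y ^ 2 / m)) (fun y => 2 * y / m));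
      [apply is_derive_scal, (iter_derive_comp g (fun z => z ^ 2 / m) 1);
         [now apply hcv | apply hu]
      | apply (is_derive_ext (fun y => (2 / m) * y)); [intros y; simpl; field; lra |];
        apply is_derive_scal, (@is_derive_id R_AbsRing)
      | intros; apply Rmult_comm].
  - unfold v2, g2, g1, iter_derive, plus, mult, one; simpl; field; lra. }
assert (hval := centre_value m (x ^ 2 / m) hm').
assert (habs : Rabs (x ^ 2 / m) < 1 / 48).
{ rewrite Rabs_pos_eq; [exact hx |].
  apply Rdiv_le_0_compat; [apply pow2_ge_0 | lra]. }
specialize (hval habs).
assert (e1 : Derive v x = v1 x) by now apply is_derive_unique, hd1.
split; [| exact e1].
split; [unfold v; fold g in hval; nra |]; split.
- intros k; apply (generated_smooth I (centre_base g m) hI); [| | exact hx].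
  + assert (gs := fun j => gen_base _ _ (cb_series g m j)).
    assert (gid := gen_base _ _ (cb_id g m)).
    assert (gk := gen_const (centre_base g m)).
    intros f [j|].
    * exists (fun y => (2 / m) * y * PSeries (iter_derive g (S j)) (y ^ 2 / m)); split.
      -- apply gen_mult; [apply gen_mult; [apply gk | apply gid] | apply gs].
      -- intros y hy; evar_last; [apply iter_derive_comp; [now apply hcv | apply hu] |].
         simpl; field; lra.
    * exists (fun _ => 1); split; [apply gk |].
      intros y _; apply (@is_derive_id R_AbsRing).
  + apply gen_mult; [apply gen_const |].
    apply gen_base, (cb_series g m 0).
- intros hx0; rewrite e1, (Derive_n_two v v1 I x v2 hI hd1 hx hd2).
  assert (hX' := habs); rewrite <- centre_radius in hX'.
  assert (ho := fuchs_equation (N / 2) 1 3 Rlt_0_1 centre_denom centre_size_ge_one _ _ _ _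
    (centre_params m hm') (x ^ 2 / m) hX').
  fold (centre_coef m) in ho; fold g in ho; fold g1 in ho; fold g2 in ho.
  unfold profile_ode, v, v1, v2; fold g in hval.
  apply (Rmult_eq_reg_l (m / (4 * c)));
    [| apply Rgt_not_eq, Rdiv_lt_0_compat; lra].
  revert ho hval; generalize (PSeries g (x ^ 2 / m)) (PSeries g1 (x ^ 2 / m))
    (PSeries g2 (x ^ 2 / m)); intros p p1 p2 ho hval.
  transitivity (x ^ 2 / m * (1 - m * (x ^ 2 / m)) * p2
    + (N / 2 + - (5 / 6 * m) * (x ^ 2 / m)) * p1 - (- (m / 18) * p + 1 / 4 / p ^ 2));
    [| rewrite ho; ring].
  unfold m; field; lra.
Qed.

End Centre.

(** * Solutions that are regular at the light cone *)

Section Cone.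

Variables (N a : R).
Hypothesis hN : 2 <= N <= 7.
Hypothesis ha : 0 < a.
Hypothesis hak : stiffness N * a ^ 3 = 1.

Let k := stiffness N.
Let D := - ((damping N - 1) / 2).

Hypothesis hD :
  forall m, 1 / 24 * (INR m + 1) ^ 2 <= Rabs ((INR m + 1) * (INR m + D)).

Definition cone_coef (s : R) : nat -> R :=
  fuchs_coef D (1 / 2) ((damping N - 1) / 2) (k / 2) (- (k / 2 / s ^ 3)).

(** With [t = 1 - 1 / eta], [w = a * cone_fun s t] is the solution that is
    regular at [eta = 1] and takes the value [a * s] there.  Dividing by [s]
    normalizes the value at [t = 0]. *)
Definition cone_fun (s t : R) : R := s * PSeries (cone_coef s) t.
Definition cone_der (s t : R) : R := s * PSeries (PS_derive (cone_coef s)) t.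
Definition cone_der2 (s t : R) : R :=
  s * PSeries (PS_derive (PS_derive (cone_coef s))) t.

Definition cone_radius : R := fuchs_radius (1 / 24) 22.

Lemma cone_radius_eq : cone_radius = 1 / 8448.
Proof. unfold cone_radius, fuchs_radius; field. Qed.

Lemma cone_gap_pos : 0 < 1 / 24.
Proof. lra. Qed.

Lemma cone_size_ge_one : 1 <= 22.
Proof. lra. Qed.

Lemma stiffness_bounds : 4 / 9 <= k <= 4.
Proof. unfold k, stiffness; lra. Qed.

Lemma inv_cube_bound s : 1 / 2 <= s -> 0 < 1 / s ^ 3 <= 8.
Proof.
intros hs; assert (h : (1 / 2) ^ 3 <= s ^ 3) by (apply pow_incr; lra).
split; [apply Rdiv_lt_0_compat; lra |].
apply Rle_div_l; lra.
Qed.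

Lemma cone_params s :
  1 / 2 <= s ->
  Rabs (1 / 2) + Rabs ((damping N - 1) / 2) + Rabs (k / 2)
  + Rabs (- (k / 2 / s ^ 3)) <= 22.
Proof.
intros hs; assert (hk := stiffness_bounds); assert (hc := inv_cube_bound s hs).
replace (k / 2 / s ^ 3) with (k / 2 * (1 / s ^ 3))
  by (field; apply Rgt_not_eq; lra).
rewrite Rabs_Ropp, (Rabs_pos_eq (k / 2 * _)) by nra.
unfold damping; rewrite !Rabs_pos_eq by lra; nra.
Qed.

Lemma cone_cv_radius s t :
  1 / 2 <= s -> Rabs t < cone_radius -> Rbar_lt (Rabs t) (CV_radius (cone_coef s)).
Proof.
intros hs ht; apply Rbar_lt_le_trans with cone_radius; [exact ht |].
apply (fuchs_cv_radius D (1 / 24) 22 cone_gap_pos hD cone_size_ge_one); now apply cone_params.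
Qed.

Lemma cone_derive s t :
  1 / 2 <= s -> Rabs t < cone_radius ->
  is_derive (cone_fun s) t (cone_der s t) /\ is_derive (cone_der s) t (cone_der2 s t).
Proof.
intros hs ht; assert (hcv := cone_cv_radius s t hs ht).
split; apply is_derive_scal, is_derive_PSeries; [exact hcv |].
now rewrite CV_radius_derive.
Qed.

Lemma cone_near s t :
  1 / 2 <= s -> Rabs t < cone_radius -> 3 / 4 <= PSeries (cone_coef s) t <= 5 / 4.
Proof.
intros hs ht.
assert (h := fuchs_near_one D (1 / 24) 22 cone_gap_pos hD cone_size_ge_one _ _ _ _
  (cone_params s hs) t ht).
fold (cone_coef s) in h; fold cone_radius in h.
assert (h' : Rabs t / cone_radius <= 1).
{ rewrite cone_radius_eq in *; lra. }
apply Rabs_le_between in h; lra.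
Qed.

Lemma cone_pos s t : 1 / 2 <= s -> Rabs t < cone_radius -> 0 < cone_fun s t.
Proof. intros hs ht; generalize (cone_near s t hs ht); unfold cone_fun; nra. Qed.

Lemma cone_equilibrium t : cone_fun 1 t = 1 /\ cone_der 1 t = 0.
Proof.
assert (h1 : 1 / 2 <= 1) by lra.
destruct (fuchs_constant_PSeries D (1 / 24) 22 cone_gap_pos hD cone_size_ge_one _ _ _ _
  (cone_params 1 h1) t) as [h2 h3]; [field |].
unfold cone_fun, cone_der, cone_coef; rewrite h2, h3; lra.
Qed.

Lemma cone_equation s t :
  1 / 2 <= s -> Rabs t < cone_radius ->
  t * (2 - t) * cone_der2 s t - (damping N - 1) * (1 - t) * cone_der s t
  = k * (cone_fun s t - 1 / cone_fun s t ^ 2).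
Proof.
intros hs ht.
assert (ho := fuchs_equation D (1 / 24) 22 cone_gap_pos hD cone_size_ge_one _ _ _ _
  (cone_params s hs) t ht).
fold (cone_coef s) in ho; assert (hn := cone_near s t hs ht).
unfold cone_der2, cone_der, cone_fun.
revert ho hn; generalize (PSeries (cone_coef s) t)
  (PSeries (PS_derive (cone_coef s)) t)
  (PSeries (PS_derive (PS_derive (cone_coef s))) t); intros p p1 p2 ho hn.
apply (Rmult_eq_reg_l (/ (2 * s))); [| apply Rinv_neq_0_compat; lra].
transitivity (t * (1 - 1 / 2 * t) * p2 + (D + (damping N - 1) / 2 * t) * p1).
- unfold D; field; lra.
- rewrite ho; field; lra.
Qed.

Lemma inv_cube_lipschitz s s' :
  1 / 2 <= s -> 1 / 2 <= s' -> Rabs (1 / s ^ 3 - 1 / s' ^ 3) <= 48 * Rabs (s - s').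
Proof.
intros hs hs'.
assert (hi : forall r, 1 / 2 <= r -> 0 < / r <= 2).
{ intros r hr; split; [apply Rinv_0_lt_compat; lra |].
  replace 2 with (/ (1 / 2)) by field; apply Rinv_le_contravar; lra. }
replace (1 / s ^ 3 - 1 / s' ^ 3) with
  ((/ s * / s' ^ 3 + / s ^ 2 * / s' ^ 2 + / s ^ 3 * / s') * (s' - s)) by (field; lra).
rewrite Rabs_mult, (Rabs_minus_sym s' s); apply Rmult_le_compat_r; [apply Rabs_pos |].
rewrite <- !pow_inv; destruct (hi s hs) as [u1 u2]; destruct (hi s' hs') as [w1 w2].
revert u1 u2 w1 w2; generalize (/ s) (/ s'); intros u w u1 u2 w1 w2.
assert (q : forall m, 0 <= u ^ m <= 2 ^ m /\ 0 <= w ^ m <= 2 ^ m).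
{ intros m; repeat split; try (apply pow_le; lra); apply pow_incr; lra. }
destruct (q 2%nat) as [a2 b2]; destruct (q 3%nat) as [a3 b3].
assert (0 <= u * w ^ 3 <= 16) by (split; [nra |]; simpl in *; nra).
assert (0 <= u ^ 2 * w ^ 2 <= 16) by (split; [nra |]; simpl in *; nra).
assert (0 <= u ^ 3 * w <= 16) by (split; [nra |]; simpl in *; nra).
rewrite Rabs_pos_eq; lra.
Qed.

Lemma cone_params_diff s s' :
  1 / 2 <= s -> 1 / 2 <= s' ->
  Rabs (1 / 2 - 1 / 2) + Rabs ((damping N - 1) / 2 - (damping N - 1) / 2)
  + Rabs (k / 2 - k / 2) + Rabs (- (k / 2 / s ^ 3) - - (k / 2 / s' ^ 3))
  <= 96 * Rabs (s - s').
Proof.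
intros hs hs'; rewrite !Rminus_diag, Rabs_R0, !Rplus_0_l.
replace (- (k / 2 / s ^ 3) - - (k / 2 / s' ^ 3))
  with (- (k / 2) * (1 / s ^ 3 - 1 / s' ^ 3)) by (field; lra).
assert (hk := stiffness_bounds).
rewrite Rabs_mult, Rabs_Ropp, (Rabs_pos_eq (k / 2)) by lra.
generalize (inv_cube_lipschitz s s' hs hs') (Rabs_pos (1 / s ^ 3 - 1 / s' ^ 3)); nra.
Qed.

(** Since [cone_fun s 0 = s], increments in [s] are nearly preserved for small
    [t]. *)
Lemma cone_fun_lipschitz s s' t :
  1 / 2 <= s <= 2 -> 1 / 2 <= s' <= 2 -> Rabs t < cone_radius ->
  Rabs (cone_fun s t - cone_fun s' t - (s - s'))
  <= Rabs t / cone_radius * 200 * Rabs (s - s').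
Proof.
intros hs hs' ht.
assert (h1 := fuchs_near_one D (1 / 24) 22 cone_gap_pos hD cone_size_ge_one _ _ _ _
  (cone_params s (proj1 hs)) t ht).
assert (h2 := fuchs_PSeries_lipschitz D (1 / 24) 22 cone_gap_pos hD cone_size_ge_one _ _ _ _ _ _ _ _
  (cone_params s (proj1 hs)) (cone_params s' (proj1 hs')) t ht).
fold (cone_coef s) in h1, h2; fold (cone_coef s') in h2; fold cone_radius in h1, h2.
assert (h3 := cone_params_diff s s' (proj1 hs) (proj1 hs')).
assert (hr : 0 <= Rabs t / cone_radius).
{ rewrite cone_radius_eq; generalize (Rabs_pos t); lra. }
assert (h4 := Rle_trans _ _ _ h2 (Rmult_le_compat_l _ _ _ hr h3)).
unfold cone_fun.
replace (s * PSeries (cone_coef s) t - s' * PSeries (cone_coef s') t - (s - s'))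
  with ((s - s') * (PSeries (cone_coef s) t - 1)
        + s' * (PSeries (cone_coef s) t - PSeries (cone_coef s') t)) by ring.
eapply Rle_trans; [apply Rabs_triang |]; rewrite !Rabs_mult, (Rabs_pos_eq s') by lra.
assert (hp := Rabs_pos (s - s')).
assert (i1 := Rmult_le_compat_l _ _ _ hp h1).
assert (i2 : s' * Rabs (PSeries (cone_coef s) t - PSeries (cone_coef s') t)
  <= 2 * (Rabs t / cone_radius * (96 * Rabs (s - s')))).
{ apply Rmult_le_compat; [lra | apply Rabs_pos | lra | exact h4]. }
assert (0 <= Rabs t / cone_radius * Rabs (s - s')) by now apply Rmult_le_pos.
lra.
Qed.

Lemma cone_der_lipschitz s s' t :
  1 / 2 <= s <= 2 -> 1 / 2 <= s' <= 2 -> Rabs t <= cone_radius / 2 ->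
  Rabs (cone_der s t - cone_der s' t) <= 200 / cone_radius * Rabs (s - s').
Proof.
intros hs hs' ht.
assert (h1 := fuchs_derive_bound D (1 / 24) 22 cone_gap_pos hD cone_size_ge_one _ _ _ _
  (cone_params s (proj1 hs)) t ht).
assert (h2 := fuchs_derive_lipschitz D (1 / 24) 22 cone_gap_pos hD cone_size_ge_one
  _ _ _ _ _ _ _ _ (cone_params s (proj1 hs)) (cone_params s' (proj1 hs')) t ht).
fold (cone_coef s) in h1, h2; fold (cone_coef s') in h2; fold cone_radius in h1, h2.
assert (h3 := cone_params_diff s s' (proj1 hs) (proj1 hs')).
unfold cone_der; set (p := PSeries (PS_derive (cone_coef s)) t) in *.
set (p' := PSeries (PS_derive (cone_coef s')) t) in *.
replace (s * p - s' * p') with ((s - s') * p + s' * (p - p')) by ring.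
eapply Rle_trans; [apply Rabs_triang |]; rewrite !Rabs_mult, (Rabs_pos_eq s') by lra.
assert (hp := Rabs_pos (s - s')).
assert (i1 := Rmult_le_compat_l _ _ _ hp h1).
rewrite cone_radius_eq in *.
assert (i2 : s' * Rabs (p - p') <= 2 * (96 * Rabs (s - s') / (1 / 8448))).
{ apply Rmult_le_compat; [lra | apply Rabs_pos | lra |].
  eapply Rle_trans; [exact h2 |]; lra. }
lra.
Qed.

Inductive cone_base (g : nat -> R) : (R -> R) -> Prop :=
| kb_series j : cone_base g (fun x => PSeries (iter_derive g j) (1 - / x))
| kb_inv : cone_base g (fun x => / x)
| kb_pow : cone_base g (fun x => Rpower x (2 / 3)).

Lemma cone_variable_derive x :
  0 < x -> is_derive (fun y => 1 - / y) x (/ x * / x).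
Proof. intros hx; auto_derive; [lra | field; lra]. Qed.

Lemma open_cone_variable r : open (fun x => 0 < x /\ Rabs (1 - / x) < r).
Proof.
intros x [hx hr].
assert (hc : continuous (fun y => Rabs (1 - / y)) x).
{ apply (continuous_comp (fun y => 1 - / y) Rabs).
  - apply (derive_continuous _ x _ (cone_variable_derive x hx)).
  - apply continuous_Rabs. }
apply filter_and; [now apply (open_gt 0 x hx) |].
apply (hc (fun z => z < r)); now apply open_lt.
Qed.

(** The chain rule for [t = 1 - 1 / eta], for the regular series as well as for its
    continuation. *)
Lemma cone_variable_scaled (f f1 : R -> R) f2 x :
  0 < x -> is_derive f1 (1 - / x) f2 -> 0 < f (1 - / x) ->
  (1 - / x) * (1 + / x) * f2 - (damping N - 1) * / x * f1 (1 - / x)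
    = k * (f (1 - / x) - 1 / f (1 - / x) ^ 2) ->
  is_derive (fun y => a * (f1 (1 - / y) / y ^ 2)) x
    (a * (f2 / x ^ 4 - 2 * f1 (1 - / x) / x ^ 3)) /\
  scaled_ode N x (a * f (1 - / x)) (a * (f1 (1 - / x) / x ^ 2))
    (a * (f2 / x ^ 4 - 2 * f1 (1 - / x) / x ^ 3)).
Proof.
intros hx h2 hf ho; split.
- apply is_derive_scal; evar_last.
  + apply (is_derive_div (fun y => f1 (1 - / y)) (fun y => y ^ 2)).
    * apply (is_derive_comp f1 (fun y => 1 - / y)); [exact h2 |].
      now apply cone_variable_derive.
    * apply is_derive_pow, (@is_derive_id R_AbsRing).
    * apply pow_nonzero; lra.
  + unfold scal, one; simpl; unfold mult; simpl; field; lra.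
- unfold scaled_ode; fold k; revert hf ho.
  generalize (f (1 - / x)) (f1 (1 - / x)); intros p p1 hf ho.
  replace (1 / (a * p) ^ 2) with (a * k * (1 / p ^ 2)).
  2: { transitivity (k * a ^ 3 * (1 / (a * p) ^ 2)); [field; lra |].
       unfold k; rewrite hak; ring. }
  replace (k * (a * p)) with (a * (k * p)) by ring.
  replace (k * p) with
    ((1 - / x) * (1 + / x) * f2 - (damping N - 1) * / x * p1 + k * (1 / p ^ 2))
    by (rewrite ho; ring).
  field; lra.
Qed.

Lemma cone_variable_derive_comp (f : R -> R) f1 x :
  0 < x -> is_derive f (1 - / x) f1 ->
  is_derive (fun y => a * f (1 - / y)) x (a * (f1 / x ^ 2)).
Proof.
intros hx hf; apply is_derive_scal; evar_last.
- apply (is_derive_comp f (fun y => 1 - / y)); [exact hf |].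
  now apply cone_variable_derive.
- unfold scal; simpl; unfold mult; simpl; field; lra.
Qed.

Lemma cone_smooth_profile s x :
  1 / 2 <= s -> 0 < x -> Rabs (1 - / x) < cone_radius ->
  smooth_profile_at N (fun y => Rpower y (2 / 3) * (a * cone_fun s (1 - / y))) x.
Proof.
intros hs hx ht.
set (I := fun x => 0 < x /\ Rabs (1 - / x) < cone_radius).
assert (hI : open I) by apply open_cone_variable.
assert (hpos : forall y, I y -> 0 < a * cone_fun s (1 - / y)).
{ intros y [hy hy']; apply Rmult_lt_0_compat; [exact ha | now apply cone_pos]. }
set (g := cone_coef s).
assert (hcv : forall y, I y -> Rbar_lt (Rabs (1 - / y)) (CV_radius g))
  by (intros y [hy hy']; now apply cone_cv_radius).
assert (hscaled := fun y (hy : I y) => cone_variable_scaled (cone_fun s) (cone_der s)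
  (cone_der2 s (1 - / y)) y (proj1 hy) (proj2 (cone_derive s _ hs (proj2 hy)))
  (cone_pos s _ hs (proj2 hy))).
assert (hode : forall y, I y ->
  (1 - / y) * (1 + / y) * cone_der2 s (1 - / y)
  - (damping N - 1) * / y * cone_der s (1 - / y)
  = k * (cone_fun s (1 - / y) - 1 / cone_fun s (1 - / y) ^ 2)).
{ intros y [hy hy']; rewrite <- (cone_equation s _ hs hy'); ring. }
split; [apply Rmult_lt_0_compat; [apply exp_pos | now apply hpos] |]; split.
- intros j; apply (generated_smooth I (cone_base g) hI); [| | now split].
  + assert (gs := fun j => gen_base _ _ (kb_series g j)).
    assert (gi := gen_base _ _ (kb_inv g)); assert (gp := gen_base _ _ (kb_pow g)).
    assert (gk := gen_const (cone_base g)).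
    intros f [i| |].
    * exists (fun y => (/ y * / y) * PSeries (iter_derive g (S i)) (1 - / y)); split.
      -- now repeat apply gen_mult.
      -- intros y hy; apply (iter_derive_comp g (fun z => 1 - / z) i); [now apply hcv |].
         apply cone_variable_derive, hy.
    * exists (fun y => -1 * (/ y * / y)); split; [now repeat apply gen_mult |].
      intros y [hy _]; auto_derive; [lra | field; lra].
    * exists (fun y => 2 / 3 * (Rpower y (2 / 3) * / y)); split.
      -- apply gen_mult; [apply (gk (2 / 3)) | now apply gen_mult].
      -- intros y [hy _]; evar_last; [now apply Rpower_two_thirds_derive |].
         field; lra.
  + apply gen_mult; [apply gen_base, kb_pow |].
    apply gen_mult; [apply gen_const |].
    apply gen_mult; [apply gen_const |].
    apply gen_base, (kb_series g 0).
- intros _; apply (scaled_profile_Derive N (fun y => a * cone_fun s (1 - / y))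
    (fun y => a * (cone_der s (1 - / y) / y ^ 2))
    (fun y => a * (cone_der2 s (1 - / y) / y ^ 4 - 2 * cone_der s (1 - / y) / y ^ 3)) I);
    [exact hI | | | | | now split].
  + intros y hy; split; [apply hy | now apply hpos].
  + intros y [hy hy']; apply cone_variable_derive_comp; [exact hy |].
    exact (proj1 (cone_derive s _ hs hy')).
  + intros y hy; apply (hscaled y hy (hode y hy)).
  + intros y hy; apply (hscaled y hy (hode y hy)).
Qed.

End Cone.

(** The exponents at the light cone, [0] and [(3 n + 1) / 6], do not differ by an
    integer, so the regular solution is unobstructed. *)
Lemma cone_denominators (n : nat) :
  (2 <= n <= 7)%nat ->
  forall m, 1 / 24 * (INR m + 1) ^ 2
    <= Rabs ((INR m + 1) * (INR m + - ((damping (INR n) - 1) / 2))).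
Proof.
intros hn m; assert (hm := pos_INR m).
rewrite Rabs_mult, (Rabs_pos_eq (INR m + 1)) by lra.
enough (h : 1 / 24 * (INR m + 1) <= Rabs (INR m + - ((damping (INR n) - 1) / 2)))
  by (simpl; nra).
(* Here [6 (m + D) = 6 m - 3 n + 5] is an integer congruent to 2 modulo 3, so it
   does not vanish; for [m >= 4] it is positive. *)
assert (hn7 : INR n <= 7) by (replace 7 with (INR 7) by (simpl; ring); apply le_INR; lia).
destruct (Nat.le_gt_cases 4 m) as [h|h].
- assert (h4 : 4 <= INR m)
    by (replace 4 with (INR 4) by (simpl; ring); now apply le_INR).
  unfold damping; rewrite Rabs_pos_eq; lra.
- assert (hnn : n = 2%nat \/ n = 3%nat \/ n = 4%nat \/ n = 5%nat \/ n = 6%nat \/ n = 7%nat)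
    by lia.
  assert (hmm : m = 0%nat \/ m = 1%nat \/ m = 2%nat \/ m = 3%nat) by lia.
  unfold damping.
  destruct hnn as [-> |[-> |[-> |[-> |[-> | ->]]]]];
  destruct hmm as [-> |[-> |[-> | ->]]]; simpl INR;
  (rewrite Rabs_pos_eq by lra; lra) || (rewrite Rabs_left by lra; lra).
Qed.

(** * Outside the light cone *)

(** Cutting the singular force off below [m] makes the Cauchy problem globally
    solvable; a priori bounds later show that the cut is never reached. *)
Definition cut_force (kap m y : R) : R := kap * y - 1 / Rmax y m ^ 2.

Lemma cut_force_eq kap m y : m <= y -> cut_force kap m y = kap * y - 1 / y ^ 2.
Proof. intros h; unfold cut_force; now rewrite Rmax_left. Qed.

Lemma Rmax_lipschitz m y z : Rabs (Rmax y m - Rmax z m) <= Rabs (y - z).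
Proof.
unfold Rmax; destruct (Rle_dec y m), (Rle_dec z m); apply Rabs_le;
  generalize (Rle_abs (y - z)) (Rle_abs (- (y - z))); rewrite Rabs_Ropp; lra.
Qed.

Lemma Rmin_lipschitz m y z : Rabs (Rmin y m - Rmin z m) <= Rabs (y - z).
Proof.
unfold Rmin; destruct (Rle_dec y m), (Rle_dec z m); apply Rabs_le;
  generalize (Rle_abs (y - z)) (Rle_abs (- (y - z))); rewrite Rabs_Ropp; lra.
Qed.

Lemma cut_force_lipschitz kap m y z :
  0 <= kap -> 0 < m ->
  Rabs (cut_force kap m y - cut_force kap m z) <= (kap + 2 / m ^ 3) * Rabs (y - z).
Proof.
intros hk hm; unfold cut_force.
replace (kap * y - 1 / Rmax y m ^ 2 - (kap * z - 1 / Rmax z m ^ 2))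
  with (kap * (y - z) + - (1 / Rmax y m ^ 2 - 1 / Rmax z m ^ 2)) by ring.
eapply Rle_trans; [apply Rabs_triang |].
rewrite Rabs_Ropp, Rabs_mult, (Rabs_pos_eq kap), Rmult_plus_distr_r by exact hk.
apply Rplus_le_compat_l.
eapply Rle_trans; [apply (inv_square_lipschitz m); [exact hm | |]; apply Rmax_r |].
apply Rmult_le_compat_l; [| apply Rmax_lipschitz].
assert (0 < m ^ 3) by (apply pow_lt; lra).
left; apply Rdiv_lt_0_compat; lra.
Qed.

Definition clamp (l u t : R) : R := Rmax (Rmin t u) l.

Lemma clamp_bounds l u t : l <= u -> l <= clamp l u t <= u.
Proof.
intros h; unfold clamp; split; [apply Rmax_r |].
apply Rmax_lub; [apply Rmin_r | exact h].
Qed.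

Lemma clamp_id l u t : l <= t <= u -> clamp l u t = t.
Proof. intros h; unfold clamp; rewrite Rmin_left, Rmax_left; lra. Qed.

Lemma clamp_continuous l u t : continuous (clamp l u) t.
Proof.
apply (lipschitz_continuous _ 1); [lra |]; intros y z; rewrite Rmult_1_l.
eapply Rle_trans; [apply Rmax_lipschitz | apply Rmin_lipschitz].
Qed.

Lemma continuous_after_clamp (f : R -> R) l u t :
  l <= u -> (forall y, l <= y <= u -> ex_derive f y) ->
  continuous (fun x => f (clamp l u x)) t.
Proof.
intros hlu hf; apply (continuous_comp (clamp l u) f); [apply clamp_continuous |].
apply (ex_derive_continuous f), hf; now apply clamp_bounds.
Qed.

Section Exterior.

Variables (N a : R).
Hypothesis hN : 2 <= N <= 7.
Hypothesis ha : 0 < a.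
Hypothesis hak : stiffness N * a ^ 3 = 1.
Hypothesis hD : forall m, 1 / 24 * (INR m + 1) ^ 2
  <= Rabs ((INR m + 1) * (INR m + - ((damping N - 1) / 2))).

Let k := stiffness N.
Let rho := cone_radius.

Let Aext t := (damping N - 1) * (1 - t) / (t * (2 - t)).
Let Bext t := k / (t * (2 - t)).
Let lo := rho / 8.

Let lo_bounds : 0 < lo < 1 / 1000.
Proof. unfold lo, rho; rewrite cone_radius_eq; lra. Qed.

Lemma exterior_coef_bound t :
  lo <= t <= 3 / 2 -> Rabs (Aext t) <= 20 / lo /\ Rabs (Bext t) <= 20 / lo.
Proof.
intros ht; assert (hl := lo_bounds).
assert (hk := stiffness_bounds N hN); fold k in hk.
assert (h1 : / (t * (2 - t)) <= 2 / lo).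
{ replace (2 / lo) with (/ (lo * / 2)) by (field; lra).
  apply Rinv_le_contravar; nra. }
assert (h0 : 0 < / (t * (2 - t))) by (apply Rinv_0_lt_compat; nra).
assert (h2 : 0 < / lo) by (apply Rinv_0_lt_compat; lra).
unfold Aext, Bext, Rdiv in *; rewrite !Rabs_mult, !(Rabs_pos_eq (/ (t * (2 - t)))) by lra.
unfold damping; rewrite (Rabs_pos_eq (N - _ - 1)), (Rabs_pos_eq k) by lra.
assert (h3 : Rabs (1 - t) <= 1) by (apply Rabs_le; lra).
assert (h4 := Rabs_pos (1 - t)).
split.
- apply Rle_trans with (10 * 1 * (2 * / lo)); [| lra].
  apply Rmult_le_compat; try lra; [nra |].
  apply Rmult_le_compat; lra.
- apply Rle_trans with (10 * (2 * / lo)); [| lra].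
  apply Rmult_le_compat; lra.
Qed.

Lemma exterior_cauchy y0 p0 :
  exists y p : R -> R, y lo = y0 /\ p lo = p0 /\
    forall t, lo <= t <= 3 / 2 -> is_derive y t (p t) /\
      is_derive p t (Aext t * p t + Bext t * cut_force 1 (1 / 2) (y t)).
Proof.
assert (hl := lo_bounds).
assert (hlu : lo <= 3 / 2) by lra.
destruct (picard_solution (fun t => Aext (clamp lo (3 / 2) t))
  (fun t => Bext (clamp lo (3 / 2) t)) (cut_force 1 (1 / 2)) (20 / lo)
  (1 + 2 / (1 / 2) ^ 3) lo y0 p0) as (y & p & hy0 & hp0 & hd).
- intros t; apply continuous_after_clamp; [exact hlu |]; intros z hz.
  unfold Aext; auto_derive; nra.
- intros t; apply continuous_after_clamp; [exact hlu |]; intros z hz.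
  unfold Bext; auto_derive; nra.
- intros t; apply exterior_coef_bound, clamp_bounds, hlu.
- intros t; apply exterior_coef_bound, clamp_bounds, hlu.
- lra.
- intros y z; apply cut_force_lipschitz; lra.
- exists y, p; split; [exact hy0 |]; split; [exact hp0 |].
  intros t ht; destruct (hd t) as [d1 d2]; split; [exact d1 |].
  rewrite clamp_id in d2 by exact ht; exact d2.
Qed.

Let C := 360 / lo.

Lemma exterior_close (y p z q : R -> R) t1 :
  (forall t, lo <= t <= t1 -> is_derive y t (p t) /\
     is_derive p t (Aext t * p t + Bext t * cut_force 1 (1 / 2) (y t))) ->
  (forall t, lo <= t <= t1 -> is_derive z t (q t) /\
     is_derive q t (Aext t * q t + Bext t * cut_force 1 (1 / 2) (z t))) ->
  forall t, lo <= t <= t1 -> t <= 3 / 2 ->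
  (y t - z t) ^ 2 + (p t - q t) ^ 2
  <= ((y lo - z lo) ^ 2 + (p lo - q lo) ^ 2) * exp ((2 + 3 * C) * (t - lo)).
Proof.
intros hy hz t ht ht1; assert (hl := lo_bounds).
assert (hlo : 0 < / lo) by (apply Rinv_0_lt_compat; lra).
replace ((y lo - z lo) ^ 2 + (p lo - q lo) ^ 2)
  with ((y lo - z lo) ^ 2 + (p lo - q lo) ^ 2 + 0 ^ 2 * (t - lo)) by ring.
apply (semilinear_gronwall Aext Bext Aext Bext (cut_force 1 (1 / 2)) y p z q
  (20 / lo) (20 / lo) (1 + 2 / (1 / 2) ^ 3)).
- lra.
- unfold Rdiv; lra.
- unfold C; right; field; lra.
- unfold Rdiv; lra.
- lra.
- intros u v; apply cut_force_lipschitz; lra.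
- intros u hu; destruct (exterior_coef_bound u) as [h1 h2]; [lra |].
  rewrite !Rminus_diag, Rabs_R0; repeat split; lra.
- intros u hu; apply hy; lra.
- intros u hu; apply hz; lra.
Qed.

Lemma exterior_field_equation t y p f :
  lo <= t <= 3 / 2 -> 1 / 2 <= y ->
  f = Aext t * p + Bext t * cut_force 1 (1 / 2) y <->
  t * (2 - t) * f - (damping N - 1) * (1 - t) * p = k * (y - 1 / y ^ 2).
Proof.
intros ht hy; assert (hl := lo_bounds); rewrite cut_force_eq by exact hy.
assert (h2 : t * (2 - t) <> 0) by nra.
unfold Aext, Bext; split; intros h.
- rewrite h; field; lra.
- apply (Rmult_eq_reg_l (t * (2 - t))); [| exact h2].
  replace (t * (2 - t) * f) with ((damping N - 1) * (1 - t) * p + k * (y - 1 / y ^ 2))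
    by lra.
  field; lra.
Qed.

(** [eta = infinity] is the regular point [t = 1], at finite distance from the
    cone, so a solution that starts close to the equilibrium [f = 1] stays close
    to it all the way to infinity. *)
Lemma exterior_solution :
  exists e : R, 0 < e /\ forall s, Rabs (s - 1) <= e ->
  exists (v : R -> R) (b : R), 0 < b /\
    (forall x, 0 < x -> Rabs (1 - / x) < rho \/ 1 < x -> smooth_profile_at N v x) /\
    (forall x, 0 < x -> 1 - / x < rho / 4 ->
       v x = Rpower x (2 / 3) * (a * cone_fun N s (1 - / x))) /\
    is_lim (fun x => v x / (b * Rpower x (2 / 3))) p_infty 1.
Proof.
assert (hl := lo_bounds); assert (hrho : rho = 1 / 8448) by apply cone_radius_eq.
set (E := exp ((2 + 3 * C) * 2)).
assert (hE : 0 < E) by apply exp_pos.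
set (Q := 201 ^ 2 + (200 / rho) ^ 2).
assert (hQ : 1 <= Q).
{ unfold Q; generalize (pow2_ge_0 (200 / rho)); lra. }
set (e := / (4 * (Q * (E + 1)))).
assert (hQE : 1 <= Q * (E + 1)) by nra.
assert (he : 0 < e <= / 4).
{ split; [apply Rinv_0_lt_compat; lra |].
  apply Rinv_le_contravar; lra. }
exists e; split; [apply he |]; intros s hs.
assert (hs' : 3 / 4 <= s <= 5 / 4) by (apply Rabs_le_between in hs; lra).
set (F := cone_fun N s); set (F1 := cone_der N s).
destruct (exterior_cauchy (F lo) (F1 lo)) as (y & p & hy0 & hp0 & hd).
assert (heq : forall t, lo <= t <= 3 / 2 -> is_derive (fun _ => 1) t 0 /\
   is_derive (fun _ => 0) t (Aext t * 0 + Bext t * cut_force 1 (1 / 2) 1)).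
{ intros t ht; split; [apply (is_derive_const 1) |].
  rewrite cut_force_eq by lra.
  replace (Aext t * 0 + Bext t * (1 * 1 - 1 / 1 ^ 2)) with 0 by field.
  apply (is_derive_const 0). }
assert (hstart : (y lo - 1) ^ 2 + (p lo - 0) ^ 2 <= Q * e ^ 2).
{ assert (h1 : 1 / 2 <= 1 <= 2) by lra; assert (h2 : 1 / 2 <= s <= 2) by lra.
  assert (hlo : Rabs lo < cone_radius) by (rewrite Rabs_pos_eq by lra; unfold lo; fold rho; lra).
  assert (hlo2 : Rabs lo <= cone_radius / 2)
    by (rewrite Rabs_pos_eq by lra; unfold lo; fold rho; lra).
  assert (i1 := cone_fun_lipschitz N hN hD s 1 lo h2 h1 hlo).
  assert (i2 := cone_der_lipschitz N hN hD s 1 lo h2 h1 hlo2).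
  destruct (cone_equilibrium N hN hD lo) as [q1 q2].
  rewrite q1 in i1; rewrite q2 in i2; fold F in i1; fold F1 in i2.
  fold rho in i1, i2; rewrite hy0, hp0.
  assert (i3 : Rabs (F lo - 1) <= 201 * e).
  { replace (F lo - 1) with ((F lo - 1 - (s - 1)) + (s - 1)) by ring.
    eapply Rle_trans; [apply Rabs_triang |].
    assert (Rabs lo / rho <= 1).
    { rewrite Rabs_pos_eq by lra; apply Rle_div_l; unfold lo; lra. }
    generalize (Rabs_pos (s - 1)); nra. }
  assert (i4 : Rabs (F1 lo - 0) <= 200 / rho * e).
  { eapply Rle_trans; [exact i2 |]; apply Rmult_le_compat_l; [| exact hs].
    rewrite hrho; lra. }
  rewrite <- (pow2_abs (F lo - 1)), <- (pow2_abs (F1 lo - 0)).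
  unfold Q; rewrite Rmult_plus_distr_r, <- !Rpow_mult_distr.
  apply Rplus_le_compat; apply pow_incr; split; auto using Rabs_pos. }
assert (hclose : forall t, lo <= t <= 3 / 2 -> 1 / 2 <= y t).
{ intros t ht.
  assert (h := exterior_close y p (fun _ => 1) (fun _ => 0) (3 / 2) hd heq t ht (proj2 ht)).
  assert (hexp : exp ((2 + 3 * C) * (t - lo)) <= E).
  { apply exp_le, Rmult_le_compat_l; [| lra].
    unfold C; assert (0 < 360 / lo) by (apply Rdiv_lt_0_compat; lra); lra. }
  assert (hb : (y t - 1) ^ 2 <= / 4 * e).
  { apply Rle_trans with (Q * e ^ 2 * E).
    - eapply Rle_trans; [| apply Rmult_le_compat; [| | exact hstart | exact hexp]].
      + generalize (pow2_ge_0 (p t - 0)); lra.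
      + apply Rplus_le_le_0_compat; apply pow2_ge_0.
      + left; apply exp_pos.
    - assert (hid : Q * (E + 1) * e = / 4) by (unfold e; field; lra).
      rewrite <- hid; assert (0 <= Q * e ^ 2) by (apply Rmult_le_pos; [lra | apply pow2_ge_0]).
      simpl in *; nra. }
  nra. }
assert (hF : forall t, lo <= t <= rho / 2 -> is_derive F t (F1 t) /\
   is_derive F1 t (Aext t * F1 t + Bext t * cut_force 1 (1 / 2) (F t))).
{ intros t ht.
  assert (htr : Rabs t < cone_radius) by (fold rho; rewrite Rabs_pos_eq; lra).
  assert (hs2 : 1 / 2 <= s) by lra.
  destruct (cone_derive N hN hD s t hs2 htr) as [d1 d2]; split; [exact d1 |].
  replace (Aext t * F1 t + Bext t * cut_force 1 (1 / 2) (F t)) with (cone_der2 N s t);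
    [exact d2 |].
  apply exterior_field_equation; [lra | |].
  - assert (hn := cone_near N hN hD s t hs2 htr); unfold F, cone_fun; nra.
  - now apply cone_equation. }
assert (hsame : forall t, lo <= t <= rho / 2 -> y t = F t).
{ intros t ht.
  assert (hd' : forall t, lo <= t <= rho / 2 -> is_derive y t (p t) /\
     is_derive p t (Aext t * p t + Bext t * cut_force 1 (1 / 2) (y t)))
    by (intros u hu; apply hd; lra).
  assert (h := exterior_close y p F F1 (rho / 2) hd' hF t ht ltac:(lra)).
  rewrite hy0, hp0, !Rminus_diag in h.
  replace ((0 ^ 2 + 0 ^ 2) * exp ((2 + 3 * C) * (t - lo))) with 0 in h by ring.
  assert (g1 := pow2_ge_0 (y t - F t)); assert (g2 := pow2_ge_0 (p t - F1 t)).
  assert (g3 : (y t - F t) ^ 2 = 0) by lra.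
  assert (g4 : y t - F t = 0) by nra; lra. }
set (w := fun x => a * y (1 - / x)).
set (v3 := fun x => Rpower x (2 / 3) * (a * F (1 - / x))).
set (v4 := fun x => Rpower x (2 / 3) * w x).
set (x1 := / (1 - rho / 4)).
assert (hx1 : 1 < x1).
{ unfold x1; rewrite <- Rinv_1; apply Rinv_lt_contravar; lra. }
assert (hinv : forall x, 0 < x -> / x < 1 - lo -> lo < 1 - / x) by (intros; lra).
assert (hix : forall x u, 0 < u -> / u < x -> / x < u).
{ intros x u hu hx; assert (0 < / u) by now apply Rinv_0_lt_compat.
  rewrite <- (Rinv_inv u); apply Rinv_lt_contravar; [nra | exact hx]. }
assert (hxi : forall x u, 0 < x -> / x < u -> / u < x).
{ intros x u hu hx; assert (0 < / x) by now apply Rinv_0_lt_compat.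
  rewrite <- (Rinv_inv x); apply Rinv_lt_contravar; [nra | exact hx]. }
assert (hinvx1 : / x1 = 1 - rho / 4) by (unfold x1; apply Rinv_inv).
exists (glue x1 v3 v4), (a * y 1); split; [| split; [| split]].
- apply Rmult_lt_0_compat; [exact ha |].
  generalize (hclose 1 ltac:(lra)); lra.
- intros x hx hcase; apply glue_smooth_profile.
  + assert (hloc : locally x1 (fun x => 0 < x /\ Rabs (1 - / x - rho / 4) < rho / 16)).
    { assert (hc : continuous (fun x => Rabs (1 - / x - rho / 4)) x1).
      { apply (continuous_comp (fun x => 1 - / x - rho / 4) Rabs);
          [| apply continuous_Rabs].
        apply (ex_derive_continuous (fun x => 1 - / x - rho / 4)).
        auto_derive; lra. }
      apply filter_and; [apply (open_gt 0 x1); lra |].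
      apply (hc (fun z => z < rho / 16)); apply open_lt.
      rewrite hinvx1; replace (1 - (1 - rho / 4) - rho / 4) with 0 by ring.
      rewrite Rabs_R0; lra. }
    revert hloc; apply filter_imp; intros z [hz hz'].
    apply Rabs_lt_between in hz'.
    unfold v3, v4, w; rewrite hsame; [reflexivity | unfold lo; lra].
  + intros hxx.
    assert (hr : Rabs (1 - / x) < cone_radius).
    { fold rho; destruct hcase as [hc|hc]; [exact hc |].
      assert (h1 : / x1 <= / x) by (apply Rinv_le_contravar; lra).
      assert (h2 : / x < 1) by (apply hix; rewrite ?Rinv_1; lra).
      apply Rabs_def1; lra. }
    apply (cone_smooth_profile N a hN ha hak hD s x); [lra | exact hx | exact hr].
  + intros hxx.
    set (I := fun z => 1 < z /\ lo < 1 - / z).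
    assert (hI : open I).
    { intros z [hz hz']; apply filter_and; [now apply (open_gt 1 z) |].
      assert (hc : continuous (fun x => 1 - / x) z)
        by (apply (derive_continuous _ z (/ z * / z)), cone_variable_derive; lra).
      apply (hc (fun u => lo < u)); now apply open_gt. }
    assert (hIb : forall z, I z -> 0 < z /\ lo <= 1 - / z <= 3 / 2).
    { intros z [hz hz']; assert (0 < / z) by (apply Rinv_0_lt_compat; lra); lra. }
    assert (hsc := fun z (hz : I z) => cone_variable_scaled N a ha hak y p
      (Aext (1 - / z) * p (1 - / z) + Bext (1 - / z) * cut_force 1 (1 / 2) (y (1 - / z)))
      z (proj1 (hIb z hz)) (proj2 (hd _ (proj2 (hIb z hz))))).
    assert (hpy : forall z, I z -> 0 < y (1 - / z))
      by (intros z hz; generalize (hclose _ (proj2 (hIb z hz))); lra).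
    assert (hode : forall z, I z ->
      (1 - / z) * (1 + / z) * (Aext (1 - / z) * p (1 - / z)
         + Bext (1 - / z) * cut_force 1 (1 / 2) (y (1 - / z)))
      - (damping N - 1) * / z * p (1 - / z)
      = stiffness N * (y (1 - / z) - 1 / y (1 - / z) ^ 2)).
    { intros z hz; destruct (hIb z hz) as [z0 zb].
      assert (h := proj1 (exterior_field_equation (1 - / z) (y (1 - / z)) (p (1 - / z)) _ zb
        (hclose _ zb)) eq_refl).
      fold k; rewrite <- h; ring. }
    apply (scaled_smooth_profile N w (fun z => a * (p (1 - / z) / z ^ 2))
      (fun z => a * ((Aext (1 - / z) * p (1 - / z)
         + Bext (1 - / z) * cut_force 1 (1 / 2) (y (1 - / z))) / z ^ 4
         - 2 * p (1 - / z) / z ^ 3)) I); [exact hI | | | | | |].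
    * intros z hz; split; [apply (hIb z hz) |].
      apply Rmult_lt_0_compat; [exact ha | now apply hpy].
    * intros z hz; apply cone_variable_derive_comp; [apply (hIb z hz) |].
      exact (proj1 (hd _ (proj2 (hIb z hz)))).
    * intros z hz; exact (proj1 (hsc z hz (hpy z hz) (hode z hz))).
    * intros z hz; exact (proj2 (hsc z hz (hpy z hz) (hode z hz))).
    * intros z [hz _]; lra.
    * split; [lra |].
      assert (/ x < 1 - rho / 4) by (rewrite <- hinvx1; apply Rinv_lt_contravar; nra).
      unfold lo; lra.
- intros x hx hx'; rewrite glue_left; [reflexivity |].
  rewrite <- (Rinv_inv x); apply Rinv_lt_contravar; [| lra].
  assert (0 < / x) by now apply Rinv_0_lt_compat. nra.
- assert (hy1 : 0 < y 1) by (generalize (hclose 1 ltac:(lra)); lra).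
  apply (is_lim_ext_loc (fun x => / y 1 * y (1 - / x))).
  + exists x1; intros x hx; rewrite glue_right by lra.
    assert (0 < Rpower x (2 / 3)) by apply exp_pos.
    unfold v4, w; field; lra.
  + replace 1 with (/ y 1 * y 1) at 1 by (field; lra).
    assert (hlim : is_lim (fun x => y (1 - / x)) p_infty (y 1)).
    { apply (is_lim_comp_continuous (fun x => 1 - / x) y p_infty 1).
      - replace (Finite 1) with (Rbar_minus 1 0) by (simpl; f_equal; ring).
        apply is_lim_minus'; [apply is_lim_const |].
        replace (Finite 0) with (Rbar_inv p_infty) by reflexivity.
        apply is_lim_inv; [apply is_lim_id | easy].
      - apply (derive_continuous y 1 (p 1)), hd; lra. }
    apply (is_lim_scal_l (fun x => y (1 - / x)) (/ y 1) p_infty (y 1) hlim).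
Qed.

End Exterior.

(** * The family of solutions issued from the centre *)

Definition cut_potential (m w : R) : R :=
  / m + RInt (fun u => - (1 / Rmax u m ^ 2)) m w.

Lemma cut_potential_derive m w :
  0 < m -> is_derive (cut_potential m) w (- (1 / Rmax w m ^ 2)).
Proof.
intros hm; rewrite <- (Rplus_0_l (- _)); unfold cut_potential.
apply (is_derive_plus (fun _ => / m)); [apply (is_derive_const (/ m)) |].
apply (RInt_derive_continuous (fun u => - (1 / Rmax u m ^ 2))); intros x.
apply (lipschitz_continuous _ (2 / m ^ 3)).
- left; apply Rdiv_lt_0_compat; [lra | now apply pow_lt].
- intros y z; assert (h := cut_force_lipschitz 0 m y z (Rle_refl 0) hm).
  unfold cut_force in h; rewrite !Rmult_0_l, !Rplus_0_l in h.
  unfold Rminus in h; rewrite !Rplus_0_l in h; exact h.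
Qed.

Lemma cut_potential_at m : cut_potential m m = / m.
Proof.
unfold cut_potential.
replace (RInt (fun u => - (1 / Rmax u m ^ 2)) m m) with 0; [ring |].
symmetry; exact (RInt_point (V := R_CompleteNormedModule) m _).
Qed.

Lemma cut_potential_eq m w : 0 < m -> m <= w -> cut_potential m w = / w.
Proof.
intros hm hw.
enough (h : cut_potential m w - / w = cut_potential m m - / m)
  by (rewrite cut_potential_at in h; lra).
apply (derive_constant (fun u => cut_potential m u - / u)
  (fun u => - (1 / Rmax u m ^ 2) - - (1 / u ^ 2))); [exact hw | |].
- intros x hx; apply (is_derive_minus (cut_potential m)).
  + now apply cut_potential_derive.
  + auto_derive; [lra | field; lra].
- intros x hx; rewrite Rmax_left by lra; ring.
Qed.

Lemma cut_potential_ge m w : 0 < m -> w <= m -> / m <= cut_potential m w.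
Proof.
intros hm hw; rewrite <- cut_potential_at.
apply (derive_nonincreasing _ (fun u => - (1 / Rmax u m ^ 2))); [exact hw | |].
- intros x _; now apply cut_potential_derive.
- intros x _; assert (0 < Rmax x m) by (generalize (Rmax_r x m); lra).
  assert (0 < 1 / Rmax x m ^ 2) by (apply Rdiv_lt_0_compat; [lra | now apply pow_lt]).
  lra.
Qed.

Definition lip_family (S T : R) (U : R -> R -> R) : Prop :=
  exists K, 0 <= K /\
    (forall mu s, 0 <= mu <= 1 -> S <= s <= T -> Rabs (U mu s) <= K) /\
    (forall mu mu' s, 0 <= mu <= 1 -> 0 <= mu' <= 1 -> S <= s <= T ->
       Rabs (U mu s - U mu' s) <= K * Rabs (mu - mu')).

Lemma lip_const S T c : lip_family S T (fun _ _ => c).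
Proof.
exists (Rabs c); split; [apply Rabs_pos |]; split; intros; [lra |].
rewrite Rminus_diag, Rabs_R0; apply Rmult_le_pos; apply Rabs_pos.
Qed.

Lemma lip_plus S T U V :
  lip_family S T U -> lip_family S T V -> lip_family S T (fun mu s => U mu s + V mu s).
Proof.
intros (K & hK & b & l) (K' & hK' & b' & l'); exists (K + K').
split; [lra |]; split.
- intros mu s hmu hs; eapply Rle_trans; [apply Rabs_triang |].
  generalize (b mu s hmu hs) (b' mu s hmu hs); lra.
- intros mu mu' s hmu hmu' hs.
  replace (U mu s + V mu s - (U mu' s + V mu' s))
    with ((U mu s - U mu' s) + (V mu s - V mu' s)) by ring.
  eapply Rle_trans; [apply Rabs_triang |].
  generalize (l mu mu' s hmu hmu' hs) (l' mu mu' s hmu hmu' hs); lra.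
Qed.

Lemma lip_mult S T U V :
  lip_family S T U -> lip_family S T V -> lip_family S T (fun mu s => U mu s * V mu s).
Proof.
intros (K & hK & b & l) (K' & hK' & b' & l'); exists (2 * K * K' + 0).
assert (hKK : 0 <= K * K') by now apply Rmult_le_pos.
split; [lra |]; split.
- intros mu s hmu hs; rewrite Rabs_mult.
  assert (h := Rmult_le_compat _ _ _ _ (Rabs_pos _) (Rabs_pos _)
    (b mu s hmu hs) (b' mu s hmu hs)); lra.
- intros mu mu' s hmu hmu' hs.
  replace (U mu s * V mu s - U mu' s * V mu' s)
    with ((U mu s - U mu' s) * V mu s + U mu' s * (V mu s - V mu' s)) by ring.
  eapply Rle_trans; [apply Rabs_triang |]; rewrite !Rabs_mult.
  assert (h1 := Rmult_le_compat _ _ _ _ (Rabs_pos _) (Rabs_pos _)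
    (l mu mu' s hmu hmu' hs) (b' mu s hmu hs)).
  assert (h2 := Rmult_le_compat _ _ _ _ (Rabs_pos _) (Rabs_pos _)
    (b mu' s hmu' hs) (l' mu mu' s hmu hmu' hs)).
  lra.
Qed.

Lemma lip_inv S T U m :
  0 < m -> (forall mu s, 0 <= mu <= 1 -> S <= s <= T -> m <= U mu s) ->
  lip_family S T U -> lip_family S T (fun mu s => / U mu s).
Proof.
intros hm hU (K & hK & b & l).
assert (hi : forall mu s, 0 <= mu <= 1 -> S <= s <= T -> 0 < / U mu s <= / m).
{ intros mu s hmu hs; specialize (hU mu s hmu hs); split.
  - apply Rinv_0_lt_compat; lra.
  - apply Rinv_le_contravar; lra. }
assert (hm' : 0 < / m) by now apply Rinv_0_lt_compat.
assert (hmm : 0 <= / m * / m) by (apply Rmult_le_pos; lra).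
exists (/ m + / m * / m * K); split; [nra |]; split.
- intros mu s hmu hs; destruct (hi mu s hmu hs).
  rewrite Rabs_pos_eq by lra; nra.
- intros mu mu' s hmu hmu' hs.
  assert (h1 := hU mu s hmu hs); assert (h2 := hU mu' s hmu' hs).
  destruct (hi mu s hmu hs); destruct (hi mu' s hmu' hs).
  replace (/ U mu s - / U mu' s)
    with (/ U mu s * / U mu' s * (U mu' s - U mu s)) by (field; lra).
  rewrite Rabs_mult, (Rabs_minus_sym (U mu' s)), Rabs_pos_eq
    by (apply Rmult_le_pos; lra).
  apply Rle_trans with (/ m * / m * (K * Rabs (mu - mu'))).
  + apply Rmult_le_compat; [apply Rmult_le_pos; lra | apply Rabs_pos | |].
    * apply Rmult_le_compat; lra.
    * now apply l.
  + generalize (Rabs_pos (mu - mu')); nra.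
Qed.

Lemma abs_le_of_sq u C m : 0 <= C -> u ^ 2 <= C * m ^ 2 -> Rabs u <= (C + 1) * Rabs m.
Proof.
intros hC hu; rewrite <- (Rabs_pos_eq (C + 1)), <- Rabs_mult by lra.
apply Rsqr_le_abs_0; unfold Rsqr.
assert (h := pow2_ge_0 m); simpl in *; nra.
Qed.

Lemma sin_lipschitz x y : Rabs (sin x - sin y) <= Rabs (x - y).
Proof.
destruct (MVT_gen sin y x cos) as [z [_ hz]].
- intros t _; apply is_derive_sin.
- intros t _; apply continuity_sin.
- rewrite hz, Rabs_mult; assert (h := COS_bound z).
  assert (Rabs (cos z) <= 1) by (apply Rabs_le; lra).
  generalize (Rabs_pos (x - y)); nra.
Qed.

Lemma cos_lipschitz x y : Rabs (cos x - cos y) <= Rabs (x - y).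
Proof.
destruct (MVT_gen cos y x (fun z => - sin z)) as [z [_ hz]].
- intros t _; apply is_derive_cos.
- intros t _; apply continuity_cos.
- rewrite hz, Rabs_mult; assert (h := SIN_bound z).
  assert (Rabs (- sin z) <= 1) by (apply Rabs_le; lra).
  generalize (Rabs_pos (x - y)); nra.
Qed.

Lemma atan_lipschitz x y : Rabs (atan x - atan y) <= Rabs (x - y).
Proof.
destruct (MVT_gen atan y x (fun z => / (1 + Rsqr z))) as [z [_ hz]].
- intros t _; apply is_derive_atan.
- intros t _; apply (derive_continuity_pt atan t (/ (1 + Rsqr t))), is_derive_atan.
- rewrite hz, Rabs_mult; assert (h := Rle_0_sqr z).
  assert (hi : 0 < / (1 + Rsqr z) <= 1).
  { split; [apply Rinv_0_lt_compat; lra |].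
    rewrite <- Rinv_1; apply Rinv_le_contravar; lra. }
  rewrite (Rabs_pos_eq (/ _)) by lra; generalize (Rabs_pos (x - y)); nra.
Qed.

(** The series at the centre is left at [eta ^ 2 / mu = 1 / 96], half of its
    guaranteed radius; [start] is [ln (eta / sqrt mu)] there, and [start_scale]
    the factor between [phi] and [w]. *)
Definition start : R := ln (1 / 96) / 2.
Definition start_scale : R := exp (- (2 / 3) * start).

(** Low enough for [1 / floor_value] to exceed the initial energy. *)
Definition floor_value : R := 1 / 200.

Lemma floor_pos : 0 < floor_value.
Proof. unfold floor_value; lra. Qed.

Lemma exp_start : exp (2 * start) = 1 / 96.
Proof.
unfold start; replace (2 * (ln (1 / 96) / 2)) with (ln (1 / 96)) by field.
apply exp_ln; lra.
Qed.

Lemma start_scale_bounds : 4 < start_scale < 5.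
Proof.
assert (h3 : start_scale ^ 3 = 96).
{ unfold start_scale; rewrite <- Rpower_pow by apply exp_pos.
  unfold Rpower; rewrite ln_exp.
  replace (INR 3 * (- (2 / 3) * start)) with (- (2 * start)) by (simpl; field).
  rewrite exp_Ropp, exp_start; field. }
assert (h0 : 0 < start_scale) by apply exp_pos.
split.
- destruct (Rlt_dec 4 start_scale) as [h1|h1]; [exact h1 | exfalso].
  assert (start_scale ^ 3 <= 4 ^ 3) by (apply pow_incr; lra); lra.
- destruct (Rlt_dec start_scale 5) as [h1|h1]; [exact h1 | exfalso].
  assert (5 ^ 3 <= start_scale ^ 3) by (apply pow_incr; lra); lra.
Qed.

Section CentreFamily.

Variable N : R.
Hypothesis hN : 2 <= N <= 7.

Let d := damping N.
Let k := stiffness N.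

Lemma damping_bounds : 4 / 3 <= d <= 19 / 3.
Proof. unfold d, damping; lra. Qed.

Definition start_val (mu : R) : R := start_scale * PSeries (centre_coef N mu) (1 / 96).
Definition start_der (mu : R) : R :=
  start_scale * (1 / 48 * PSeries (PS_derive (centre_coef N mu)) (1 / 96)
                 - 2 / 3 * PSeries (centre_coef N mu) (1 / 96)).

Lemma start_val_bounds mu : 0 <= mu <= 1 -> 3 <= start_val mu <= 7.
Proof.
intros hmu; assert (hs := start_scale_bounds).
assert (hX : Rabs (1 / 96) < 1 / 48) by (rewrite Rabs_pos_eq; lra).
assert (hv := centre_value N hN mu (1 / 96) hmu hX); unfold start_val; nra.
Qed.

Lemma start_der_bound mu : 0 <= mu <= 1 -> Rabs (start_der mu) <= 12.
Proof.
intros hmu; assert (hs := start_scale_bounds).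
assert (hX : Rabs (1 / 96) < 1 / 48) by (rewrite Rabs_pos_eq; lra).
assert (hX' : Rabs (1 / 96) <= 1 / 96) by (rewrite Rabs_pos_eq; lra).
assert (hv := centre_value N hN mu (1 / 96) hmu hX).
assert (hv' := centre_derive_value N hN mu (1 / 96) hmu hX').
apply Rabs_le_between in hv'; unfold start_der.
rewrite Rabs_mult, Rabs_pos_eq by lra.
replace 12 with (5 * (12 / 5)) by field.
apply Rmult_le_compat; [lra | apply Rabs_pos | lra |].
apply Rabs_le; lra.
Qed.

Lemma start_lipschitz mu mu' :
  0 <= mu <= 1 -> 0 <= mu' <= 1 ->
  Rabs (start_val mu - start_val mu') <= 10 * Rabs (mu - mu') /\
  Rabs (start_der mu - start_der mu') <= 20 * Rabs (mu - mu').
Proof.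
intros hmu hmu'; assert (hs := start_scale_bounds).
assert (hX : Rabs (1 / 96) <= 1 / 96) by (rewrite Rabs_pos_eq; lra).
destruct (centre_lipschitz N hN mu mu' (1 / 96) hmu hmu' hX) as [h1 h2].
assert (hm := Rabs_pos (mu - mu')).
unfold start_val, start_der; split.
- rewrite <- Rmult_minus_distr_l, Rabs_mult, (Rabs_pos_eq start_scale) by lra.
  replace (10 * Rabs (mu - mu')) with (5 * (2 * Rabs (mu - mu'))) by ring.
  apply Rmult_le_compat; [lra | apply Rabs_pos | lra | exact h1].
- set (f := PSeries (centre_coef N mu) (1 / 96)) in *.
  set (f' := PSeries (centre_coef N mu') (1 / 96)) in *.
  set (g := PSeries (PS_derive (centre_coef N mu)) (1 / 96)) in *.
  set (g' := PSeries (PS_derive (centre_coef N mu')) (1 / 96)) in *.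
  rewrite <- Rmult_minus_distr_l, Rabs_mult, (Rabs_pos_eq start_scale) by lra.
  replace (20 * Rabs (mu - mu')) with (5 * (4 * Rabs (mu - mu'))) by ring.
  apply Rmult_le_compat; [lra | apply Rabs_pos | lra |].
  apply Rabs_le; apply Rabs_le_between in h1; apply Rabs_le_between in h2; lra.
Qed.

(** This is where [N <= 7] enters: the characteristic equation
    [s ^ 2 + d s + 3 k = 0] at the singular solution has complex roots. *)
Lemma discriminant_neg : 0 < 3 * k - d ^ 2 / 4.
Proof. unfold k, d, stiffness, damping; nra. Qed.

Definition spin : R := (3 * k - d ^ 2 / 4) / (1 + 3 * k).

Lemma spin_pos : 0 < spin.
Proof.
assert (hk := stiffness_bounds N hN); fold k in hk.
apply Rdiv_lt_0_compat; [exact discriminant_neg | lra].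
Qed.

(** Completing the square leaves [spin ^ 2 * C ^ 2] by the choice of [spin]. *)
Lemma spin_lower S C :
  S * S + C * C = 1 -> spin <= S * S - d * (S * C) + 3 * k * (C * C).
Proof.
intros h1; assert (hk := stiffness_bounds N hN); fold k in hk.
assert (hd := discriminant_neg); assert (hs := spin_pos).
assert (he : spin * (1 + 3 * k) = 3 * k - d ^ 2 / 4) by (unfold spin; field; lra).
assert (hlt : spin < 1).
{ unfold spin; apply Rlt_div_l; [lra |]; generalize (pow2_ge_0 d); lra. }
assert (hsq : 0 <= (1 - spin) * (S * S - d * (S * C) + 3 * k * (C * C) - spin)).
{ replace ((1 - spin) * (S * S - d * (S * C) + 3 * k * (C * C) - spin))
    with ((1 - spin) * (S * S - d * (S * C) + 3 * k * (C * C) - spin * (S * S + C * C)))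
    by (rewrite h1; ring).
  replace ((1 - spin) * (S * S - d * (S * C) + 3 * k * (C * C) - spin * (S * S + C * C)))
    with (((1 - spin) * S - d * C / 2) ^ 2
          + (3 * k - d ^ 2 / 4 - spin * (1 + 3 * k) + spin ^ 2) * C ^ 2) by field.
  rewrite he; generalize (pow2_ge_0 ((1 - spin) * S - d * C / 2))
    (Rmult_le_pos _ _ (pow2_ge_0 spin) (pow2_ge_0 C)); lra. }
destruct (Rle_dec spin (S * S - d * (S * C) + 3 * k * (C * C))) as [h2|h2]; [exact h2 |].
exfalso; nra.
Qed.

Variable a : R.
Hypothesis ha : 0 < a.
Hypothesis hak : stiffness N * a ^ 3 = 1.

Lemma equilibrium_bounds : 1 / 2 < a < 3 / 2.
Proof.
assert (hk := stiffness_bounds N hN); split.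
- destruct (Rlt_dec (1 / 2) a) as [h0|h0]; [exact h0 | exfalso].
  assert (a ^ 3 <= (1 / 2) ^ 3) by (apply pow_incr; lra); nra.
- destruct (Rlt_dec a (3 / 2)) as [h0|h0]; [exact h0 | exfalso].
  assert ((3 / 2) ^ 3 <= a ^ 3) by (apply pow_incr; lra); nra.
Qed.

(** With [F w = k w ^ 2 / 2 + 1 / w], this is [F w - F a] in factored form. *)
Lemma potential_excess w :
  0 < w -> k * w ^ 2 / 2 + / w - (k * a ^ 2 / 2 + / a)
           = k / 2 * (w - a) ^ 2 * (1 + 2 * a / w).
Proof.
intros hw.
replace (/ w) with (k * a ^ 3 * / w) by (unfold k; rewrite hak; ring).
replace (/ a) with (k * a ^ 3 * / a) by (unfold k; rewrite hak; ring).
field; lra.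
Qed.

Definition min_energy : R := k * a ^ 2 / 2 + / a.

Variable h : R.
Hypothesis hh : 0 < h < 1.

(** [eta ^ 2 = mu * exp (2 sg)], capped below the light cone. *)
Definition cap (mu sg : R) : R := Rmin (mu * exp (2 * sg)) h.

Definition drag (mu sg : R) : R := (d - cap mu sg) / (1 - cap mu sg).

Lemma cap_bounds mu sg : 0 <= mu -> 0 <= cap mu sg <= h.
Proof.
intros hmu; unfold cap; split; [| apply Rmin_r].
apply Rmin_glb; [| lra]; apply Rmult_le_pos; [exact hmu | left; apply exp_pos].
Qed.

Lemma cap_continuous mu sg : continuous (cap mu) sg.
Proof.
apply (continuous_comp (fun s => mu * exp (2 * s)) (fun z => Rmin z h)).
- apply (ex_derive_continuous (fun s => mu * exp (2 * s))); auto_derive; easy.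
- apply (lipschitz_continuous _ 1); [lra |]; intros y z; rewrite Rmult_1_l.
  apply Rmin_lipschitz.
Qed.

Lemma drag_bounds mu sg : 0 <= mu -> 0 <= drag mu sg <= 7 / (1 - h).
Proof.
intros hmu; assert (hc := cap_bounds mu sg hmu); assert (hd := damping_bounds).
unfold drag; split.
- apply Rdiv_le_0_compat; lra.
- unfold Rdiv; apply Rmult_le_compat; try lra.
  + left; apply Rinv_0_lt_compat; lra.
  + apply Rinv_le_contravar; lra.
Qed.

Lemma cap_inv_bounds mu sg : 0 <= mu -> 1 <= / (1 - cap mu sg) <= / (1 - h).
Proof.
intros hmu; assert (hc := cap_bounds mu sg hmu); split.
- rewrite <- Rinv_1 at 1; apply Rinv_le_contravar; lra.
- apply Rinv_le_contravar; lra.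
Qed.

Definition cut_acc (mu sg w p : R) : R :=
  - drag mu sg * p + - / (1 - cap mu sg) * cut_force k floor_value w.

Definition cut_lip : R := k + 2 / floor_value ^ 3.

Lemma cut_lip_pos : 0 < cut_lip.
Proof.
assert (hk := stiffness_bounds N hN); unfold cut_lip, k, floor_value; lra.
Qed.

(** [W mu] and [P mu] stand for [w] and [w_s] as functions of [sg = ln (eta / sqrt mu)],
    where [mu = c ^ 3].  Capping and cutting make the system globally solvable; the
    true equation holds while [eta ^ 2 <= h] and [w >= floor_value]. *)
Definition centre_family (W P : R -> R -> R) : Prop :=
  forall mu, 0 <= mu <= 1 ->
    W mu start = start_val mu /\ P mu start = start_der mu /\
    forall sg, is_derive (W mu) sg (P mu sg) /\
               is_derive (P mu) sg (cut_acc mu sg (W mu sg) (P mu sg)).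

Lemma centre_family_exists : exists W P : R -> R -> R, centre_family W P.
Proof.
assert (hex : forall mu, exists WP : (R -> R) * (R -> R), 0 <= mu <= 1 ->
  fst WP start = start_val mu /\ snd WP start = start_der mu /\
  forall sg, is_derive (fst WP) sg (snd WP sg) /\
    is_derive (snd WP) sg (cut_acc mu sg (fst WP sg) (snd WP sg))).
{ intros mu; destruct (classic (0 <= mu <= 1)) as [hmu|hmu];
    [| now exists ((fun _ => 0), (fun _ => 0))].
  assert (hdiv : forall s, 1 - cap mu s <> 0)
    by (intros s; generalize (cap_bounds mu s (proj1 hmu)); lra).
  assert (hi : forall s, continuous (fun s => / (1 - cap mu s)) s).
  { intros s; apply continuity_pt_filterlim, continuity_pt_inv; [| apply hdiv].
    apply continuity_pt_minus; [apply continuity_pt_const; now intros ? ? |].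
    apply continuity_pt_filterlim, cap_continuous. }
  destruct (picard_solution (fun s => - drag mu s) (fun s => - / (1 - cap mu s))
    (cut_force k floor_value) (7 / (1 - h)) cut_lip start (start_val mu) (start_der mu))
    as (y & p & hy & hp & hd).
  - intros s; apply (continuous_opp (drag mu)).
    apply (continuous_mult (fun s => d - cap mu s) (fun s => / (1 - cap mu s)));
      [| apply hi].
    apply (continuous_minus (fun _ => d)); [apply continuous_const | apply cap_continuous].
  - intros s; apply (continuous_opp (fun s => / (1 - cap mu s))), hi.
  - intros s; destruct (drag_bounds mu s (proj1 hmu)).
    rewrite Rabs_Ropp, Rabs_pos_eq; lra.
  - intros s; destruct (cap_inv_bounds mu s (proj1 hmu)).
    assert (0 < / (1 - h)) by (apply Rinv_0_lt_compat; lra).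
    rewrite Rabs_Ropp, Rabs_pos_eq; unfold Rdiv; lra.
  - left; apply cut_lip_pos.
  - intros y z; assert (hk := stiffness_bounds N hN).
    apply cut_force_lipschitz; unfold k, floor_value; lra.
  - exists (y, p); intros _; split; [exact hy |]; split; [exact hp |].
    intros s; destruct (hd s) as [d1 d2]; split; [exact d1 |]; simpl.
    exact d2. }
destruct (functional_choice _ hex) as [f hf].
exists (fun mu => fst (f mu)), (fun mu => snd (f mu)); exact hf.
Qed.

Variables W P : R -> R -> R.
Hypothesis hWP : centre_family W P.

Lemma family_derive mu sg :
  0 <= mu <= 1 -> is_derive (W mu) sg (P mu sg) /\
  is_derive (P mu) sg (cut_acc mu sg (W mu sg) (P mu sg)).
Proof. intros hmu; now apply hWP. Qed.

(** ** Energy *)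

Definition cut_energy (x w p : R) : R :=
  (1 - x) * p ^ 2 / 2 + (k * w ^ 2 / 2 + cut_potential floor_value w).

Definition energy (mu sg : R) : R := cut_energy (cap mu sg) (W mu sg) (P mu sg).

Lemma cut_energy_derive mu sg (x : R -> R) x1 :
  0 <= mu <= 1 -> is_derive x sg x1 ->
  is_derive (fun s => cut_energy (x s) (W mu s) (P mu s)) sg
    (- x1 * P mu sg ^ 2 / 2
     + (1 - x sg) * P mu sg * cut_acc mu sg (W mu sg) (P mu sg)
     + P mu sg * cut_force k floor_value (W mu sg)).
Proof.
intros hmu hx; destruct (family_derive mu sg hmu) as [hW hP].
unfold cut_energy; evar_last.
- apply @is_derive_plus.
  + apply (is_derive_ext (fun s => / 2 * ((1 - x s) * P mu s ^ 2)));
      [intros s; simpl; field |].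
    apply is_derive_scal, (is_derive_mult (fun s => 1 - x s) (fun s => P mu s ^ 2));
      [apply (is_derive_minus (fun _ => 1)); [apply (is_derive_const 1) | exact hx]
      | apply is_derive_pow; exact hP | intros; apply Rmult_comm].
  + apply @is_derive_plus.
    * apply (is_derive_ext (fun s => k / 2 * W mu s ^ 2)); [intros s; simpl; field |].
      apply is_derive_scal, is_derive_pow; exact hW.
    * apply (is_derive_comp (cut_potential floor_value) (W mu));
        [apply cut_potential_derive, floor_pos | exact hW].
- unfold cut_force, plus, mult, minus, opp, scal, zero; simpl;
    unfold mult, plus, opp; simpl; field.
  apply Rgt_not_eq; generalize (Rmax_r (W mu sg) floor_value) floor_pos; lra.
Qed.

(** For the true equation, with [x = eta ^ 2] and [x1 = 2 * x], the dissipation is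
    exactly [d * w_s ^ 2]. *)
Lemma energy_dissipation mu sg (x : R -> R) x1 :
  0 <= mu <= 1 -> is_derive x sg x1 -> x sg = cap mu sg -> 
  is_derive (fun s => cut_energy (x s) (W mu s) (P mu s)) sg
    (- (d - x sg + x1 / 2) * P mu sg ^ 2).
Proof.
intros hmu hx hxe; evar_last; [apply cut_energy_derive; eassumption |].
unfold cut_acc, drag; rewrite hxe.
generalize (cap_bounds mu sg (proj1 hmu)); intros; field; lra.
Qed.

Lemma energy_nonincreasing mu s t :
  0 <= mu <= 1 -> s <= t -> energy mu t <= energy mu s.
Proof.
intros hmu hst; assert (hd := damping_bounds).
set (x := fun u => mu * exp (2 * u)).
assert (hx : forall u, is_derive x u (2 * x u)).
{ intros u; unfold x; auto_derive; [easy | ring]. }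
assert (hmono : forall u u', u <= u' -> x u <= x u').
{ intros u u' hu; apply Rmult_le_compat_l; [lra |]; apply exp_le; lra. }
assert (hpos : forall u, 0 <= x u).
{ intros u; apply Rmult_le_pos; [lra | left; apply exp_pos]. }
assert (hlow : forall s t, s <= t -> x t <= h -> energy mu t <= energy mu s).
{ intros u u' hu hu'.
  assert (hcap : forall z, z <= u' -> x z = cap mu z).
  { intros z hz; unfold cap; rewrite Rmin_left; [reflexivity |].
    generalize (hmono z u' hz); fold (x z); lra. }
  unfold energy; rewrite <- !hcap by lra.
  apply (derive_nonincreasing (fun s => cut_energy (x s) (W mu s) (P mu s))
    (fun s => - (d - x s + 2 * x s / 2) * P mu s ^ 2)); [exact hu | |].
  - intros z hz; apply energy_dissipation; [exact hmu | apply hx | apply hcap; lra].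
  - intros z hz; assert (h1 := pow2_ge_0 (P mu z)); nra. }
assert (hhigh : forall s t, s <= t -> h <= x s -> energy mu t <= energy mu s).
{ intros u u' hu hu'.
  assert (hcap : forall z, u <= z -> h = cap mu z).
  { intros z hz; unfold cap; rewrite Rmin_right; [reflexivity |].
    generalize (hmono u z hz); fold (x z); lra. }
  unfold energy; rewrite <- !hcap by lra.
  apply (derive_nonincreasing (fun s => cut_energy h (W mu s) (P mu s))
    (fun s => - (d - h + 0 / 2) * P mu s ^ 2)); [exact hu | |].
  - intros z hz; apply (energy_dissipation mu z (fun _ => h));
      [exact hmu | apply (is_derive_const h) | apply hcap; lra].
  - intros z hz; assert (h1 := pow2_ge_0 (P mu z)); nra. }
destruct (Rle_dec (x t) h) as [h1|h1]; [now apply hlow |].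
destruct (Rle_dec h (x s)) as [h2|h2]; [now apply hhigh |].
assert (hmu0 : 0 < mu).
{ destruct (Rtotal_order 0 mu) as [h3|[h3|h3]]; [exact h3 | | lra].
  exfalso; apply h1; unfold x; rewrite <- h3; lra. }
set (u := ln (h / mu) / 2).
assert (hu : x u = h).
{ unfold x, u; replace (2 * (ln (h / mu) / 2)) with (ln (h / mu)) by field.
  rewrite exp_ln by (apply Rdiv_lt_0_compat; lra); field; lra. }
assert (hsu : s <= u).
{ destruct (Rle_dec s u) as [h3|h3]; [exact h3 |].
  generalize (hmono u s); lra. }
assert (hut : u <= t).
{ destruct (Rle_dec u t) as [h3|h3]; [exact h3 |].
  generalize (hmono t u); lra. }
apply Rle_trans with (energy mu u); [apply hhigh | apply hlow]; lra.
Qed.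

Lemma energy_start mu : 0 <= mu <= 1 -> energy mu start <= 180.
Proof.
intros hmu; unfold energy, cut_energy.
destruct (hWP mu hmu) as (h1 & h2 & _); rewrite h1, h2.
assert (hv := start_val_bounds mu hmu); assert (hp := start_der_bound mu hmu).
assert (hc := cap_bounds mu start (proj1 hmu)).
assert (hk := stiffness_bounds N hN); fold k in hk.
rewrite cut_potential_eq by (unfold floor_value; lra).
assert (hp2 : start_der mu ^ 2 <= 144).
{ rewrite <- pow2_abs; replace 144 with (12 ^ 2) by ring.
  apply pow_incr; split; [apply Rabs_pos | exact hp]. }
assert (hp3 := pow2_ge_0 (start_der mu)).
assert (hi : / start_val mu <= / 3) by (apply Rinv_le_contravar; lra).
assert (start_val mu ^ 2 <= 49) by (simpl; nra).
nra.
Qed.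

Lemma energy_bound mu sg : 0 <= mu <= 1 -> start <= sg -> energy mu sg <= 180.
Proof.
intros hmu hs; apply Rle_trans with (energy mu start).
- now apply energy_nonincreasing.
- now apply energy_start.
Qed.

(** Below the cut the potential alone exceeds the initial energy. *)
Lemma family_above_floor mu sg :
  0 <= mu <= 1 -> start <= sg -> floor_value < W mu sg.
Proof.
intros hmu hs; destruct (Rlt_dec floor_value (W mu sg)) as [h1|h1]; [exact h1 | exfalso].
assert (he := energy_bound mu sg hmu hs); unfold energy, cut_energy in he.
assert (hp := cut_potential_ge floor_value (W mu sg) floor_pos ltac:(lra)).
assert (hc := cap_bounds mu sg (proj1 hmu)).
assert (hk := stiffness_bounds N hN); fold k in hk.
assert (0 <= (1 - cap mu sg) * P mu sg ^ 2)
  by (apply Rmult_le_pos; [lra | apply pow2_ge_0]).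
assert (0 <= k * W mu sg ^ 2) by (apply Rmult_le_pos; [lra | apply pow2_ge_0]).
unfold floor_value in *; lra.
Qed.

Lemma family_energy_eq mu sg :
  0 <= mu <= 1 -> start <= sg ->
  energy mu sg = (1 - cap mu sg) * P mu sg ^ 2 / 2 + (k * W mu sg ^ 2 / 2 + / W mu sg).
Proof.
intros hmu hs; unfold energy, cut_energy; rewrite cut_potential_eq; [reflexivity | |].
- exact floor_pos.
- left; now apply family_above_floor.
Qed.

Lemma family_bounds mu sg :
  0 <= mu <= 1 -> start <= sg ->
  W mu sg <= 30 /\ P mu sg ^ 2 <= 360 / (1 - h).
Proof.
intros hmu hs; assert (he := energy_bound mu sg hmu hs).
rewrite family_energy_eq in he by assumption.
assert (hw := family_above_floor mu sg hmu hs).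
assert (hc := cap_bounds mu sg (proj1 hmu)).
assert (hk := stiffness_bounds N hN); fold k in hk.
assert (hi : 0 < / W mu sg) by (apply Rinv_0_lt_compat; unfold floor_value in *; lra).
assert (hp := pow2_ge_0 (P mu sg)); assert (hw2 := pow2_ge_0 (W mu sg)).
split.
- destruct (Rle_dec (W mu sg) 30) as [h1|h1]; [exact h1 | exfalso].
  assert (900 < W mu sg ^ 2) by (simpl; nra); nra.
- assert (h1 : 1 - h > 0) by lra.
  apply (proj1 (Rle_div_r _ _ _ h1)).
  assert (P mu sg ^ 2 * (1 - h) <= P mu sg ^ 2 * (1 - cap mu sg))
    by (apply Rmult_le_compat_l; lra).
  assert (0 <= k * W mu sg ^ 2) by (apply Rmult_le_pos; lra).
  lra.
Qed.

Lemma family_force mu sg :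
  0 <= mu <= 1 -> start <= sg ->
  cut_force k floor_value (W mu sg) = k * W mu sg - 1 / W mu sg ^ 2.
Proof.
intros hmu hs; apply cut_force_eq; left; now apply family_above_floor.
Qed.


(** ** Dependence on the parameter *)

Lemma lip_cap T : lip_family start T cap.
Proof.
exists (1 + exp (2 * T)); assert (he := exp_pos (2 * T)); split; [lra |]; split.
- intros mu s hmu _; assert (hc := cap_bounds mu s (proj1 hmu)).
  rewrite Rabs_pos_eq; lra.
- intros mu mu' s hmu hmu' hs; unfold cap.
  eapply Rle_trans; [apply Rmin_lipschitz |].
  rewrite <- Rmult_minus_distr_r, Rabs_mult, Rmult_comm, (Rabs_pos_eq (exp _))
    by (left; apply exp_pos).
  apply Rmult_le_compat_r; [apply Rabs_pos |].
  assert (exp (2 * s) <= exp (2 * T)) by (apply exp_le; lra); lra.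
Qed.

Lemma lip_cap_inv T : lip_family start T (fun mu s => / (1 - cap mu s)).
Proof.
apply (lip_inv start T (fun mu s => 1 - cap mu s) (1 - h)); [lra | |].
- intros mu s hmu _; generalize (cap_bounds mu s (proj1 hmu)); lra.
- destruct (lip_plus start T _ _ (lip_const start T 1)
    (lip_mult start T _ _ (lip_const start T (-1)) (lip_cap T))) as (K & hK & b & l).
  exists K; split; [exact hK |]; split.
  + intros mu s hmu hs; replace (1 - cap mu s) with (1 + -1 * cap mu s) by ring; auto.
  + intros mu mu' s hmu hmu' hs.
    replace (1 - cap mu s - (1 - cap mu' s))
      with (1 + -1 * cap mu s - (1 + -1 * cap mu' s)) by ring; auto.
Qed.

Lemma lip_ext S T U V :
  (forall mu s, 0 <= mu <= 1 -> S <= s <= T -> U mu s = V mu s) ->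
  lip_family S T U -> lip_family S T V.
Proof.
intros he (K & hK & b & l); exists K; split; [exact hK |]; split.
- intros mu s hmu hs; rewrite <- he by assumption; auto.
- intros mu mu' s hmu hmu' hs; rewrite <- !he by assumption; auto.
Qed.

Lemma lip_drag T : lip_family start T drag.
Proof.
apply (lip_ext start T (fun mu s => 1 + (d - 1) * / (1 - cap mu s))).
- intros mu s hmu _; unfold drag; generalize (cap_bounds mu s (proj1 hmu)).
  intros; field; lra.
- apply lip_plus; [apply lip_const |].
  apply lip_mult; [apply lip_const | apply lip_cap_inv].
Qed.

Lemma cut_force_lip y z :
  Rabs (cut_force k floor_value y - cut_force k floor_value z) <= cut_lip * Rabs (y - z).
Proof.
assert (hk := stiffness_bounds N hN).
apply cut_force_lipschitz; unfold k, floor_value; lra.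
Qed.

Lemma cut_force_bound w : Rabs (cut_force k floor_value w) <= cut_lip * Rabs (w - a).
Proof.
assert (hb := equilibrium_bounds).
assert (h0 : cut_force k floor_value a = 0).
{ rewrite cut_force_eq by (unfold floor_value; lra).
  replace (1 / a ^ 2) with (k * a ^ 3 * (1 / a ^ 2)) by (unfold k; rewrite hak; ring).
  field; lra. }
replace (cut_force k floor_value w)
  with (cut_force k floor_value w - cut_force k floor_value a) by (rewrite h0; ring).
apply cut_force_lip.
Qed.

Lemma family_lipschitz T : start <= T -> lip_family start T W /\ lip_family start T P.
Proof.
intros hT.
destruct (lip_drag T) as (Kd & hKd & bd & ld).
destruct (lip_cap_inv T) as (Ki & hKi & bi & li).
assert (hL := cut_lip_pos); assert (hb := equilibrium_bounds).
set (M := 360 / (1 - h) + 1 + cut_lip * 32).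
assert (hM : 0 <= 360 / (1 - h)) by (apply Rdiv_le_0_compat; lra).
assert (hbound : forall mu s, 0 <= mu <= 1 -> start <= s ->
  Rabs (W mu s) <= M + 30 /\ Rabs (P mu s) <= M /\
  Rabs (cut_force k floor_value (W mu s)) <= M).
{ intros mu s hmu hs; destruct (family_bounds mu s hmu hs) as [hw hp].
  assert (hf := family_above_floor mu s hmu hs); unfold floor_value in hf.
  rewrite <- pow2_abs in hp; unfold M; repeat split.
  - rewrite Rabs_pos_eq; lra.
  - generalize (pow2_ge_0 (Rabs (P mu s) - 1)) (Rabs_pos (P mu s)); nra.
  - eapply Rle_trans; [apply cut_force_bound |].
    assert (Rabs (W mu s - a) <= 32) by (apply Rabs_le; lra).
    generalize (Rmult_le_compat_l cut_lip _ _ ltac:(lra) H); lra. }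
assert (hM0 : 0 <= M) by (unfold M; lra).
set (C := Kd + Ki * cut_lip); set (X := Kd * M + Ki * M).
set (E := exp ((2 + 3 * C) * (T - start))).
set (K2 := (10 ^ 2 + 20 ^ 2 + X ^ 2 * (T - start)) * E).
assert (hE : 0 < E) by apply exp_pos.
assert (hC : 0 <= C) by (unfold C; generalize (Rmult_le_pos Ki cut_lip hKi); lra).
assert (hXT : 0 <= X ^ 2 * (T - start)) by (apply Rmult_le_pos; [apply pow2_ge_0 | lra]).
assert (hK2 : 0 <= K2) by (apply Rmult_le_pos; lra).
assert (hmain : forall mu mu' s, 0 <= mu <= 1 -> 0 <= mu' <= 1 -> start <= s <= T ->
  (W mu s - W mu' s) ^ 2 + (P mu s - P mu' s) ^ 2 <= K2 * (mu - mu') ^ 2).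
{ intros mu mu' s hmu hmu' hs; set (dm := Rabs (mu - mu')).
  assert (hdm : 0 <= dm) by apply Rabs_pos.
  eapply Rle_trans.
  - apply (semilinear_gronwall (fun t => - drag mu t) (fun t => - / (1 - cap mu t))
      (fun t => - drag mu' t) (fun t => - / (1 - cap mu' t)) (cut_force k floor_value)
      (W mu) (P mu) (W mu') (P mu') Kd Ki cut_lip C (X * dm) start s); try lra.
    + unfold C; lra.
    + exact cut_force_lip.
    + intros t ht; assert (ht' : start <= t <= T) by lra.
      rewrite !Rabs_Ropp; repeat split; [now apply bd | now apply bi |].
      destruct (hbound mu' t hmu' (proj1 ht')) as (_ & b2 & b3).
      replace (- drag mu t - - drag mu' t) with (- (drag mu t - drag mu' t)) by ring.
      replace (- / (1 - cap mu t) - - / (1 - cap mu' t))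
        with (- (/ (1 - cap mu t) - / (1 - cap mu' t))) by ring.
      rewrite !Rabs_Ropp.
      assert (j1 := Rmult_le_compat _ _ _ _ (Rabs_pos _) (Rabs_pos _)
        (ld mu mu' t hmu hmu' ht') b2).
      assert (j2 := Rmult_le_compat _ _ _ _ (Rabs_pos _) (Rabs_pos _)
        (li mu mu' t hmu hmu' ht') b3).
      fold dm in j1, j2; unfold X; lra.
    + intros t _; now apply family_derive.
    + intros t _; now apply family_derive.
  - destruct (hWP mu hmu) as (e1 & e2 & _); destruct (hWP mu' hmu') as (e1' & e2' & _).
    rewrite e1, e2, e1', e2'.
    destruct (start_lipschitz mu mu' hmu hmu') as [l1 l2]; fold dm in l1, l2.
    rewrite <- (pow2_abs (start_val mu - _)), <- (pow2_abs (start_der mu - _)).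
    rewrite <- (pow2_abs (mu - mu')); fold dm.
    assert (s1 := pow_incr _ _ 2 (conj (Rabs_pos _) l1)).
    assert (s2 := pow_incr _ _ 2 (conj (Rabs_pos _) l2)).
    assert (s3 : (X * dm) ^ 2 * (s - start) <= (X * dm) ^ 2 * (T - start))
      by (apply Rmult_le_compat_l; [apply pow2_ge_0 | lra]).
    assert (s4 : exp ((2 + 3 * C) * (s - start)) <= E)
      by (apply exp_le, Rmult_le_compat_l; lra).
    apply Rle_trans with
      (((10 * dm) ^ 2 + (20 * dm) ^ 2 + (X * dm) ^ 2 * (T - start)) * E);
      [| unfold K2; right; ring].
    apply Rmult_le_compat; [| left; apply exp_pos | lra | exact s4].
    repeat apply Rplus_le_le_0_compat; try apply pow2_ge_0.
    apply Rmult_le_pos; [apply pow2_ge_0 | lra]. }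
assert (hfin : forall u mu mu', u ^ 2 <= K2 * (mu - mu') ^ 2 ->
  Rabs u <= (M + 30 + (K2 + 1)) * Rabs (mu - mu')).
{ intros u mu mu' hu; apply Rle_trans with ((K2 + 1) * Rabs (mu - mu')).
  - now apply abs_le_of_sq.
  - apply Rmult_le_compat_r; [apply Rabs_pos | lra]. }
split; exists (M + 30 + (K2 + 1)); (split; [lra |]; split).
- intros mu s hmu hs; generalize (hbound mu s hmu (proj1 hs)); lra.
- intros mu mu' s hmu hmu' hs; apply hfin.
  generalize (hmain mu mu' s hmu hmu' hs) (pow2_ge_0 (P mu s - P mu' s)); lra.
- intros mu s hmu hs; generalize (hbound mu s hmu (proj1 hs)); lra.
- intros mu mu' s hmu hmu' hs; apply hfin.
  generalize (hmain mu mu' s hmu hmu' hs) (pow2_ge_0 (W mu s - W mu' s)); lra.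
Qed.

(** ** Convergence to the singular solution *)

Lemma energy_excess_lower mu sg :
  0 <= mu <= 1 -> start <= sg ->
  (1 - h) / 2 * P mu sg ^ 2 + k / 2 * (W mu sg - a) ^ 2 <= energy mu sg - min_energy.
Proof.
intros hmu hs; rewrite family_energy_eq by assumption.
assert (hw := family_above_floor mu sg hmu hs); unfold floor_value in hw.
assert (hc := cap_bounds mu sg (proj1 hmu)).
assert (hk := stiffness_bounds N hN); fold k in hk.
assert (he := potential_excess (W mu sg) ltac:(lra)); unfold min_energy.
assert (hq := pow2_ge_0 (W mu sg - a)); assert (hp := pow2_ge_0 (P mu sg)).
assert (h1 : 0 < 2 * a / W mu sg) by (apply Rdiv_lt_0_compat; lra).
assert (0 <= k / 2 * (W mu sg - a) ^ 2 * (2 * a / W mu sg)).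
{ apply Rmult_le_pos; [apply Rmult_le_pos |]; lra. }
assert (0 <= (h - cap mu sg) * P mu sg ^ 2) by (apply Rmult_le_pos; lra).
lra.
Qed.

Lemma energy_excess_upper mu sg :
  0 <= mu <= 1 -> start <= sg -> a / 2 <= W mu sg ->
  energy mu sg - min_energy <= P mu sg ^ 2 + 10 * (W mu sg - a) ^ 2.
Proof.
intros hmu hs hw; rewrite family_energy_eq by assumption.
assert (hc := cap_bounds mu sg (proj1 hmu)).
assert (hk := stiffness_bounds N hN); fold k in hk.
assert (he := potential_excess (W mu sg) ltac:(lra)); unfold min_energy.
assert (hq := pow2_ge_0 (W mu sg - a)); assert (hp := pow2_ge_0 (P mu sg)).
assert (h1 : 2 * a / W mu sg <= 4).
{ apply Rle_div_l; lra. }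
assert (k / 2 * (W mu sg - a) ^ 2 * (1 + 2 * a / W mu sg)
        <= 2 * (W mu sg - a) ^ 2 * 5).
{ apply Rmult_le_compat; try lra.
  - apply Rmult_le_pos; lra.
  - assert (0 < 2 * a / W mu sg) by (apply Rdiv_lt_0_compat; lra); lra.
  - apply Rmult_le_compat_r; lra. }
assert (0 <= cap mu sg * P mu sg ^ 2) by (apply Rmult_le_pos; lra).
lra.
Qed.

(** The energy alone does not control the distance to the equilibrium; adding a
    small multiple of [(W - a) * P] makes its decay coercive. *)
Lemma limit_family_approaches dl :
  0 < dl -> exists sg, start <= sg /\ (W 0 sg - a) ^ 2 + P 0 sg ^ 2 < dl.
Proof.
intros hdl; apply NNPP; intros hno.
assert (hall : forall s, start <= s -> dl <= (W 0 s - a) ^ 2 + P 0 s ^ 2).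
{ intros s hs; destruct (Rlt_dec ((W 0 s - a) ^ 2 + P 0 s ^ 2) dl) as [h1|h1]; [| lra].
  exfalso; apply hno; now exists s. }
assert (h0 : 0 <= 0 <= 1) by lra.
assert (hcap : forall s, cap 0 s = 0)
  by (intros s; unfold cap; rewrite Rmult_0_l; apply Rmin_left; lra).
assert (hd := damping_bounds); assert (hk := stiffness_bounds N hN); fold k in hk.
set (nu := 1 / 100).
set (L := fun s => cut_energy 0 (W 0 s) (P 0 s) + nu * ((W 0 s - a) * P 0 s)).
set (dL := fun s => - d * P 0 s ^ 2 + nu * (P 0 s ^ 2 + (W 0 s - a)
             * (- d * P 0 s - (k * W 0 s - 1 / W 0 s ^ 2)))).
assert (hdL : forall s, start <= s -> is_derive L s (dL s)).
{ intros s hs; destruct (family_derive 0 s h0) as [dW dP].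
  unfold L; evar_last.
  - apply @is_derive_plus.
    + apply (energy_dissipation 0 s (fun _ => 0) 0); [exact h0 | | now rewrite hcap].
      apply (is_derive_const 0).
    + apply is_derive_scal, (is_derive_mult (fun s => W 0 s - a) (P 0));
        [apply (is_derive_minus (W 0) (fun _ => a)); [exact dW | apply (is_derive_const a)]
        | exact dP | intros; apply Rmult_comm].
  - unfold dL, cut_acc, drag; rewrite family_force, hcap by assumption.
    unfold plus, mult, minus, opp, zero, plus; simpl.
    assert (hw := family_above_floor 0 s h0 hs); unfold floor_value in hw.
    field; lra. }
assert (hdec : forall s, start <= s -> dL s <= - (nu / 100 * dl)).
{ intros s hs; specialize (hall s hs).
  assert (hw := family_above_floor 0 s h0 hs); unfold floor_value in hw.
  assert (hconv : k * (W 0 s - a) ^ 2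
                  <= (W 0 s - a) * (k * W 0 s - 1 / W 0 s ^ 2)).
  { replace (1 / W 0 s ^ 2) with (k * a ^ 3 * (1 / W 0 s ^ 2))
      by (unfold k; rewrite hak; ring).
    replace ((W 0 s - a) * (k * W 0 s - k * a ^ 3 * (1 / W 0 s ^ 2)))
      with (k * (W 0 s - a) ^ 2 * (1 + (a / W 0 s + (a / W 0 s) ^ 2))) by (field; lra).
    assert (0 < a / W 0 s) by (apply Rdiv_lt_0_compat; lra).
    assert (0 <= k * (W 0 s - a) ^ 2) by (apply Rmult_le_pos; [lra | apply pow2_ge_0]).
    assert (0 < (a / W 0 s) ^ 2) by (now apply pow_lt).
    rewrite <- (Rmult_1_r (k * (W 0 s - a) ^ 2)) at 1.
    apply Rmult_le_compat_l; lra. }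
  unfold dL; revert hall hconv.
  generalize (k * W 0 s - 1 / W 0 s ^ 2) (W 0 s - a) (P 0 s); intros f q p hall hconv.
  assert (hq := pow2_ge_0 q); assert (hp := pow2_ge_0 p).
  assert (hcross : - (q * (d * p)) <= k / 2 * q ^ 2 + d ^ 2 / (2 * k) * p ^ 2).
  { apply (Rmult_le_reg_l (2 * k)); [lra |].
    replace (2 * k * (k / 2 * q ^ 2 + d ^ 2 / (2 * k) * p ^ 2))
      with ((k * q) ^ 2 + (d * p) ^ 2) by (field; lra).
    generalize (pow2_ge_0 (k * q + d * p)); lra. }
  assert (hd2 : d ^ 2 / (2 * k) <= 50).
  { apply Rle_div_l; [lra |]; simpl; nra. }
  assert (hd3 : d ^ 2 / (2 * k) * p ^ 2 <= 50 * p ^ 2) by (apply Rmult_le_compat_r; lra).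
  assert (hk2 : 4 / 9 * q ^ 2 <= k * q ^ 2) by (apply Rmult_le_compat_r; lra).
  assert (hd4 : 4 / 3 * p ^ 2 <= d * p ^ 2) by (apply Rmult_le_compat_r; lra).
  unfold nu; lra. }
assert (hbelow : forall s, start <= s -> min_energy <= L s).
{ intros s hs; assert (he := energy_excess_lower 0 s h0 hs).
  unfold energy in he; rewrite hcap in he; unfold L.
  assert (hw := family_above_floor 0 s h0 hs); unfold floor_value in hw.
  assert (he2 := potential_excess (W 0 s) ltac:(lra)).
  unfold cut_energy; rewrite cut_potential_eq by (unfold floor_value; lra).
  assert (hq := pow2_ge_0 (W 0 s - a)); assert (hp := pow2_ge_0 (P 0 s)).
  assert (h1 : 0 < 2 * a / W 0 s) by (apply Rdiv_lt_0_compat; lra).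
  assert (0 <= k / 2 * (W 0 s - a) ^ 2 * (2 * a / W 0 s)) by (apply Rmult_le_pos; [apply Rmult_le_pos |]; lra).
  assert (4 / 9 * (W 0 s - a) ^ 2 <= k * (W 0 s - a) ^ 2) by (apply Rmult_le_compat_r; lra).
  assert (h2 := pow2_ge_0 (W 0 s - a + P 0 s)).
  unfold min_energy, nu; lra. }
set (r := nu / 100 * dl).
assert (hr : 0 < r) by (unfold r, nu; lra).
set (t := start + (L start - min_energy + 1) / r).
assert (hLs := hbelow start (Rle_refl _)).
assert (hst : start <= t).
{ unfold t; assert (0 <= (L start - min_energy + 1) / r)
    by (apply Rdiv_le_0_compat; lra); lra. }
assert (hfin : L t + r * t <= L start + r * start).
{ apply (derive_nonincreasing (fun s => L s + r * s) (fun s => dL s + r)); [exact hst | |].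
  - intros s hs; apply (is_derive_plus L (fun s => r * s)); [apply hdL; lra |].
    evar_last; [apply is_derive_scal, (@is_derive_id R_AbsRing) | unfold one; simpl; ring].
  - intros s hs; generalize (hdec s (proj1 hs)); unfold r; lra. }
assert (hrt : r * t = r * start + (L start - min_energy + 1)) by (unfold t; field; lra).
generalize (hbelow t hst); lra.
Qed.

(** Energy decay turns the approach at one value of the variable, for [mu = 0],
    into uniform closeness at all later ones, for all small [mu]. *)
Lemma family_near_equilibrium dl :
  0 < dl -> exists sg0 mu0, start <= sg0 /\ 0 < mu0 <= 1 /\
    forall mu s, 0 <= mu <= mu0 -> sg0 <= s ->
      (W mu s - a) ^ 2 <= dl /\ P mu s ^ 2 <= dl.
Proof.
intros hdl; assert (hk := stiffness_bounds N hN); fold k in hk.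
assert (hb := equilibrium_bounds).
set (c := (1 - h) / 2 * (2 / 9)).
assert (hc : 0 < c < 1) by (unfold c; lra).
set (eta := Rmin (c * dl / 100) (1 / 100)).
assert (heta : 0 < eta) by (apply Rmin_glb_lt; [apply Rdiv_lt_0_compat; nra | lra]).
assert (heta1 : eta <= c * dl / 100) by apply Rmin_l.
assert (heta2 : eta <= 1 / 100) by apply Rmin_r.
destruct (limit_family_approaches eta heta) as (sg0 & hsg & hlim).
destruct (family_lipschitz sg0 hsg) as [(Kw & hKw & _ & lw) (Kp & hKp & _ & lp)].
set (K := Kw ^ 2 + Kp ^ 2 + 1).
assert (hK : 1 <= K) by (unfold K; generalize (pow2_ge_0 Kw) (pow2_ge_0 Kp); lra).
set (mu0 := Rmin 1 (eta / K)).
assert (hek : 0 < eta / K) by (apply Rdiv_lt_0_compat; lra).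
assert (hmu0 : 0 < mu0 <= 1) by (split; [apply Rmin_glb_lt; lra | apply Rmin_l]).
exists sg0, mu0; split; [exact hsg |]; split; [exact hmu0 |].
intros mu s hmu hs.
assert (hmu1 : 0 <= mu <= 1) by lra; assert (h00 : 0 <= 0 <= 1) by lra.
assert (hss : start <= sg0 <= sg0) by lra.
assert (l1 := lw mu 0 sg0 hmu1 h00 hss); assert (l2 := lp mu 0 sg0 hmu1 h00 hss).
rewrite Rminus_0_r, (Rabs_pos_eq mu) in l1, l2 by lra.
assert (hmuK : mu ^ 2 * K <= eta).
{ assert (mu <= eta / K) by (generalize (Rmin_r 1 (eta / K)); fold mu0; lra).
  assert (mu * K <= eta) by (apply (Rle_div_r mu eta K); lra).
  simpl; nra. }
assert (s1 : (W mu sg0 - W 0 sg0) ^ 2 <= Kw ^ 2 * mu ^ 2).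
{ rewrite <- pow2_abs, <- Rpow_mult_distr; apply pow_incr; split; [apply Rabs_pos | exact l1]. }
assert (s2 : (P mu sg0 - P 0 sg0) ^ 2 <= Kp ^ 2 * mu ^ 2).
{ rewrite <- pow2_abs, <- Rpow_mult_distr; apply pow_incr; split; [apply Rabs_pos | exact l2]. }
assert (hm2 := pow2_ge_0 mu).
assert (s3 : Kw ^ 2 * mu ^ 2 + Kp ^ 2 * mu ^ 2 <= eta) by (unfold K in hmuK; nra).
assert (hq : (W mu sg0 - a) ^ 2 + P mu sg0 ^ 2 <= 4 * eta).
{ generalize (pow2_ge_0 ((W mu sg0 - W 0 sg0) - (W 0 sg0 - a)))
    (pow2_ge_0 ((P mu sg0 - P 0 sg0) - P 0 sg0)); nra. }
assert (hwa : a / 2 <= W mu sg0).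
{ assert (hp := pow2_ge_0 (P mu sg0)); nra. }
assert (u := energy_excess_upper mu sg0 hmu1 hsg hwa).
assert (e := energy_nonincreasing mu sg0 s hmu1 hs).
assert (lo := energy_excess_lower mu s hmu1 ltac:(lra)).
assert (hp0 := pow2_ge_0 (P mu sg0)).
assert (hfin : energy mu s - min_energy <= c * dl) by lra.
assert (hp := pow2_ge_0 (P mu s)); assert (hq' := pow2_ge_0 (W mu s - a)).
assert (k1 : 0 <= (1 - h) / 2 * P mu s ^ 2) by (apply Rmult_le_pos; lra).
assert (k2 : 2 / 9 * (W mu s - a) ^ 2 <= k / 2 * (W mu s - a) ^ 2)
  by (apply Rmult_le_compat_r; lra).
assert (c1 : c * dl <= 2 / 9 * dl) by (apply Rmult_le_compat_r; unfold c; lra).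
assert (c2 : c * dl <= (1 - h) / 2 * dl) by (apply Rmult_le_compat_r; unfold c; lra).
split.
- lra.
- apply (Rmult_le_reg_l ((1 - h) / 2)); lra.
Qed.

(** ** The angle around the equilibrium *)

Definition radius2 (mu sg : R) : R := (W mu sg - a) ^ 2 + P mu sg ^ 2.

Lemma radius2_derive mu sg :
  0 <= mu <= 1 ->
  is_derive (radius2 mu) sg
    (2 * (P mu sg * (W mu sg - a + cut_acc mu sg (W mu sg) (P mu sg)))).
Proof.
intros hmu; destruct (family_derive mu sg hmu) as [dW dP]; evar_last.
- apply @is_derive_plus; apply is_derive_pow; [| exact dP].
  apply (is_derive_minus (W mu) (fun _ => a)); [exact dW | apply (is_derive_const a)].
- unfold plus, minus, opp, zero; simpl; unfold plus, opp; simpl; ring.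
Qed.

Lemma radius2_start mu : 0 <= mu <= 1 -> 0 < radius2 mu start.
Proof.
intros hmu; unfold radius2; destruct (hWP mu hmu) as (h1 & _ & _); rewrite h1.
assert (hv := start_val_bounds mu hmu); assert (hb := equilibrium_bounds).
generalize (pow2_ge_0 (P mu start)); nra.
Qed.

(** The equilibrium is a solution of the same system, so no member of the family
    ever reaches it. *)
Lemma radius2_pos mu sg : 0 <= mu <= 1 -> 0 < radius2 mu sg.
Proof.
intros hmu.
set (C := 7 / (1 - h) + / (1 - h) * cut_lip); set (K := 1 + 3 * C).
set (dR := fun s => 2 * (P mu s * (W mu s - a + cut_acc mu s (W mu s) (P mu s)))).
assert (hrate : forall s, Rabs (dR s) <= K * radius2 mu s).
{ intros s; destruct (drag_bounds mu s (proj1 hmu)) as [b1 b2].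
  destruct (cap_inv_bounds mu s (proj1 hmu)) as [i1 i2].
  assert (hL := cut_lip_pos).
  assert (hacc : Rabs (cut_acc mu s (W mu s) (P mu s))
                 <= C * (Rabs (P mu s) + Rabs (W mu s - a))).
  { unfold cut_acc; eapply Rle_trans; [apply Rabs_triang |].
    rewrite !Rabs_mult, !Rabs_Ropp, (Rabs_pos_eq (drag mu s)), (Rabs_pos_eq (/ _)) by lra.
    assert (j1 := Rmult_le_compat_r _ _ _ (Rabs_pos (P mu s)) b2).
    assert (i0 : 0 <= / (1 - cap mu s)) by lra.
    assert (j2 := Rmult_le_compat _ _ _ _ i0 (Rabs_pos _) i2 (cut_force_bound (W mu s))).
    assert (0 <= 7 / (1 - h) * Rabs (W mu s - a)) by (apply Rmult_le_pos; [lra | apply Rabs_pos]).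
    assert (0 <= / (1 - h) * cut_lip * Rabs (P mu s))
      by (apply Rmult_le_pos; [apply Rmult_le_pos; lra | apply Rabs_pos]).
    unfold C; lra. }
  assert (hC : 0 <= C) by (unfold C; generalize (Rmult_le_pos (/ (1 - h)) cut_lip); lra).
  unfold dR, radius2; rewrite <- (pow2_abs (W mu s - a)), <- (pow2_abs (P mu s)).
  rewrite !Rabs_mult, (Rabs_pos_eq 2) by lra.
  assert (j3 := Rmult_le_compat_l _ _ _ (Rabs_pos (P mu s)) (Rle_trans _ _ _
    (Rabs_triang (W mu s - a) (cut_acc mu s (W mu s) (P mu s)))
    (Rplus_le_compat_l _ _ _ hacc))).
  revert j3; generalize (Rabs (P mu s)) (Rabs (W mu s - a)); intros p q j3.
  assert (0 <= (1 + C) * (p - q) ^ 2) by (apply Rmult_le_pos; [lra | apply pow2_ge_0]).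
  assert (0 <= C * q ^ 2) by (apply Rmult_le_pos; [lra | apply pow2_ge_0]).
  unfold K; lra. }
assert (hdR : forall s, is_derive (radius2 mu) s (dR s))
  by (intros s; now apply radius2_derive).
assert (hexp : forall c s, is_derive (fun s => exp (c * (s - start))) s
                             (c * exp (c * (s - start)))).
{ intros c s; auto_derive; [easy | unfold Rminus; ring]. }
assert (hprod : forall c s, is_derive (fun s => radius2 mu s * exp (c * (s - start))) s
  ((dR s + c * radius2 mu s) * exp (c * (s - start)))).
{ intros c s; evar_last.
  - apply (is_derive_mult (radius2 mu) (fun s => exp (c * (s - start)))); [apply hdR
      | apply hexp | intros; apply Rmult_comm].
  - unfold plus, mult; simpl; ring. }
assert (hs := radius2_start mu hmu).
assert (hpos : forall c u, radius2 mu start <= radius2 mu u * exp (c * (u - start)) ->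
  0 < radius2 mu u).
{ intros c u hu; apply (Rmult_lt_reg_r (exp (c * (u - start)))); [apply exp_pos | lra]. }
assert (hst : forall c, radius2 mu start * exp (c * (start - start)) = radius2 mu start).
{ intros c; rewrite Rminus_diag, Rmult_0_r, exp_0; ring. }
destruct (Rle_dec start sg) as [hle|hle].
- apply (hpos K); rewrite <- (hst K) at 1.
  apply (derive_nondecreasing (fun s => radius2 mu s * exp (K * (s - start)))
    (fun s => (dR s + K * radius2 mu s) * exp (K * (s - start)))); [exact hle | |].
  + intros s _; apply hprod.
  + intros s _; apply Rmult_le_pos; [| left; apply exp_pos].
    generalize (hrate s); intros hr; apply Rabs_le_between in hr; lra.
- apply (hpos (- K)); rewrite <- (hst (- K)) at 1.
  apply (derive_nonincreasing (fun s => radius2 mu s * exp (- K * (s - start)))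
    (fun s => (dR s + - K * radius2 mu s) * exp (- K * (s - start)))); [lra | |].
  + intros s _; apply hprod.
  + intros s _; rewrite <- (Rmult_0_l (exp (- K * (s - start)))).
    apply Rmult_le_compat_r; [left; apply exp_pos |].
    generalize (hrate s); intros hr; apply Rabs_le_between in hr; lra.
Qed.

Definition angular_rate (mu sg : R) : R :=
  (P mu sg ^ 2 - (W mu sg - a) * cut_acc mu sg (W mu sg) (P mu sg)) / radius2 mu sg.

Definition angle (mu sg : R) : R :=
  - atan (P mu start / (W mu start - a)) + RInt (angular_rate mu) start sg.

Lemma cap_inv_continuous mu sg :
  0 <= mu -> continuous (fun s => / (1 - cap mu s)) sg.
Proof.
intros hmu; apply continuity_pt_filterlim, continuity_pt_inv.
- apply continuity_pt_minus; [apply continuity_pt_const; now intros ? ? |].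
  apply continuity_pt_filterlim, cap_continuous.
- generalize (cap_bounds mu sg hmu); lra.
Qed.

Lemma angular_rate_continuous mu sg :
  0 <= mu <= 1 -> continuous (angular_rate mu) sg.
Proof.
intros hmu; destruct (family_derive mu sg hmu) as [dW dP].
assert (cW := derive_continuous _ _ _ dW); assert (cP := derive_continuous _ _ _ dP).
assert (cR := derive_continuous _ _ _ (radius2_derive mu sg hmu)).
assert (ci := cap_inv_continuous mu sg (proj1 hmu)).
assert (cq : continuous (fun s => W mu s - a) sg)
  by (apply (continuous_minus (W mu) (fun _ => a)); [exact cW | apply continuous_const]).
assert (cacc : continuous (fun s => cut_acc mu s (W mu s) (P mu s)) sg).
{ unfold cut_acc; apply @continuous_plus; apply @continuous_mult.
  - apply (continuous_opp (drag mu)); unfold drag, Rdiv; apply @continuous_mult; [| exact ci].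
    apply (continuous_minus (fun _ => d)); [apply continuous_const | apply cap_continuous].
  - exact cP.
  - apply (continuous_opp (fun s => / (1 - cap mu s))); exact ci.
  - apply (continuous_comp (W mu) (cut_force k floor_value)); [exact cW |].
    apply (lipschitz_continuous _ cut_lip); [left; apply cut_lip_pos |].
    exact cut_force_lip. }
unfold angular_rate, Rdiv; apply @continuous_mult.
- apply @continuous_minus; [| now apply @continuous_mult].
  apply (continuous_ext (fun s => P mu s * P mu s)); [intros; simpl; ring |].
  now apply @continuous_mult.
- apply continuity_pt_filterlim, continuity_pt_inv.
  + apply continuity_pt_filterlim; exact cR.
  + generalize (radius2_pos mu sg hmu); lra.
Qed.

Lemma angle_derive mu sg : 0 <= mu <= 1 -> is_derive (angle mu) sg (angular_rate mu sg).
Proof.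
intros hmu; rewrite <- (Rplus_0_l (angular_rate mu sg)); unfold angle.
apply (is_derive_plus (fun _ => - atan (P mu start / (W mu start - a)))).
- apply (is_derive_const (- atan (P mu start / (W mu start - a)))).
- apply (RInt_derive_continuous (angular_rate mu)).
  intros x; now apply angular_rate_continuous.
Qed.

Lemma angle_start mu : angle mu start = - atan (P mu start / (W mu start - a)).
Proof.
unfold angle; replace (RInt (angular_rate mu) start start) with 0; [ring |].
symmetry; exact (RInt_point (V := R_CompleteNormedModule) start _).
Qed.

(** The angle integrates the rate at which [(W - a, P)] turns, so undoing that
    rotation and dividing by the length leaves nothing that moves.  The phase [f]
    is what later yields the cosine and the sine from one identity. *)
Lemma rotated_constant mu f sg :
  0 <= mu <= 1 ->
  is_derive (fun s => ((W mu s - a) * cos (angle mu s + f) - P mu s * sin (angle mu s + f))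
                      / sqrt (radius2 mu s)) sg 0.
Proof.
intros hmu; destruct (family_derive mu sg hmu) as [dW dP].
assert (hr0 := radius2_pos mu sg hmu); assert (hr := sqrt_lt_R0 _ hr0).
assert (hr2 : sqrt (radius2 mu sg) ^ 2 = (W mu sg - a) ^ 2 + P mu sg ^ 2)
  by (rewrite <- Rsqr_pow2, Rsqr_sqrt by lra; reflexivity).
assert (dq : is_derive (fun s => W mu s - a) sg (P mu sg)).
{ rewrite <- (Rminus_0_r (P mu sg)).
  apply (is_derive_minus (W mu) (fun _ => a)); [exact dW | apply (is_derive_const a)]. }
assert (dth : is_derive (fun s => angle mu s + f) sg (angular_rate mu sg)).
{ rewrite <- (Rplus_0_r (angular_rate mu sg)).
  apply (is_derive_plus (angle mu) (fun _ => f));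
    [now apply angle_derive | apply (is_derive_const f)]. }
assert (hcomm : forall n m : R_AbsRing, mult n m = mult m n) by (intros; apply Rmult_comm).
evar_last.
- apply (is_derive_div (fun s => (W mu s - a) * cos (angle mu s + f)
      - P mu s * sin (angle mu s + f)) (fun s => sqrt (radius2 mu s))).
  + apply (is_derive_minus (fun s => (W mu s - a) * cos (angle mu s + f))
      (fun s => P mu s * sin (angle mu s + f))).
    * apply (is_derive_mult (fun s => W mu s - a) (fun s => cos (angle mu s + f)));
        [exact dq | | exact hcomm].
      apply (is_derive_comp cos (fun s => angle mu s + f)); [apply is_derive_cos | exact dth].
    * apply (is_derive_mult (P mu) (fun s => sin (angle mu s + f)));
        [exact dP | | exact hcomm].
      apply (is_derive_comp sin (fun s => angle mu s + f)); [apply is_derive_sin | exact dth].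
  + apply (is_derive_sqrt (radius2 mu)); [now apply radius2_derive | exact hr0].
  + lra.
- unfold angular_rate, minus, plus, opp, scal, mult; simpl; unfold mult; simpl.
  replace (radius2 mu sg) with (sqrt (radius2 mu sg) ^ 2) at 1 2
    by (rewrite <- Rsqr_pow2; apply Rsqr_sqrt; lra).
  revert hr hr2; generalize (sqrt (radius2 mu sg)) (W mu sg - a) (P mu sg)
    (cut_acc mu sg (W mu sg) (P mu sg)) (cos (angle mu sg + f)) (sin (angle mu sg + f)).
  intros r q p acc C S hr hr2.
  apply (Rmult_eq_reg_r (r ^ 4)); [| apply pow_nonzero; lra].
  transitivity (r * (r ^ 2 * (p * C - acc * S) - (p ^ 2 - q * acc) * (q * S + p * C)
    - p * (q + acc) * (q * C - p * S))); [field; lra |].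
  rewrite hr2; ring.
Qed.

Lemma family_polar_start mu :
  0 <= mu <= 1 ->
  W mu start - a = sqrt (radius2 mu start) * cos (angle mu start) /\
  P mu start = - sqrt (radius2 mu start) * sin (angle mu start).
Proof.
intros hmu; rewrite angle_start, cos_neg, sin_neg, cos_atan, sin_atan.
assert (hq : 0 < W mu start - a).
{ destruct (hWP mu hmu) as (h1 & _ & _); rewrite h1.
  generalize (start_val_bounds mu hmu) equilibrium_bounds; lra. }
unfold radius2; revert hq; generalize (W mu start - a) (P mu start); intros q p hq.
assert (hr : sqrt (q ^ 2 + p ^ 2) = q * sqrt (1 + Rsqr (p / q))).
{ rewrite <- (sqrt_Rsqr q) at 2 by lra; rewrite <- sqrt_mult_alt by apply Rle_0_sqr.
  f_equal; unfold Rsqr; field; lra. }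
assert (hz : 0 < sqrt (1 + Rsqr (p / q)))
  by (apply sqrt_lt_R0; generalize (Rle_0_sqr (p / q)); lra).
rewrite hr; split; field; lra.
Qed.

Lemma family_polar mu sg :
  0 <= mu <= 1 ->
  W mu sg - a = sqrt (radius2 mu sg) * cos (angle mu sg) /\
  P mu sg = - sqrt (radius2 mu sg) * sin (angle mu sg).
Proof.
intros hmu.
assert (hconst : forall f,
  (W mu sg - a) * cos (angle mu sg + f) - P mu sg * sin (angle mu sg + f)
  = sqrt (radius2 mu sg) * cos (angle mu start + f - angle mu start)).
{ intros f; set (g := fun s => ((W mu s - a) * cos (angle mu s + f)
    - P mu s * sin (angle mu s + f)) / sqrt (radius2 mu s)).
  assert (hg : g sg = g start).
  { destruct (Rle_dec start sg) as [hle|hle]; [| symmetry];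
      (apply (derive_constant g (fun _ => 0)); [lra | | auto]);
      intros s _; now apply rotated_constant. }
  assert (h1 := sqrt_lt_R0 _ (radius2_pos mu sg hmu)).
  assert (h2 := sqrt_lt_R0 _ (radius2_pos mu start hmu)).
  destruct (family_polar_start mu hmu) as [e1 e2].
  apply (Rmult_eq_reg_r (/ sqrt (radius2 mu sg))); [| apply Rinv_neq_0_compat; lra].
  transitivity (g sg); [reflexivity |]; rewrite hg; unfold g.
  set (r := sqrt (radius2 mu start)) in *; rewrite e1, e2, (cos_minus (angle mu start + f)).
  field; split; lra. }
(* Two values of the phase recover both components. *)
assert (h1 := hconst (- angle mu sg)); assert (h2 := hconst (PI / 2 - angle mu sg)).
replace (angle mu sg + - angle mu sg) with 0 in h1 by ring.
replace (angle mu sg + (PI / 2 - angle mu sg)) with (PI / 2) in h2 by ring.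
replace (angle mu start + - angle mu sg - angle mu start) with (- angle mu sg) in h1 by ring.
replace (angle mu start + (PI / 2 - angle mu sg) - angle mu start)
  with (PI / 2 - angle mu sg) in h2 by ring.
rewrite cos_0, sin_0, cos_neg in h1; rewrite cos_PI2, sin_PI2, cos_shift in h2; lra.
Qed.

(** [F' (w) / (w - a)] over [1 - x], the restoring coefficient. *)
Definition restoring (mu sg : R) : R :=
  k * (1 + (a * / W mu sg + a * / W mu sg * (a * / W mu sg))) * / (1 - cap mu sg).

(** In polar coordinates the radius drops out of the rate. *)
Lemma angular_rate_eq mu sg :
  0 <= mu <= 1 -> start <= sg ->
  angular_rate mu sg
  = sin (angle mu sg) * sin (angle mu sg)
    + (- (drag mu sg * (sin (angle mu sg) * cos (angle mu sg)))
       + restoring mu sg * (cos (angle mu sg) * cos (angle mu sg))).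
Proof.
intros hmu hs; destruct (family_polar mu sg hmu) as [hq hp].
assert (hw := family_above_floor mu sg hmu hs); unfold floor_value in hw.
assert (hr := radius2_pos mu sg hmu).
assert (hr2 : sqrt (radius2 mu sg) * sqrt (radius2 mu sg) = radius2 mu sg)
  by (apply sqrt_sqrt; lra).
assert (hc := cap_bounds mu sg (proj1 hmu)).
assert (hacc : cut_acc mu sg (W mu sg) (P mu sg)
   = - drag mu sg * P mu sg - restoring mu sg * (W mu sg - a)).
{ unfold cut_acc, restoring; rewrite family_force by assumption.
  replace (1 / W mu sg ^ 2) with (k * a ^ 3 * (1 / W mu sg ^ 2))
    by (unfold k; rewrite hak; ring).
  field; lra. }
unfold angular_rate; rewrite hacc.
set (D := restoring mu sg); set (b := drag mu sg).
assert (hrr := sqrt_lt_R0 _ hr); revert hq hp hr2 hrr.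
generalize (sqrt (radius2 mu sg)); intros r hq hp hr2 hrr.
rewrite hq, hp, <- hr2; field; lra.
Qed.

Lemma restoring_pos mu sg : 0 <= mu <= 1 -> start <= sg -> 0 <= restoring mu sg.
Proof.
intros hmu hs; assert (hw := family_above_floor mu sg hmu hs); unfold floor_value in hw.
assert (hk := stiffness_bounds N hN); fold k in hk.
destruct (cap_inv_bounds mu sg (proj1 hmu)) as [i1 _].
assert (hi : 0 < a * / W mu sg)
  by (apply Rmult_lt_0_compat; [lra | apply Rinv_0_lt_compat; lra]).
unfold restoring; apply Rmult_le_pos; [| lra].
apply Rmult_le_pos; [lra | nra].
Qed.

Lemma angular_rate_lower mu sg :
  0 <= mu <= 1 -> start <= sg -> - (7 / (1 - h)) <= angular_rate mu sg.
Proof.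
intros hmu hs; rewrite angular_rate_eq by assumption.
assert (hM := restoring_pos mu sg hmu hs).
destruct (drag_bounds mu sg (proj1 hmu)) as [b1 b2].
set (S := sin (angle mu sg)); set (C := cos (angle mu sg)).
assert (h1 : S * S + C * C = 1) by apply sin2_cos2.
assert (h2 : S * C <= 1) by nra.
assert (h3 : drag mu sg * (S * C) <= drag mu sg * 1) by (apply Rmult_le_compat_l; lra).
assert (0 <= restoring mu sg * (C * C)) by (apply Rmult_le_pos; nra).
nra.
Qed.

Lemma angular_rate_near :
  exists dl x0, 0 < dl /\ 0 < x0 /\ forall mu sg, 0 <= mu <= 1 -> start <= sg ->
    (W mu sg - a) ^ 2 <= dl -> cap mu sg <= x0 -> spin / 2 <= angular_rate mu sg.
Proof.
assert (hs := spin_pos); assert (hd := damping_bounds).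
assert (hk := stiffness_bounds N hN); fold k in hk.
assert (hb := equilibrium_bounds).
set (e := spin / 96).
exists (e ^ 2), (Rmin (1 / 2) (spin / 48)).
assert (he : 0 < e) by (unfold e; lra).
split; [now apply pow_lt |]; split; [apply Rmin_glb_lt; lra |].
intros mu sg hmu hsg hq hx; rewrite angular_rate_eq by assumption.
assert (hx1 := Rmin_l (1 / 2) (spin / 48)); assert (hx2 := Rmin_r (1 / 2) (spin / 48)).
destruct (cap_bounds mu sg (proj1 hmu)) as [hc1 hc2].
assert (hw := family_above_floor mu sg hmu hsg); unfold floor_value in hw.
set (S := sin (angle mu sg)); set (C := cos (angle mu sg)).
assert (h1 : S * S + C * C = 1) by apply sin2_cos2.
assert (hf := spin_lower S C h1).
assert (hdrag : 0 <= drag mu sg - d <= spin / 4).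
{ replace (drag mu sg - d) with (cap mu sg * (d - 1) / (1 - cap mu sg))
    by (unfold drag; field; lra).
  split; [apply Rdiv_le_0_compat; [apply Rmult_le_pos; lra | lra] |].
  apply Rle_div_l; nra. }
assert (hsc : S * C <= 1) by nra.
assert (t1 : (drag mu sg - d) * (S * C) <= spin / 4).
{ apply Rle_trans with ((drag mu sg - d) * 1); [apply Rmult_le_compat_l |]; lra. }
assert (hrest : 3 * k - spin / 4 <= restoring mu sg).
{ destruct (cap_inv_bounds mu sg (proj1 hmu)) as [i1 _].
  set (r := a * / W mu sg).
  assert (hr0 : 0 < r)
    by (apply Rmult_lt_0_compat; [lra | apply Rinv_0_lt_compat; lra]).
  assert (hwa : W mu sg <= a + e).
  { assert (h2 : Rabs (W mu sg - a) <= e).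
    { rewrite <- (Rabs_pos_eq e) by lra; apply Rsqr_le_abs_0; unfold Rsqr; simpl in hq; lra. }
    apply Rabs_le_between in h2; lra. }
  assert (hr : 1 - 2 * e <= r).
  { unfold r; apply (Rmult_le_reg_r (W mu sg)); [lra |].
    rewrite Rmult_assoc, Rinv_l, Rmult_1_r by lra.
    assert (0 <= e * e) by nra.
    destruct (Rle_dec 0 (1 - 2 * e)) as [h3|h3]; nra. }
  assert (hH : 3 - 6 * e <= 1 + (r + r * r)) by nra.
  assert (hk6 : k * (3 - 6 * e) <= k * (1 + (r + r * r)))
    by (apply Rmult_le_compat_l; lra).
  assert (k * e <= 4 * e) by (apply Rmult_le_compat_r; lra).
  assert (0 <= k * (1 + (r + r * r))) by (apply Rmult_le_pos; nra).
  unfold restoring; fold r.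
  apply Rle_trans with (k * (1 + (r + r * r)) * 1); [unfold e in *; lra |].
  apply Rmult_le_compat_l; lra. }
assert (hC : 0 <= C * C <= 1) by nra.
assert (t2 : (3 * k - spin / 4) * (C * C) <= restoring mu sg * (C * C))
  by (apply Rmult_le_compat_r; lra).
assert (t3 : spin / 4 * (C * C) <= spin / 4 * 1) by (apply Rmult_le_compat_l; lra).
lra.
Qed.

Lemma lip_restoring T : start <= T -> lip_family start T restoring.
Proof.
intros hT; destruct (family_lipschitz T hT) as [lW _].
assert (li : lip_family start T (fun mu s => / W mu s)).
{ apply (lip_inv start T W floor_value floor_pos); [| exact lW].
  intros mu s hmu hs; left; now apply family_above_floor. }
assert (lai := lip_mult start T _ _ (lip_const start T a) li).
unfold restoring; apply lip_mult; [| apply lip_cap_inv].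
apply lip_mult; [apply lip_const |].
apply lip_plus; [apply lip_const |].
apply lip_plus; [exact lai | now apply (lip_mult start T _ _ lai lai)].
Qed.

Lemma angle_start_lipschitz mu mu' :
  0 <= mu <= 1 -> 0 <= mu' <= 1 ->
  Rabs (angle mu start - angle mu' start) <= 500 * Rabs (mu - mu').
Proof.
intros hmu hmu'; rewrite !angle_start.
destruct (hWP mu hmu) as (e1 & e2 & _); destruct (hWP mu' hmu') as (e1' & e2' & _).
rewrite e1, e2, e1', e2'.
replace (- atan (start_der mu / (start_val mu - a))
         - - atan (start_der mu' / (start_val mu' - a)))
  with (- (atan (start_der mu / (start_val mu - a))
           - atan (start_der mu' / (start_val mu' - a)))) by ring.
rewrite Rabs_Ropp; eapply Rle_trans; [apply atan_lipschitz |].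
assert (hb := equilibrium_bounds).
assert (v1 := start_val_bounds mu hmu); assert (v2 := start_val_bounds mu' hmu').
assert (p1 := start_der_bound mu hmu); assert (p2 := start_der_bound mu' hmu').
destruct (start_lipschitz mu mu' hmu hmu') as [l1 l2].
set (x := start_val mu - a) in *; set (y := start_val mu' - a) in *.
assert (hx : 3 / 2 <= x <= 7) by (unfold x; lra).
assert (hy : 3 / 2 <= y <= 7) by (unfold y; lra).
replace (start_der mu / x - start_der mu' / y)
  with (((start_der mu - start_der mu') * y + start_der mu' * (y - x)) * (/ x * / y))
  by (field; lra).
assert (ix : 0 < / x <= 1).
{ split; [apply Rinv_0_lt_compat; lra |]; rewrite <- Rinv_1; apply Rinv_le_contravar; lra. }
assert (iy : 0 < / y <= 1).
{ split; [apply Rinv_0_lt_compat; lra |]; rewrite <- Rinv_1; apply Rinv_le_contravar; lra. }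
rewrite Rabs_mult, (Rabs_pos_eq (/ x * / y)) by (apply Rmult_le_pos; lra).
rewrite <- (Rmult_1_r (500 * _)).
apply Rmult_le_compat; [apply Rabs_pos | apply Rmult_le_pos; lra | | nra].
eapply Rle_trans; [apply Rabs_triang |]; rewrite !Rabs_mult.
assert (hyx : Rabs (y - x) <= 10 * Rabs (mu - mu')).
{ replace (y - x) with (- (start_val mu - start_val mu')) by (unfold x, y; ring).
  now rewrite Rabs_Ropp. }
assert (t1 : Rabs (start_der mu - start_der mu') * Rabs y <= 20 * Rabs (mu - mu') * 7).
{ apply Rmult_le_compat; try apply Rabs_pos; [exact l2 | rewrite Rabs_pos_eq; lra]. }
assert (t2 : Rabs (start_der mu') * Rabs (y - x) <= 12 * (10 * Rabs (mu - mu'))).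
{ apply Rmult_le_compat; try apply Rabs_pos; assumption. }
generalize (Rabs_pos (mu - mu')); lra.
Qed.

Lemma angle_lipschitz T :
  start <= T -> exists K, 0 <= K /\ forall mu mu' s, 0 <= mu <= 1 -> 0 <= mu' <= 1 ->
    start <= s <= T -> Rabs (angle mu s - angle mu' s) <= K * Rabs (mu - mu').
Proof.
intros hT.
destruct (lip_drag T) as (Kd & hKd & bd & ld).
destruct (lip_restoring T hT) as (Km & hKm & bm & lm).
set (C := 2 * (1 + Kd + Km)); set (X := Kd + Km).
set (E := exp ((2 * C + 1) * (T - start))).
set (K2 := (500 ^ 2 + X ^ 2 * (T - start)) * E).
assert (hE : 0 < E) by apply exp_pos.
assert (hXT : 0 <= X ^ 2 * (T - start)) by (apply Rmult_le_pos; [apply pow2_ge_0 | lra]).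
assert (hK2 : 0 <= K2) by (unfold K2; apply Rmult_le_pos; lra).
exists (K2 + 1); split; [lra |]; intros mu mu' s hmu hmu' hs.
apply abs_le_of_sq; [exact hK2 |]; set (dm := Rabs (mu - mu')).
assert (hdm : 0 <= dm) by apply Rabs_pos.
assert (hrate : forall t, start <= t <= T ->
  Rabs (angular_rate mu t - angular_rate mu' t)
  <= C * Rabs (angle mu t - angle mu' t) + X * dm).
{ intros t ht; rewrite !angular_rate_eq by (assumption || lra).
  set (u := angle mu t); set (u' := angle mu' t).
  assert (hS := sin_lipschitz u u'); assert (hC := cos_lipschitz u u').
  assert (bS : forall z, Rabs (sin z) <= 1)
    by (intros z; apply Rabs_le; generalize (SIN_bound z); lra).
  assert (bC : forall z, Rabs (cos z) <= 1)
    by (intros z; apply Rabs_le; generalize (COS_bound z); lra).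
  assert (hprod : forall f g : R -> R, (forall z, Rabs (f z) <= 1) ->
     (forall z, Rabs (g z) <= 1) -> Rabs (f u - f u') <= Rabs (u - u') ->
     Rabs (g u - g u') <= Rabs (u - u') ->
     Rabs (f u * g u - f u' * g u') <= 2 * Rabs (u - u') /\ Rabs (f u' * g u') <= 1).
  { intros f g bf bg lf lg; split.
    - replace (f u * g u - f u' * g u')
        with ((f u - f u') * g u + f u' * (g u - g u')) by ring.
      eapply Rle_trans; [apply Rabs_triang |]; rewrite !Rabs_mult.
      assert (i1 := Rmult_le_compat _ _ _ _ (Rabs_pos _) (Rabs_pos _) lf (bg u)).
      assert (i2 := Rmult_le_compat _ _ _ _ (Rabs_pos _) (Rabs_pos _) (bf u') lg).
      lra.
    - rewrite Rabs_mult.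
      assert (i1 := Rmult_le_compat _ _ _ _ (Rabs_pos _) (Rabs_pos _) (bf u') (bg u')); lra. }
  destruct (hprod sin sin bS bS hS hS) as [ss _].
  destruct (hprod sin cos bS bC hS hC) as [sc sc'].
  destruct (hprod cos cos bC bC hC hC) as [cc cc'].
  assert (hcoef : forall c c' x x' K, 0 <= K -> Rabs c <= K -> Rabs (c - c') <= K * dm ->
     Rabs (x - x') <= 2 * Rabs (u - u') -> Rabs x' <= 1 ->
     Rabs (c * x - c' * x') <= 2 * K * Rabs (u - u') + K * dm).
  { intros c c' x x' K hK hc hcc hxx hx'.
    replace (c * x - c' * x') with (c * (x - x') + (c - c') * x') by ring.
    eapply Rle_trans; [apply Rabs_triang |]; rewrite !Rabs_mult.
    assert (i1 := Rmult_le_compat _ _ _ _ (Rabs_pos _) (Rabs_pos _) hc hxx).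
    assert (i2 := Rmult_le_compat _ _ _ _ (Rabs_pos _) (Rabs_pos _) hcc hx').
    lra. }
  assert (j1 := hcoef _ _ _ _ Kd hKd (bd mu t hmu ht) (ld mu mu' t hmu hmu' ht) sc sc').
  assert (j2 := hcoef _ _ _ _ Km hKm (bm mu t hmu ht) (lm mu mu' t hmu hmu' ht) cc cc').
  match goal with |- Rabs (?s1 + (- ?b1 + ?m1) - (?s2 + (- ?b2 + ?m2))) <= _ =>
    replace (s1 + (- b1 + m1) - (s2 + (- b2 + m2)))
      with ((s1 - s2) + (- (b1 - b2) + (m1 - m2))) by ring end.
  eapply Rle_trans; [apply Rabs_triang |].
  eapply Rle_trans; [apply Rplus_le_compat_l, Rabs_triang |].
  rewrite Rabs_Ropp; unfold C, X; lra. }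
assert (hC0 : 0 <= C) by (unfold C; lra).
assert (hg := gronwall (fun t => (angle mu t - angle mu' t) ^ 2)
  (fun t => 2 * (angle mu t - angle mu' t) * (angular_rate mu t - angular_rate mu' t))
  (2 * C + 1) ((X * dm) ^ 2) start s (proj1 hs) ltac:(lra) (pow2_ge_0 _)).
eapply Rle_trans; [apply hg |].
- intros t ht; evar_last.
  + apply is_derive_pow; apply (is_derive_minus (angle mu) (angle mu'));
      now apply angle_derive.
  + unfold minus, plus, opp; simpl; ring.
- intros t ht; specialize (hrate t ltac:(lra)).
  set (u := angle mu t - angle mu' t) in *.
  set (r := angular_rate mu t - angular_rate mu' t) in *.
  assert (h2 : u * r <= Rabs u * (C * Rabs u + X * dm)).
  { apply Rle_trans with (Rabs u * Rabs r).
    - rewrite <- Rabs_mult; apply Rle_abs.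
    - apply Rmult_le_compat_l; [apply Rabs_pos | exact hrate]. }
  rewrite <- (pow2_abs u); generalize (pow2_ge_0 (Rabs u - X * dm)); lra.
- rewrite <- (pow2_abs (mu - mu')); fold dm.
  assert (s1 : (angle mu start - angle mu' start) ^ 2 <= (500 * dm) ^ 2).
  { rewrite <- pow2_abs; apply pow_incr; split; [apply Rabs_pos |].
    now apply angle_start_lipschitz. }
  assert (s3 : (X * dm) ^ 2 * (s - start) <= (X * dm) ^ 2 * (T - start))
    by (apply Rmult_le_compat_l; [apply pow2_ge_0 | lra]).
  assert (s4 : exp ((2 * C + 1) * (s - start)) <= E)
    by (apply exp_le, Rmult_le_compat_l; lra).
  apply Rle_trans with (((500 * dm) ^ 2 + (X * dm) ^ 2 * (T - start)) * E).
  + apply Rmult_le_compat; [| left; apply exp_pos | lra | exact s4].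
    assert (0 <= (X * dm) ^ 2 * (s - start))
      by (apply Rmult_le_pos; [apply pow2_ge_0 | lra]).
    generalize (pow2_ge_0 (angle mu start - angle mu' start)); lra.
  + unfold K2; right; ring.
Qed.

End CentreFamily.

(** * Winding and matching *)

Lemma intermediate_value (f : R -> R) l u y :
  l <= u -> (forall x, l <= x <= u -> continuity_pt f x) ->
  Rmin (f l) (f u) <= y <= Rmax (f l) (f u) -> exists x, l <= x <= u /\ f x = y.
Proof.
intros hlu hf hy.
destruct (IVT_gen (fun x => f (clamp l u x)) l u y) as [x [hx he]].
- intros x; apply continuity_pt_filterlim.
  apply (continuous_comp (clamp l u) f); [apply clamp_continuous |].
  apply continuity_pt_filterlim, hf, clamp_bounds, hlu.
- rewrite !clamp_id by lra; exact hy.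
- rewrite Rmin_left, Rmax_right in hx by exact hlu.
  rewrite clamp_id in he by exact hx; now exists x.
Qed.

Section Winding.

Variables (N a h : R) (W P : R -> R -> R).
Hypothesis hN : 2 <= N <= 7.
Hypothesis ha : 0 < a.
Hypothesis hak : stiffness N * a ^ 3 = 1.
Hypothesis hh : 0 < h < 1.
Hypothesis hWP : centre_family N h W P.
Variable s0 : R.

Lemma scale_range l : 0 <= l -> 0 <= exp (-2 * l) <= 1.
Proof.
intros hl; split; [left; apply exp_pos |].
rewrite <- exp_0; apply exp_le; lra.
Qed.

(** With [mu = exp (-2 l)], [sg = l + s0] is the point [eta = exp s0] for every [l]:
    the family is observed at a fixed [eta] as the initial value varies. *)
Lemma along_family_continuous (U : R -> R -> R) l :
  (forall T, start <= T -> exists K, 0 <= K /\ forall mu mu' s, 0 <= mu <= 1 ->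
     0 <= mu' <= 1 -> start <= s <= T ->
     Rabs (U mu s - U mu' s) <= K * Rabs (mu - mu')) ->
  (forall mu s, 0 <= mu <= 1 -> continuous (U mu) s) ->
  0 < l -> start < l + s0 ->
  continuity_pt (fun l => U (exp (-2 * l)) (l + s0)) l.
Proof.
intros hlip hcont hl hs.
destruct (hlip (l + s0 + 1) ltac:(lra)) as (K & hK & hU).
apply continuity_pt_filterlim, filterlim_locally; intros eps.
assert (heps := cond_pos eps).
assert (c1 : locally l (fun z => Rabs (U (exp (-2 * l)) (z + s0)
                                       - U (exp (-2 * l)) (l + s0)) < eps / 2)).
{ assert (hc : continuous (fun z => U (exp (-2 * l)) (z + s0)) l).
  { apply (continuous_comp (fun z => z + s0) (U (exp (-2 * l)))).
    - apply (ex_derive_continuous (fun z => z + s0)); auto_derive; easy.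
    - apply hcont, scale_range; lra. }
  apply (proj1 (filterlim_locally _ _) hc (mkposreal (eps / 2) ltac:(lra))). }
assert (c2 : locally l (fun z => Rabs (exp (-2 * z) - exp (-2 * l)) < eps / (2 * (K + 1)))).
{ assert (hc : continuous (fun z => exp (-2 * z)) l)
    by (apply (ex_derive_continuous (fun z => exp (-2 * z))); auto_derive; easy).
  assert (he : 0 < eps / (2 * (K + 1))) by (apply Rdiv_lt_0_compat; lra).
  apply (proj1 (filterlim_locally _ _) hc (mkposreal _ he)). }
assert (c3 : locally l (fun z => Rabs (z - l) < Rmin 1 (Rmin l (l + s0 - start)))).
{ assert (he : 0 < Rmin 1 (Rmin l (l + s0 - start))) by (repeat apply Rmin_glb_lt; lra).
  exists (mkposreal _ he); intros z hz; exact hz. }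
generalize (filter_and _ _ c1 (filter_and _ _ c2 c3)); apply filter_imp.
intros z (h1 & h2 & h3).
change (Rabs (U (exp (-2 * z)) (z + s0) - U (exp (-2 * l)) (l + s0)) < eps).
assert (m1 := Rmin_l 1 (Rmin l (l + s0 - start))).
assert (m2 := Rmin_r 1 (Rmin l (l + s0 - start))).
assert (m3 := Rmin_l l (l + s0 - start)); assert (m4 := Rmin_r l (l + s0 - start)).
apply Rabs_lt_between in h3.
assert (hz : Rabs (U (exp (-2 * z)) (z + s0) - U (exp (-2 * l)) (z + s0))
  <= K * Rabs (exp (-2 * z) - exp (-2 * l)))
  by (apply hU; [apply scale_range; lra | apply scale_range; lra | lra]).
assert (hK2 : K * Rabs (exp (-2 * z) - exp (-2 * l)) <= eps / 2).
{ apply Rle_trans with ((K + 1) * (eps / (2 * (K + 1)))); [| right; field; lra].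
  apply Rmult_le_compat; [exact hK | apply Rabs_pos | lra | lra]. }
replace (U (exp (-2 * z)) (z + s0) - U (exp (-2 * l)) (l + s0))
  with ((U (exp (-2 * z)) (z + s0) - U (exp (-2 * l)) (z + s0))
        + (U (exp (-2 * l)) (z + s0) - U (exp (-2 * l)) (l + s0))) by ring.
eapply Rle_lt_trans; [apply Rabs_triang |]; lra.
Qed.

Lemma along_angle_continuous l :
  0 < l -> start < l + s0 ->
  continuity_pt (fun l => angle N a h W P (exp (-2 * l)) (l + s0)) l.
Proof.
apply along_family_continuous.
- intros T hT; now apply angle_lipschitz.
- intros mu s hmu; apply (derive_continuous _ _ (angular_rate N a h W P mu s)).
  now apply angle_derive.
Qed.

Lemma along_position_continuous l :
  0 < l -> start < l + s0 ->
  continuity_pt (fun l => W (exp (-2 * l)) (l + s0)) l /\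
  continuity_pt (fun l => P (exp (-2 * l)) (l + s0)) l.
Proof.
intros hl hs; split; apply along_family_continuous; try assumption.
- intros T hT.
  destruct (family_lipschitz N hN a ha hak h hh W P hWP T hT) as [(K & hK & _ & l1) _].
  exists K; auto.
- intros mu s hmu; apply (derive_continuous _ _ (P mu s)).
  now apply (family_derive N h W P hWP).
- intros T hT.
  destruct (family_lipschitz N hN a ha hak h hh W P hWP T hT) as [_ (K & hK & _ & l1)].
  exists K; auto.
- intros mu s hmu; apply (derive_continuous _ _ (cut_acc N h mu s (W mu s) (P mu s))).
  now apply (family_derive N h W P hWP).
Qed.

Lemma angle_growth mu r s t :
  0 <= mu <= 1 -> start <= s -> s <= t ->
  (forall u, s <= u <= t -> r <= angular_rate N a h W P mu u) ->
  angle N a h W P mu s + r * (t - s) <= angle N a h W P mu t.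
Proof.
intros hmu hs hst hr.
enough (angle N a h W P mu s - r * s <= angle N a h W P mu t - r * t) by lra.
apply (derive_nondecreasing (fun u => angle N a h W P mu u - r * u)
  (fun u => angular_rate N a h W P mu u - r)); [exact hst | |].
- intros u hu; evar_last.
  + apply (is_derive_minus (angle N a h W P mu) (fun u => r * u));
      [now apply angle_derive | apply is_derive_scal, (@is_derive_id R_AbsRing)].
  + unfold minus, plus, opp, one; simpl; ring.
- intros u hu; generalize (hr u hu); lra.
Qed.

(** Near the singular solution the angle advances at a definite rate, for a
    stretch of [ln eta] whose length tends to infinity as the initial value
    tends to zero; elsewhere it cannot retreat by more than a fixed amount. *)
Lemma angle_unbounded B :
  exists l0, forall l, l0 <= l -> B <= angle N a h W P (exp (-2 * l)) (l + s0).
Proof.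
destruct (angular_rate_near N hN a ha hak h hh W P hWP) as (dl & x0 & hdl & hx0 & hrate).
destruct (family_near_equilibrium N hN a ha hak h hh W P hWP dl hdl)
  as (sg0 & mu0 & hsg & hmu0 & hnear).
set (u1 := Rmin s0 (ln x0 / 2)).
assert (hu1 : u1 <= s0) by apply Rmin_l.
assert (hu2 : exp (2 * u1) <= x0).
{ rewrite <- (exp_ln x0) by exact hx0; apply exp_le.
  generalize (Rmin_r s0 (ln x0 / 2)); fold u1; lra. }
assert (hsp := spin_pos N hN); set (r := spin N / 2).
assert (hr : 0 < r) by (unfold r; lra).
set (C := 7 / (1 - h)).
assert (hC : 0 < C) by (apply Rdiv_lt_0_compat; lra).
set (lm := Rmax 0 (Rmax (sg0 - u1) (- ln mu0 / 2))).
set (lB := (B + 2 + C * (sg0 - start) + C * (s0 - u1)) / r + sg0 - u1).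
exists (Rmax lm lB); intros l hl.
assert (hl1 : lm <= l) by (generalize (Rmax_l lm lB); lra).
assert (hl2 : lB <= l) by (generalize (Rmax_r lm lB); lra).
assert (m1 := Rmax_l 0 (Rmax (sg0 - u1) (- ln mu0 / 2))).
assert (m2 := Rmax_r 0 (Rmax (sg0 - u1) (- ln mu0 / 2))).
assert (m3 := Rmax_l (sg0 - u1) (- ln mu0 / 2)).
assert (m4 := Rmax_r (sg0 - u1) (- ln mu0 / 2)).
fold lm in m1, m2.
set (mu := exp (-2 * l)).
assert (hmu : 0 <= mu <= 1) by (apply scale_range; lra).
assert (hmu2 : mu <= mu0).
{ unfold mu; rewrite <- (exp_ln mu0) by lra; apply exp_le; lra. }
assert (g1 := angle_growth mu (- C) start sg0 hmu ltac:(lra) hsg).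
assert (g2 := angle_growth mu r sg0 (l + u1) hmu hsg ltac:(lra)).
assert (g3 := angle_growth mu (- C) (l + u1) (l + s0) hmu ltac:(lra) ltac:(lra)).
assert (k1 : angle N a h W P mu start + - C * (sg0 - start) <= angle N a h W P mu sg0).
{ apply g1; intros u hu; apply angular_rate_lower; auto; lra. }
assert (k2 : angle N a h W P mu sg0 + r * (l + u1 - sg0) <= angle N a h W P mu (l + u1)).
{ apply g2; intros u hu; apply hrate; [exact hmu | lra | |].
  - apply hnear; lra.
  - unfold cap; eapply Rle_trans; [apply Rmin_l |].
    unfold mu; rewrite <- exp_plus; eapply Rle_trans; [| exact hu2].
    apply exp_le; lra. }
assert (k3 : angle N a h W P mu (l + u1) + - C * (l + s0 - (l + u1))
             <= angle N a h W P mu (l + s0)).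
{ apply g3; intros u hu; apply angular_rate_lower; auto; lra. }
assert (k0 : -2 <= angle N a h W P mu start).
{ rewrite angle_start.
  destruct (atan_bound (P mu start / (W mu start - a))) as [_ hat].
  generalize PI_4; lra. }
assert (hrl : r * (lB + u1 - sg0) = B + 2 + C * (sg0 - start) + C * (s0 - u1)).
{ unfold lB; field; lra. }
assert (r * (lB + u1 - sg0) <= r * (l + u1 - sg0)) by (apply Rmult_le_compat_l; lra).
lra.
Qed.

Lemma family_at_angle mu sg th j :
  0 <= mu <= 1 -> angle N a h W P mu sg = th + 2 * INR j * PI ->
  W mu sg - a = sqrt (radius2 a W P mu sg) * cos th /\
  P mu sg = - sqrt (radius2 a W P mu sg) * sin th.
Proof.
intros hmu he; destruct (family_polar N hN a ha hak h hh W P hWP mu sg hmu) as [h1 h2].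
rewrite he, cos_period in h1; rewrite he, sin_period in h2; now split.
Qed.

(** Where the angle is [PI / 2] modulo [2 * PI] the point [(W - a, P)] lies below the
    origin, hence below the graph; where it is [3 * PI / 2] it lies above.  Both
    values are attained beyond any [l0], because the angle is continuous and
    unbounded in [l]. *)
Lemma spiral_meets_graph (G : R -> R) K l0 :
  0 <= K -> (forall y z, Rabs (G y - G z) <= K * Rabs (y - z)) -> G 0 = 0 ->
  0 < l0 -> start < l0 + s0 ->
  exists l, l0 <= l /\ P (exp (-2 * l)) (l + s0) = G (W (exp (-2 * l)) (l + s0) - a).
Proof.
intros hK hG hG0 hl0 hs0.
set (th := fun l => angle N a h W P (exp (-2 * l)) (l + s0)).
assert (hth : forall l, l0 <= l -> continuity_pt th l)
  by (intros l hl; apply along_angle_continuous; lra).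
assert (hpi := PI_RGT_0).
destruct (INR_unbounded (Rabs (th l0))) as [j hj].
assert (hj2 : th l0 <= PI / 2 + 2 * INR j * PI).
{ assert (h1 := Rle_abs (th l0)); assert (h2 := pos_INR j).
  assert (1 <= PI) by (generalize PI2_1; lra); nra. }
destruct (angle_unbounded (3 * (PI / 2) + 2 * INR j * PI)) as [l1 hl1].
set (l2 := Rmax l0 l1).
assert (hl2 : l0 <= l2) by apply Rmax_l.
assert (ht2 : 3 * (PI / 2) + 2 * INR j * PI <= th l2) by (apply hl1, Rmax_r).
destruct (intermediate_value th l0 l2 (PI / 2 + 2 * INR j * PI) hl2) as (la & hla & ea).
{ intros x hx; apply hth; lra. }
{ rewrite Rmin_left, Rmax_right by lra; lra. }
destruct (intermediate_value th la l2 (3 * (PI / 2) + 2 * INR j * PI)) as (lb & hlb & eb).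
{ lra. }
{ intros x hx; apply hth; lra. }
{ rewrite ea, Rmin_left, Rmax_right by lra; lra. }
set (D := fun l => P (exp (-2 * l)) (l + s0) - G (W (exp (-2 * l)) (l + s0) - a)).
assert (hD : forall l, l0 <= l -> continuity_pt D l).
{ intros l hl; destruct (along_position_continuous l) as [cW cP]; [lra | lra |].
  apply continuity_pt_minus; [exact cP |].
  apply continuity_pt_filterlim.
  apply (continuous_comp (fun l => W (exp (-2 * l)) (l + s0) - a) G).
  - apply (continuous_minus (fun l => W (exp (-2 * l)) (l + s0)) (fun _ => a)).
    + apply continuity_pt_filterlim; exact cW.
    + apply continuous_const.
  - now apply (lipschitz_continuous _ K). }
assert (hr : forall l, l0 <= l -> 0 < sqrt (radius2 a W P (exp (-2 * l)) (l + s0))).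
{ intros l hl; apply sqrt_lt_R0, (radius2_pos N hN a ha hak h hh W P hWP).
  apply scale_range; lra. }
assert (hDa : D la < 0).
{ destruct (family_at_angle (exp (-2 * la)) (la + s0) (PI / 2) j) as [e1 e2];
    [apply scale_range; lra | exact ea |].
  unfold D; rewrite e1, e2, cos_PI2, sin_PI2, Rmult_0_r, hG0.
  generalize (hr la ltac:(lra)); lra. }
assert (hDb : 0 < D lb).
{ destruct (family_at_angle (exp (-2 * lb)) (lb + s0) (3 * (PI / 2)) j) as [e1 e2];
    [apply scale_range; lra | exact eb |].
  unfold D; rewrite e1, e2, cos_3PI2, sin_3PI2, Rmult_0_r, hG0.
  generalize (hr lb ltac:(lra)); lra. }
destruct (intermediate_value D la lb 0) as (l & hl & el).
{ lra. }
{ intros x hx; apply hD; lra. }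
{ rewrite Rmin_left, Rmax_right by lra; lra. }
exists l; split; [lra |]; unfold D in el; lra.
Qed.

End Winding.

(** ** The graph of regular solutions at the light cone *)

Section ConeGraph.

Variables (N a : R).
Hypothesis hN : 2 <= N <= 7.
Hypothesis ha : 0 < a.
Hypothesis hD : forall m, 1 / 24 * (INR m + 1) ^ 2
  <= Rabs ((INR m + 1) * (INR m + - ((damping N - 1) / 2))).

(** [eta = match_point] is where the two families are matched; it corresponds to
    [t = match_t], so close to the cone that [cone_fun s match_t] is strictly
    increasing in [s]. *)
Definition match_t : R := - (cone_radius / 1000).
Definition match_point : R := / (1 - match_t).

Lemma match_t_bounds : - (1 / 1000) < match_t < 0.
Proof. unfold match_t; rewrite cone_radius_eq; lra. Qed.

Lemma match_point_bounds : 1 / 2 < match_point < 1.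
Proof.
assert (h := match_t_bounds); unfold match_point; split.
- replace (1 / 2) with (/ 2) by field; apply Rinv_lt_contravar; lra.
- rewrite <- Rinv_1; apply Rinv_lt_contravar; lra.
Qed.

Lemma cone_fun_increments s s' :
  1 / 2 <= s <= 2 -> 1 / 2 <= s' <= 2 ->
  Rabs (cone_fun N s match_t - cone_fun N s' match_t - (s - s')) <= 1 / 5 * Rabs (s - s').
Proof.
intros hs hs'.
assert (ht : Rabs match_t = cone_radius / 1000).
{ unfold match_t; rewrite Rabs_Ropp, Rabs_pos_eq; rewrite ?cone_radius_eq; lra. }
eapply Rle_trans; [apply cone_fun_lipschitz; auto; rewrite ht, cone_radius_eq; lra |].
rewrite ht, cone_radius_eq; right; field.
Qed.

(** This inverse makes the Cauchy data at [match_point] of the solutions regular at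
    the cone a graph over their first component. *)
Lemma cone_inverse :
  exists S : R -> R, S 0 = 1 /\
    (forall q, Rabs q <= a / 20 ->
       9 / 10 <= S q <= 11 / 10 /\ a * cone_fun N (S q) match_t - a = q) /\
    (forall q q', Rabs q <= a / 20 -> Rabs q' <= a / 20 ->
       Rabs (S q - S q') <= 2 / a * Rabs (q - q')).
Proof.
assert (h1 : 1 / 2 <= 1 <= 2) by lra.
destruct (cone_equilibrium N hN hD match_t) as [he _].
assert (hex : forall q, exists s, Rabs q <= a / 20 ->
  9 / 10 <= s <= 11 / 10 /\ a * cone_fun N s match_t - a = q).
{ intros q; destruct (Rle_dec (Rabs q) (a / 20)) as [hq|hq]; [| now exists 0].
  assert (hqa : Rabs (q / a) <= 1 / 20).
  { unfold Rdiv; rewrite Rabs_mult, (Rabs_pos_eq (/ a))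
      by (left; now apply Rinv_0_lt_compat).
    apply (Rmult_le_reg_r a); [exact ha |].
    rewrite Rmult_assoc, Rinv_l by lra; lra. }
  apply Rabs_le_between in hqa.
  assert (b1 : Rabs (cone_fun N (9 / 10) match_t - 1 - (9 / 10 - 1)) <= 1 / 5 * (1 / 10)).
  { rewrite <- he at 1; eapply Rle_trans; [apply cone_fun_increments; lra |].
    right; f_equal; rewrite Rabs_left; lra. }
  assert (b2 : Rabs (cone_fun N (11 / 10) match_t - 1 - (11 / 10 - 1)) <= 1 / 5 * (1 / 10)).
  { rewrite <- he at 1; eapply Rle_trans; [apply cone_fun_increments; lra |].
    right; f_equal; rewrite Rabs_pos_eq; lra. }
  apply Rabs_le_between in b1, b2.
  destruct (intermediate_value (fun s => cone_fun N s match_t) (9 / 10) (11 / 10) (1 + q / a))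
    as (s & hs & es).
  - lra.
  - intros s hs.
    apply (continuity_pt_ext_loc
      (fun s => cone_fun N (clamp (1 / 2) 2 s) match_t)).
    + assert (q1 : 1 / 2 < s) by lra; assert (q2 : s < 2) by lra.
      generalize (filter_and _ _ (open_gt (1 / 2) s q1) (open_lt 2 s q2)).
      apply filter_imp; intros z hz; now rewrite clamp_id by lra.
    + apply continuity_pt_filterlim.
      apply (lipschitz_continuous (fun s => cone_fun N (clamp (1 / 2) 2 s) match_t) 2); [lra |].
      intros y z.
      assert (by_ := clamp_bounds (1 / 2) 2 y ltac:(lra)).
      assert (bz := clamp_bounds (1 / 2) 2 z ltac:(lra)).
      assert (hi := cone_fun_increments _ _ by_ bz).
      assert (hc : Rabs (clamp (1 / 2) 2 y - clamp (1 / 2) 2 z) <= Rabs (y - z)).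
      { unfold clamp; eapply Rle_trans; [apply Rmax_lipschitz | apply Rmin_lipschitz]. }
      set (d := clamp (1 / 2) 2 y - clamp (1 / 2) 2 z) in *.
      replace (cone_fun N (clamp (1 / 2) 2 y) match_t - cone_fun N (clamp (1 / 2) 2 z) match_t)
        with ((cone_fun N (clamp (1 / 2) 2 y) match_t
               - cone_fun N (clamp (1 / 2) 2 z) match_t - d) + d) by ring.
      eapply Rle_trans; [apply Rabs_triang |]; generalize (Rabs_pos d); lra.
  - rewrite Rmin_left, Rmax_right by lra; lra.
  - exists s; intros _; split; [exact hs |]; rewrite es; field; lra. }
destruct (functional_choice _ hex) as [S hS].
assert (hlip : forall s s', 9 / 10 <= s <= 11 / 10 -> 9 / 10 <= s' <= 11 / 10 ->
  Rabs (s - s') <= 2 / a * Rabs (a * cone_fun N s match_t - a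
                                 - (a * cone_fun N s' match_t - a))).
{ intros s s' hs hs'.
  assert (hi := cone_fun_increments s s' ltac:(lra) ltac:(lra)).
  set (f := cone_fun N s match_t - cone_fun N s' match_t) in *.
  replace (a * cone_fun N s match_t - a - (a * cone_fun N s' match_t - a))
    with (a * f) by (unfold f; ring).
  rewrite Rabs_mult, (Rabs_pos_eq a) by lra.
  replace (2 / a * (a * Rabs f)) with (2 * Rabs f) by (field; lra).
  assert (ht : Rabs (s - s') <= Rabs (s - s' - f) + Rabs f).
  { replace (s - s') with ((s - s' - f) + f) at 1 by ring; apply Rabs_triang. }
  rewrite (Rabs_minus_sym (s - s') f) in ht; generalize (Rabs_pos (s - s')); lra. }
assert (hz : Rabs 0 <= a / 20) by (rewrite Rabs_R0; lra).
exists S; split; [| split].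
- destruct (hS 0 hz) as [s1 s2].
  assert (h := hlip (S 0) 1 s1 ltac:(lra)).
  rewrite s2, he in h.
  replace (0 - (a * 1 - a)) with 0 in h by ring.
  rewrite Rabs_R0, Rmult_0_r in h.
  assert (h' := Rabs_pos (S 0 - 1)).
  assert (h2 : Rabs (S 0 - 1) = 0) by lra.
  destruct (Req_dec (S 0 - 1) 0) as [h3|h3]; [lra |].
  now apply Rabs_no_R0 in h3.
- exact hS.
- intros q q' hq hq'; destruct (hS q hq) as [s1 s2]; destruct (hS q' hq') as [s1' s2'].
  assert (h := hlip (S q) (S q') s1 s1'); now rewrite s2, s2' in h.
Qed.

End ConeGraph.

(** * Assembling the global solutions *)

Section Assembly.

Variables (N a : R).
Hypothesis hN : 2 <= N <= 7.
Hypothesis ha : 0 < a.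
Hypothesis hak : stiffness N * a ^ 3 = 1.
Hypothesis hD : forall m, 1 / 24 * (INR m + 1) ^ 2
  <= Rabs ((INR m + 1) * (INR m + - ((damping N - 1) / 2))).

(** A level between [match_point] and [1], so that the cap is inactive on a
    neighbourhood of [match_point]. *)
Definition cap_level : R := (1 + match_point) / 2.

Lemma cap_level_bounds : match_point < cap_level < 1.
Proof. generalize match_point_bounds; unfold cap_level; lra. Qed.

Lemma cap_level_range : 0 < cap_level < 1.
Proof. generalize match_point_bounds cap_level_bounds; lra. Qed.

Variables W P : R -> R -> R.
Hypothesis hWP : centre_family N cap_level W P.

Definition log_match : R := ln match_point.

(** The member of the family with [c = exp (- (2 / 3) * l)], that is [mu = exp (-2 * l)],
    in the original variables. *)
Definition middle (l x : R) : R := Rpower x (2 / 3) * W (exp (-2 * l)) (ln x + l).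

Lemma ln_shift_derive l x : 0 < x -> is_derive (fun y => ln y + l) x (/ x).
Proof. intros hx; auto_derive; [exact hx | field; lra]. Qed.

Lemma is_derive_comp_inv (f u : R -> R) x f1 :
  is_derive f (u x) f1 -> is_derive u x (/ x) -> is_derive (fun y => f (u y)) x (f1 / x).
Proof.
intros hf hu; unfold Rdiv; rewrite Rmult_comm; exact (is_derive_comp f u x f1 (/ x) hf hu).
Qed.

Lemma middle_derive l x :
  0 <= l -> 0 < x ->
  is_derive (middle l) x
    (Rpower x (2 / 3) * (P (exp (-2 * l)) (ln x + l) / x
                         + 2 / 3 * W (exp (-2 * l)) (ln x + l) / x)).
Proof.
intros hl hx; apply (scaled_derive (fun y => W (exp (-2 * l)) (ln y + l))); [exact hx |].
apply (is_derive_comp_inv (W (exp (-2 * l))) (fun y => ln y + l)).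
- exact (proj1 (family_derive N cap_level W P hWP _ _ (scale_range l hl))).
- exact (ln_shift_derive l x hx).
Qed.

Lemma middle_smooth_profile l x :
  0 <= l -> 0 < x -> start <= ln x + l -> x ^ 2 < cap_level ->
  smooth_profile_at N (middle l) x.
Proof.
intros hl hx hs hx2; set (mu := exp (-2 * l)).
assert (hmu : 0 <= mu <= 1) by now apply scale_range.
assert (hcl := cap_level_range).
assert (hfam := fun s => family_derive N cap_level W P hWP mu s hmu).
set (w := fun y => W mu (ln y + l)).
set (p := fun y => P mu (ln y + l)).
set (acc := fun y => cut_acc N cap_level mu (ln y + l) (w y) (p y)).
(* Past the starting point the cut is inactive; an open neighbourhood suffices. *)
set (I := fun y => 0 < y /\ (y ^ 2 < cap_level /\ floor_value < w y)).
assert (dw : forall y, 0 < y -> is_derive w y (p y / y)).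
{ intros y hy; apply (is_derive_comp_inv (W mu) (fun y => ln y + l));
    [exact (proj1 (hfam _)) | exact (ln_shift_derive l y hy)]. }
assert (dp : forall y, 0 < y -> is_derive p y (acc y / y)).
{ intros y hy; apply (is_derive_comp_inv (P mu) (fun y => ln y + l));
    [exact (proj2 (hfam _)) | exact (ln_shift_derive l y hy)]. }
assert (hI : open I).
{ intros y (y1 & y2 & y3); apply filter_and; [now apply (open_gt 0 y) |].
  apply filter_and.
  - assert (hc : continuous (fun z => z ^ 2) y)
      by (apply (ex_derive_continuous (fun z => z ^ 2)); auto_derive; easy).
    apply (hc (fun z => z < cap_level)); now apply open_lt.
  - assert (hc := derive_continuous w y _ (dw y y1)).
    apply (hc (fun z => floor_value < z)); now apply open_gt. }
assert (hfl := floor_pos).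
apply (scaled_smooth_profile N w (fun y => p y / y)
  (fun y => (acc y - p y) / y ^ 2) I hI).
- intros y (y1 & y2 & y3); split; [exact y1 | lra].
- intros y (y1 & _); now apply dw.
- intros y (y1 & y2 & y3); evar_last.
  + apply (is_derive_div p (fun z => z)); [now apply dp
      | apply (@is_derive_id R_AbsRing) | lra].
  + unfold one; simpl; field; lra.
- intros y (y1 & y2 & y3); unfold scaled_ode.
  assert (hcap : cap cap_level mu (ln y + l) = y ^ 2).
  { unfold cap, mu; rewrite <- exp_plus.
    replace (-2 * l + 2 * (ln y + l)) with (ln y + ln y) by ring.
    rewrite exp_plus, exp_ln, Rmin_left by lra; ring. }
  unfold acc, cut_acc, drag; rewrite hcap, cut_force_eq by lra.
  assert (1 - y ^ 2 <> 0) by lra.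
  field; repeat split; lra.
- intros y (y1 & y2 & y3) he; rewrite he in y2; lra.
- split; [exact hx |]; split; [exact hx2 |].
  apply (family_above_floor N hN cap_level hcl W P hWP mu _ hmu hs).
Qed.

(** Consecutive pieces have the same Cauchy data at one point, so by uniqueness they
    coincide on an interval; the seams are placed inside these intervals, where
    gluing preserves smoothness. *)
Lemma matched_profile l s (v3 : R -> R) b :
  0 <= l -> start + 1 <= l + log_match ->
  1 / 2 <= s <= 2 ->
  W (exp (-2 * l)) (l + log_match) = a * cone_fun N s match_t ->
  P (exp (-2 * l)) (l + log_match) = a * (1 - match_t) * cone_der N s match_t ->
  (forall x, 0 < x -> Rabs (1 - / x) < cone_radius \/ 1 < x ->
     smooth_profile_at N v3 x) ->
  (forall x, 0 < x -> 1 - / x < cone_radius / 4 ->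
     v3 x = Rpower x (2 / 3) * (a * cone_fun N s (1 - / x))) ->
  is_lim (fun x => v3 x / (b * Rpower x (2 / 3))) p_infty 1 ->
  exists v : R -> R,
    (forall x, 0 <= x -> smooth_profile_at N v x) /\
    v 0 = exp (- (2 / 3) * l) /\ Derive v 0 = 0 /\
    is_lim (fun x => v x / (b * Rpower x (2 / 3))) p_infty 1 /\
    (forall x, exp (start - l) <= x <= match_point -> v x = middle l x).
Proof.
intros hl hlm hs hW hP h3 h3c h3l.
set (mu := exp (-2 * l)) in *.
assert (hmu : 0 <= mu <= 1) by now apply scale_range.
set (c := exp (- (2 / 3) * l)).
assert (hc3 : c ^ 3 = mu).
{ unfold c, mu; rewrite <- Rpower_pow by apply exp_pos; unfold Rpower.
  rewrite ln_exp; f_equal; simpl; field. }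
assert (hc : 0 < c <= 1).
{ split; [apply exp_pos |]; unfold c; rewrite <- exp_0; apply exp_le; lra. }
assert (hmu0 : 0 < mu) by apply exp_pos.
assert (hmp := match_point_bounds); assert (hcl := cap_level_bounds).
assert (hmt := match_t_bounds).
set (v1 := fun y => c * PSeries (centre_coef N (c ^ 3)) (y ^ 2 / c ^ 3)).
set (xa := exp (start - l)).
assert (hxa : 0 < xa) by apply exp_pos.
assert (hxa2 : xa ^ 2 = mu * (1 / 96)).
{ rewrite <- exp_start; unfold xa, mu; rewrite <- exp_plus; simpl; rewrite Rmult_1_r.
  rewrite <- exp_plus; f_equal; ring. }
assert (hlnxa : ln xa = start - l) by apply ln_exp.
assert (hxm : 11 / 10 * xa <= match_point).
{ unfold xa; apply Rle_trans with (11 / 10 * exp (log_match - 1)).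
  - apply Rmult_le_compat_l; [lra |]; apply exp_le; lra.
  - unfold Rminus; rewrite exp_plus; unfold log_match; rewrite exp_ln by lra.
    assert (he : exp (- (1)) <= / 2).
    { rewrite exp_Ropp; apply Rinv_le_contravar; [lra |].
      generalize (exp_ineq1 1 ltac:(lra)); lra. }
    apply Rle_trans with (match_point * (11 / 10 * / 2)); [nra |]; nra. }
assert (hv1 : forall x, 0 <= x <= 11 / 10 * xa -> smooth_profile_at N v1 x /\
   Derive v1 x = c * PSeries (PS_derive (centre_coef N (c ^ 3))) (x ^ 2 / c ^ 3)
                 * (2 * x / c ^ 3)).
{ intros x hx; apply (centre_smooth_profile N hN c x hc).
  rewrite hc3; apply Rlt_div_l; [lra |].
  apply Rle_lt_trans with ((11 / 10 * xa) ^ 2); [apply pow_incr; lra |].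
  rewrite Rpow_mult_distr, hxa2; lra. }
assert (hv2 : forall x, xa <= x <= cap_level -> smooth_profile_at N (middle l) x).
{ intros x hx; apply middle_smooth_profile; [exact hl | lra | |].
  - assert (h : ln xa <= ln x).
    { destruct (Req_dec xa x) as [->|hne]; [lra |]; left; apply ln_increasing; lra. }
    lra.
  - assert (0 < (1 - x) * x) by (apply Rmult_lt_0_compat; lra); simpl; lra. }
assert (hRxa : Rpower xa (2 / 3) * start_scale = c).
{ unfold Rpower, start_scale, c; rewrite hlnxa, <- exp_plus; f_equal; field. }
destruct (hWP mu hmu) as (hW0 & hP0 & _).
assert (heq12 : forall x, xa <= x <= 11 / 10 * xa -> v1 x = middle l x).
{ apply (smooth_profile_unique N); [exact hxa | lra | left; lra | | | |].
  - intros x hx; apply hv1; lra.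
  - intros x hx; apply hv2; lra.
  - unfold v1, middle; fold mu; rewrite hc3, hxa2, hlnxa.
    replace (start - l + l) with start by ring; rewrite hW0; unfold start_val.
    replace (mu * (1 / 96) / mu) with (1 / 96) by (field; lra).
    rewrite <- hRxa; ring.
  - rewrite (proj2 (hv1 xa ltac:(lra))).
    rewrite (is_derive_unique _ _ _ (middle_derive l xa hl hxa)); fold mu.
    rewrite hc3, hxa2, hlnxa.
    replace (start - l + l) with start by ring; rewrite hW0, hP0.
    unfold start_val, start_der.
    replace (mu * (1 / 96) / mu) with (1 / 96) by (field; lra).
    set (f := PSeries (centre_coef N mu) (1 / 96)).
    set (f1 := PSeries (PS_derive (centre_coef N mu)) (1 / 96)).
    replace (2 * xa / mu) with (2 * (1 / 96) / xa).
    2: { replace mu with (96 * xa ^ 2) by (rewrite hxa2; field); field; lra. }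
    rewrite <- hRxa; field; lra. }
assert (hmi : / match_point = 1 - match_t) by (unfold match_point; apply Rinv_inv).
assert (heq23 : forall x, match_point <= x <= cap_level -> middle l x = v3 x).
{ assert (h3r : forall x, match_point <= x <= cap_level ->
    Rabs (1 - / x) < cone_radius /\ 1 - / x < cone_radius / 4).
  { intros x hx.
    assert (i1 : / x <= / match_point) by (apply Rinv_le_contravar; lra).
    assert (i2 : 1 < / x) by (rewrite <- Rinv_1; apply Rinv_lt_contravar; lra).
    unfold match_t in *; rewrite cone_radius_eq in *.
    split; [apply Rabs_def1; lra | lra]. }
  assert (hwm : a * cone_fun N s (1 - / match_point) = W mu (l + log_match)).
  { rewrite hmi; replace (1 - (1 - match_t)) with match_t by ring; now symmetry. }
  apply (smooth_profile_unique N); [lra | lra | left; lra | | | |].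
  - intros x hx; apply hv2; lra.
  - intros x hx; apply h3; [lra |]; left; now apply h3r.
  - rewrite h3c; [| lra | apply h3r; lra].
    unfold middle; fold mu; fold log_match; rewrite hwm, (Rplus_comm log_match); reflexivity.
  - rewrite (is_derive_unique _ _ _ (middle_derive l match_point hl ltac:(lra))); fold mu.
    fold log_match; rewrite (Rplus_comm log_match).
    assert (htr : Rabs (1 - / match_point) < cone_radius) by (apply h3r; lra).
    assert (hd3 : is_derive v3 match_point (Rpower match_point (2 / 3)
      * (a * (cone_der N s (1 - / match_point) / match_point ^ 2)
         + 2 / 3 * (a * cone_fun N s (1 - / match_point)) / match_point))).
    { apply (is_derive_ext_loc
        (fun x => Rpower x (2 / 3) * (a * cone_fun N s (1 - / x)))).
      - assert (q1 : 0 < match_point) by lra; assert (q2 : match_point < cap_level) by lra.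
        generalize (filter_and _ _ (open_gt 0 match_point q1)
                                   (open_lt cap_level match_point q2)).
        apply filter_imp; intros z [z1 z2]; rewrite h3c; [reflexivity | exact z1 |].
        assert (1 < / z) by (rewrite <- Rinv_1; apply Rinv_lt_contravar; lra).
        rewrite cone_radius_eq; lra.
      - apply (scaled_derive (fun x => a * cone_fun N s (1 - / x))); [lra |].
        apply cone_variable_derive_comp; [lra |].
        exact (proj1 (cone_derive N hN hD s _ (proj1 hs) htr)). }
    rewrite (is_derive_unique _ _ _ hd3), hwm, hP, hmi.
    replace (1 - (1 - match_t)) with match_t by ring.
    rewrite <- hmi; field; lra. }
set (m1 := 21 / 20 * xa); set (m2 := (match_point + cap_level) / 2).
assert (hm1 : xa < m1 < 11 / 10 * xa) by (unfold m1; lra).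
assert (hm2 : match_point < m2 < cap_level) by (unfold m2; lra).
assert (hm12 : m1 < m2) by lra; assert (hm10 : 0 < m1) by lra.
assert (hloc : forall u z y, u < z -> z < y -> locally z (fun x => u <= x <= y)).
{ intros u z y h1 h2.
  generalize (filter_and _ _ (open_gt u z h1) (open_lt y z h2)).
  apply filter_imp; intros t [t1 t2]; lra. }
exists (glue m2 (glue m1 v1 (middle l)) v3); split; [| split; [| split; [| split]]].
- intros x hx; apply glue_smooth_profile.
  + generalize (filter_and _ _ (hloc _ _ _ (proj1 hm2) (proj2 hm2)) (open_gt m1 m2 hm12)).
    apply filter_imp; intros z [z1 z2]; rewrite glue_right by lra; now apply heq23.
  + intros hx2; apply glue_smooth_profile.
    * generalize (hloc _ _ _ (proj1 hm1) (proj2 hm1)).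
      apply filter_imp; exact heq12.
    * intros hx1; apply hv1; lra.
    * intros hx1; apply hv2; lra.
  + intros hx2; apply h3; [lra |].
    destruct (Rlt_dec 1 x) as [h1|h1]; [now right | left].
    assert (i1 : / x <= / match_point) by (apply Rinv_le_contravar; lra).
    assert (i2 : 1 <= / x) by (rewrite <- Rinv_1; apply Rinv_le_contravar; lra).
    unfold match_t in *; rewrite cone_radius_eq in *; apply Rabs_def1; lra.
- rewrite !glue_left by lra; unfold v1.
  replace (0 ^ 2 / c ^ 3) with 0 by (field; lra).
  rewrite centre_coef_zero; ring.
- rewrite (Derive_ext_loc _ v1).
  + rewrite (proj2 (hv1 0 ltac:(lra))); field; lra.
  + generalize (open_lt m1 0 hm10); apply filter_imp; intros z hz.
    rewrite !glue_left by lra; reflexivity.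
- apply (is_lim_ext_loc (fun x => v3 x / (b * Rpower x (2 / 3)))); [| exact h3l].
  exists m2; intros x hx; rewrite glue_right by lra; reflexivity.
- intros x hx; rewrite glue_left by lra; unfold glue.
  destruct (Rlt_dec x m1) as [h1|h1]; [apply heq12; fold xa in hx; lra | reflexivity].
Qed.

(** The graph that the spiral meets consists of the Cauchy data of the solutions
    regular at the cone.  For large [l] the meeting point is close to the singular
    solution, where those solutions continue to infinity. *)
Lemma connections :
  exists lmin, 0 < lmin /\ forall l0, lmin <= l0 ->
  exists l (v : R -> R) b, l0 <= l /\ 0 < b /\
    (forall x, 0 <= x -> smooth_profile_at N v x) /\
    v 0 = exp (- (2 / 3) * l) /\ Derive v 0 = 0 /\
    is_lim (fun x => v x / (b * Rpower x (2 / 3))) p_infty 1 /\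
    (forall x, exp (start - l) <= x <= match_point -> v x = middle l x).
Proof.
assert (hcr := cap_level_range).
destruct (exterior_solution N a hN ha hak hD) as (e & he & hext).
destruct (cone_inverse N a hN ha hD) as (S & hS0 & hS & hSl).
assert (hmt := match_t_bounds).
set (q0 := Rmin (a / 20) (a / 2 * e)).
assert (hq0 : 0 < q0).
{ apply Rmin_glb_lt; [lra |]; apply Rmult_lt_0_compat; lra. }
assert (hq1 : q0 <= a / 20) by apply Rmin_l.
assert (hq2 : q0 <= a / 2 * e) by apply Rmin_r.
set (G := fun q => a * (1 - match_t) * cone_der N (S (clamp (- q0) q0 q)) match_t).
assert (hcl : forall q, Rabs (clamp (- q0) q0 q) <= a / 20).
{ intros q; assert (h := clamp_bounds (- q0) q0 q ltac:(lra)); apply Rabs_le; lra. }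
set (K := a * (1 - match_t) * (200 / cone_radius * (2 / a))).
assert (hK : 0 <= K).
{ unfold K; apply Rmult_le_pos; [apply Rmult_le_pos; lra |].
  rewrite cone_radius_eq; apply Rmult_le_pos; [lra |].
  apply Rdiv_le_0_compat; lra. }
assert (hG : forall y z, Rabs (G y - G z) <= K * Rabs (y - z)).
{ intros y z; unfold G.
  rewrite <- Rmult_minus_distr_l, Rabs_mult, (Rabs_pos_eq (a * _))
    by (apply Rmult_le_pos; lra).
  unfold K; rewrite (Rmult_assoc (a * (1 - match_t))); apply Rmult_le_compat_l; [apply Rmult_le_pos; lra |].
  destruct (hS _ (hcl y)) as [sy _]; destruct (hS _ (hcl z)) as [sz _].
  eapply Rle_trans.
  { apply cone_der_lipschitz; auto; try lra.
    unfold match_t; rewrite Rabs_Ropp, Rabs_pos_eq; rewrite cone_radius_eq; lra. }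
  rewrite (Rmult_assoc (200 / cone_radius)).
  apply Rmult_le_compat_l; [rewrite cone_radius_eq; lra |].
  eapply Rle_trans; [apply hSl; apply hcl |].
  apply Rmult_le_compat_l; [apply Rdiv_le_0_compat; lra |].
  unfold clamp; eapply Rle_trans; [apply Rmax_lipschitz | apply Rmin_lipschitz]. }
assert (hG0 : G 0 = 0).
{ unfold G; rewrite clamp_id, hS0 by lra.
  rewrite (proj2 (cone_equilibrium N hN hD match_t)); ring. }
destruct (family_near_equilibrium N hN a ha hak cap_level hcr W P hWP (q0 ^ 2))
  as (sg0 & mu0 & hsg & hmu0 & hnear); [now apply pow_lt |].
set (lmin := Rmax 1 (Rmax (sg0 + 1 - log_match) (- ln mu0 / 2))).
assert (m1 := Rmax_l 1 (Rmax (sg0 + 1 - log_match) (- ln mu0 / 2))).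
assert (m2 := Rmax_r 1 (Rmax (sg0 + 1 - log_match) (- ln mu0 / 2))).
assert (m3 := Rmax_l (sg0 + 1 - log_match) (- ln mu0 / 2)).
assert (m4 := Rmax_r (sg0 + 1 - log_match) (- ln mu0 / 2)).
fold lmin in m1, m2.
exists lmin; split; [lra |]; intros l0 hl0.
destruct (spiral_meets_graph N a cap_level W P hN ha hak hcr hWP log_match G K l0
  hK hG hG0) as (l & hl & hmatch); [lra | lra |].
set (mu := exp (-2 * l)) in *; set (q := W mu (l + log_match) - a) in *.
assert (hmu : 0 <= mu <= mu0).
{ split; [left; apply exp_pos |]; unfold mu; rewrite <- (exp_ln mu0) by lra.
  apply exp_le; lra. }
destruct (hnear mu (l + log_match) hmu ltac:(lra)) as [hq _]; fold q in hq.
assert (hqa : Rabs q <= q0).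
{ rewrite <- (Rabs_pos_eq q0) by lra; apply Rsqr_le_abs_0; unfold Rsqr; simpl in hq; lra. }
assert (hqb : - q0 <= q <= q0) by (apply Rabs_le_between; exact hqa).
destruct (hS q ltac:(lra)) as [hs1 hs2].
assert (hse : Rabs (S q - 1) <= e).
{ rewrite <- hS0; eapply Rle_trans; [apply hSl; [lra | rewrite Rabs_R0; lra] |].
  rewrite Rminus_0_r; apply Rle_trans with (2 / a * (a / 2 * e)); [| right; field; lra].
  apply Rmult_le_compat_l; [apply Rdiv_le_0_compat |]; lra. }
destruct (hext (S q) hse) as (v3 & b & hb & hv3 & hv3c & hv3l).
destruct (matched_profile l (S q) v3 b) as (v & hv); try assumption; try lra.
- fold mu; unfold q in hs2; fold q in hs2; unfold q in hs2 at 2; lra.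
- fold mu; rewrite hmatch; unfold G; now rewrite clamp_id by exact hqb.
- exists l, v, b; split; [exact hl |]; split; [exact hb | exact hv].
Qed.

End Assembly.

Lemma smooth_profile_global n v c :
  (forall x, 0 <= x -> smooth_profile_at (INR n) v x) ->
  v 0 = c -> Derive v 0 = 0 -> smooth_global_solution n c v.
Proof.
intros hv h0 h1; exists (Derive_n v); split; [split |].
- intros x _; reflexivity.
- intros j x hx; destruct (hv x hx) as [_ [hs _]].
  assert (hd : derivable_pt_lim (Derive_n v j) x (Derive_n v (S j) x)).
  { apply is_derive_Reals, Derive_correct, (hs (S j)). }
  intros eps heps; destruct (hd eps heps) as [dl hdl].
  exists dl; split; [apply cond_pos |].
  intros y [[hy hne] hyx].
  unfold R_met, Rdist in *; simpl in *; unfold Rdist in *.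
  assert (h := hdl (y - x) ltac:(lra) hyx).
  replace (x + (y - x)) with y in h by ring; exact h.
- split; [intros x hx; now apply hv |]; split; [| now split].
  intros x hx; apply (hv x ltac:(lra)); exact hx.
Qed.

Lemma a_coef_cube n : (2 <= n)%nat -> stiffness (INR n) * a_coef n ^ 3 = 1.
Proof.
intros hn; assert (hn2 : 2 <= INR n) by (replace 2 with (INR 2) by reflexivity; now apply le_INR).
unfold a_coef, stiffness; set (k := 2 / 3 * (INR n - 4 / 3)).
assert (hk : 0 < k) by (unfold k; lra).
rewrite <- Rpower_pow by apply exp_pos; rewrite Rpower_mult.
replace (- (1 / 3) * INR 3) with (- (1)) by (simpl; field).
rewrite Rpower_Ropp, Rpower_1 by exact hk; field; lra.
Qed.

Lemma c_star_gt_one : 1 < c_star.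
Proof.
unfold c_star, Rpower; rewrite <- exp_0 at 1; apply exp_increasing.
apply Rmult_lt_0_compat; [lra |]; rewrite <- ln_1 at 1; apply ln_increasing; lra.
Qed.

Theorem theorem2p1 (n : nat) (hn : (2 <= n <= 7)%nat) :
  exists (c : nat -> R) (v : nat -> R -> R),
    (* (a) *)
    ( (forall i j, c i = c j -> i = j) /\
      discrete_set (fun x => exists j, x = c j) /\
      (forall j, 0 < c j < c_star) /\
      is_lim_seq c 0 /\
      (forall j, smooth_global_solution n (c j) (v j) /\ non_constant (v j)) ) /\
    (* (b) *)
    ( intermediate_asymptotics c v (a_coef n) /\
      exists b : nat -> R, forall j, asymptotics_at_infinity (v j) (b j) ).
Proof.
set (N := INR n); set (a := a_coef n).
assert (hN : 2 <= N <= 7).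
{ unfold N; replace 2 with (INR 2) by reflexivity.
  replace 7 with (INR 7) by (simpl; ring); split; apply le_INR; lia. }
assert (ha : 0 < a) by apply exp_pos.
assert (hak : stiffness N * a ^ 3 = 1) by (apply a_coef_cube; lia).
assert (hD := cone_denominators n hn); fold N in hD.
assert (hcr := cap_level_range); assert (hmp := match_point_bounds).
destruct (centre_family_exists N hN cap_level hcr) as (W & P & hWP).
destruct (connections N a hN ha hak hD W P hWP) as (lmin & hlmin & hconn).
(* Keeping [w] within [a / 2] of [a] at [match_point] makes [v] larger there than at
   the centre, hence not constant. *)
destruct (family_near_equilibrium N hN a ha hak cap_level hcr W P hWP ((a / 2) ^ 2))
  as (sg1 & mu1 & hsg1 & hmu1 & hnear1); [apply pow_lt; lra |].
set (B := Rpower match_point (2 / 3) * (a / 2)).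
assert (hB : 0 < B) by (apply Rmult_lt_0_compat; [apply exp_pos | lra]).
(* The last entry forces [c < B]. *)
set (lbase := Rmax lmin (Rmax (sg1 - log_match) (Rmax (- ln mu1 / 2) (- (3 / 2) * ln B + 1)))).
assert (b1 : lmin <= lbase) by apply Rmax_l.
assert (b2 := Rmax_r lmin (Rmax (sg1 - log_match) (Rmax (- ln mu1 / 2) (- (3 / 2) * ln B + 1)))).
fold lbase in b2.
assert (b3 := Rmax_l (sg1 - log_match) (Rmax (- ln mu1 / 2) (- (3 / 2) * ln B + 1))).
assert (b4 := Rmax_r (sg1 - log_match) (Rmax (- ln mu1 / 2) (- (3 / 2) * ln B + 1))).
assert (b5 := Rmax_l (- ln mu1 / 2) (- (3 / 2) * ln B + 1)).
assert (b6 := Rmax_r (- ln mu1 / 2) (- (3 / 2) * ln B + 1)).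
destruct (functional_choice (fun (l0 : R) (r : R * (R -> R) * R) => lmin <= l0 ->
  let '(l, v, b) := r in l0 <= l /\ 0 < b /\
    (forall x, 0 <= x -> smooth_profile_at N v x) /\
    v 0 = exp (- (2 / 3) * l) /\ Derive v 0 = 0 /\
    is_lim (fun x => v x / (b * Rpower x (2 / 3))) p_infty 1 /\
    (forall x, exp (start - l) <= x <= match_point -> v x = middle W l x)))
  as [pick hpick].
{ intros l0; destruct (classic (lmin <= l0)) as [h|h].
  - destruct (hconn l0 h) as (l & v & b & hh); exists (l, v, b); intros _; exact hh.
  - exists (0, (fun _ => 0), 0); intros h'; contradiction. }
set (next := fun l0 => fst (fst (pick l0))).
set (prev := fix prev (j : nat) : R :=
  match j with O => lbase | S i => next (prev i) + 1 end).
set (ell := fun j => next (prev j)).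
set (v := fun j => snd (fst (pick (prev j)))).
set (b := fun j => snd (pick (prev j))).
assert (hprev : forall j, lbase + INR j <= prev j).
{ intros j; induction j as [|j IH]; [simpl; lra |].
  rewrite S_INR; simpl prev.
  assert (hp := hpick (prev j)); unfold next.
  destruct (pick (prev j)) as [[l w] b']; simpl.
  destruct hp as [hp _]; [generalize (pos_INR j); lra | lra]. }
assert (hsol : forall j, prev j <= ell j /\ 0 < b j /\
    (forall x, 0 <= x -> smooth_profile_at N (v j) x) /\
    v j 0 = exp (- (2 / 3) * ell j) /\ Derive (v j) 0 = 0 /\
    is_lim (fun x => v j x / (b j * Rpower x (2 / 3))) p_infty 1 /\
    (forall x, exp (start - ell j) <= x <= match_point -> v j x = middle W (ell j) x)).
{ intros j; assert (hp := hpick (prev j)); unfold ell, v, b, next.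
  destruct (pick (prev j)) as [[l w] b']; simpl; apply hp.
  generalize (hprev j) (pos_INR j); lra. }
assert (hstep : forall j, ell j + 1 <= ell (S j)) by (intros j; apply (hsol (S j))).
assert (hge : forall j, lbase + INR j <= ell j)
  by (intros j; generalize (hprev j) (proj1 (hsol j)); lra).
assert (hmono : forall i j, (i < j)%nat -> ell i + 1 <= ell j).
{ intros i j hij; induction j as [|j IH]; [lia |].
  destruct (Nat.eq_dec i j) as [->|hne]; [generalize (hstep j); lra |].
  generalize (hstep j) (IH ltac:(lia)); lra. }
set (c := fun j => exp (- (2 / 3) * ell j)).
assert (hcpos : forall j, 0 < c j) by (intros j; apply exp_pos).
assert (hcdec : forall i j, (i < j)%nat -> c j <= 3 / 5 * c i).
{ intros i j hij; apply Rle_trans with (exp (- (2 / 3)) * c i).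
  - unfold c; rewrite <- exp_plus; apply exp_le; generalize (hmono i j hij); lra.
  - apply Rmult_le_compat_r; [left; apply hcpos |].
    rewrite exp_Ropp; replace (3 / 5) with (/ (1 + 2 / 3)) by field.
    apply Rinv_le_contravar; [lra |]; left; apply exp_ineq1; lra. }
assert (hc1 : forall j, 0 < c j < 1).
{ intros j; split; [apply exp_pos |]; unfold c; rewrite <- exp_0; apply exp_increasing.
  generalize (hge j) (pos_INR j); lra. }
assert (hlim : is_lim_seq c 0).
{ apply is_lim_seq_spec; intros eps; assert (he := cond_pos eps).
  destruct (INR_unbounded (- (3 / 2) * ln eps)) as [J hJ].
  exists J; intros j hj; rewrite Rminus_0_r, Rabs_pos_eq by (left; apply hc1).
  rewrite <- (exp_ln eps) by exact he; apply exp_increasing.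
  assert (INR J <= INR j) by now apply le_INR.
  generalize (hge j); lra. }
exists c, v; split; [split; [| split; [| split; [| split]]] | split].
- intros i j hij; destruct (Nat.lt_trichotomy i j) as [h|[h|h]]; [| exact h |].
  + generalize (hcdec i j h) (hcpos i); lra.
  + generalize (hcdec j i h) (hcpos j); lra.
- intros x [j ->]; exists (c j / 4); split; [generalize (hcpos j); lra |].
  intros y [i ->] hy; apply Rabs_lt_between in hy.
  destruct (Nat.lt_trichotomy i j) as [h|[h|h]]; [| now rewrite h |].
  + generalize (hcdec i j h) (hcpos i); lra.
  + generalize (hcdec j i h) (hcpos j); lra.
- intros j; generalize (hc1 j) c_star_gt_one; lra.
- exact hlim.
- intros j; destruct (hsol j) as (s1 & s2 & s3 & s4 & s5 & s6 & s7); split.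
  + apply smooth_profile_global; auto.
  + intros [z hz].
    assert (hmu : 0 <= exp (-2 * ell j) <= mu1).
    { split; [left; apply exp_pos |]; rewrite <- (exp_ln mu1) by lra; apply exp_le.
      generalize (hge j) (pos_INR j); lra. }
    destruct (hnear1 (exp (-2 * ell j)) (log_match + ell j) hmu) as [hq _].
    { generalize (hge j) (pos_INR j); lra. }
    assert (hwa : a / 2 <= W (exp (-2 * ell j)) (log_match + ell j)).
    { assert (hab : Rabs (W (exp (-2 * ell j)) (log_match + ell j) - a) <= a / 2).
      { rewrite <- (Rabs_pos_eq (a / 2)) by lra; apply Rsqr_le_abs_0.
        unfold Rsqr; simpl in hq; lra. }
      apply Rabs_le_between in hab; lra. }
    assert (hvm : v j match_point = middle W (ell j) match_point).
    { apply s7; split; [| lra].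
      rewrite <- (exp_ln match_point) by lra; apply exp_le; fold log_match.
      generalize (hge j) (pos_INR j); lra. }
    assert (hcB : c j < B).
    { rewrite <- (exp_ln B) by exact hB; apply exp_increasing.
      generalize (hge j) (pos_INR j); lra. }
    assert (hBv : B <= v j match_point).
    { rewrite hvm; unfold middle, B; fold log_match.
      apply Rmult_le_compat_l; [left; apply exp_pos | exact hwa]. }
    rewrite (hz match_point) in hBv by lra; rewrite (hz 0) in s4 by lra.
    unfold c in hcB; lra.
- intros eps heps.
  destruct (family_near_equilibrium N hN a ha hak cap_level hcr W P hWP ((a * eps / 2) ^ 2))
    as (sg0 & mu0 & hsg & hmu0 & hnear); [apply pow_lt; nra |].
  destruct (INR_unbounded (- ln mu0 / 2)) as [J hJ].
  exists (exp sg0), match_point, J.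
  split; [apply exp_pos |]; split; [lra |].
  intros j x hj hx; destruct (hsol j) as (s1 & s2 & s3 & s4 & s5 & s6 & s7).
  assert (hcl : Rpower (c j) (3 / 2) = exp (- ell j)).
  { unfold Rpower, c; rewrite ln_exp; f_equal; field. }
  rewrite hcl, <- exp_plus in hx.
  assert (hx0 : 0 < x) by (generalize (exp_pos (sg0 + - ell j)); lra).
  assert (hlx : sg0 <= ln x + ell j).
  { assert (h : sg0 + - ell j <= ln x).
    { rewrite <- (ln_exp (sg0 + - ell j)).
      destruct (Req_dec (exp (sg0 + - ell j)) x) as [->|hne]; [lra |].
      left; apply ln_increasing; [apply exp_pos | lra]. }
    lra. }
  rewrite s7.
  2: { split; [| lra]; apply Rle_trans with (exp (sg0 + - ell j)); [| lra].
       apply exp_le; lra. }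
  assert (hmu : 0 <= exp (-2 * ell j) <= mu0).
  { split; [left; apply exp_pos |]; rewrite <- (exp_ln mu0) by lra; apply exp_le.
    assert (INR J <= INR j) by now apply le_INR.
    generalize (hge j); lra. }
  destruct (hnear _ (ln x + ell j) hmu hlx) as [hq _].
  unfold middle; set (w := W (exp (-2 * ell j)) (ln x + ell j)) in *.
  assert (hr : 0 < Rpower x (2 / 3)) by apply exp_pos.
  fold a; replace (Rpower x (2 / 3) * w / (a * Rpower x (2 / 3)) - 1) with ((w - a) / a)
    by (field; lra).
  assert (hab : Rabs (w - a) <= a * eps / 2).
  { rewrite <- (Rabs_pos_eq (a * eps / 2)) by nra; apply Rsqr_le_abs_0.
    unfold Rsqr; simpl in hq; lra. }
  unfold Rdiv; rewrite Rabs_mult, (Rabs_pos_eq (/ a)) by (left; now apply Rinv_0_lt_compat).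
  apply (Rmult_lt_reg_r a); [exact ha |].
  rewrite Rmult_assoc, Rinv_l, Rmult_1_r by lra; nra.
- exists b; intros j; destruct (hsol j) as (s1 & s2 & s3 & s4 & s5 & s6 & s7).
  split; [lra | exact s6].
Qed.
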